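(* Let $M$ be a compact manifold whose fundamental group $\pi_1(M)$ has exponential growth. Then for any riemannian metric on $M$, the blocking cost function $t\mapsto s(t)$ of $M$ is either infinite (that is, $s(t)=\infty$ for some $t>0$) or grows at least exponentially, that is, $\limsup_{t\to\infty}\frac{\log s(t)}{t}>0$ (the value $+\infty$ being allowed).
   Context: All manifolds are closed (compact, without boundary), connected and $C^\infty$; riemannian metrics are $C^\infty$. A geodesic from $x$ to $y$ is an oriented geodesic segment $\gamma:[0,L]\to M$ parametrized by arclength, with $\gamma(0)=x$, $\gamma(L)=y$ and length $L=|\gamma|>0$; $x=y$ is allowed. It passes through $z\in M$ if $z$ is an interior point of it, i.e. $\gamma(u)=z$ for some $0<u<L$. For $x,y\in M$ and $t>0$ let $\Gamma_t(x,y)$ be the set of geodesics from $x$ to $y$ of length at most $t$ that pass through neither $x$ nor $y$. A finite set $B\subset M\setminus\{x,y\}$ is a blocking set for $\Gamma_t(x,y)$ if every $\gamma\in\Gamma_t(x,y)$ passes through a point of $B$. The blocking threshold $s_t(x,y)\le\infty$ is the minimal cardinality of a blocking set for $\Gamma_t(x,y)$ ($\infty$ if there is none), and the blocking cost function is $s(t)=\sup_{x,y\in M}s_t(x,y)\le\infty$. A finitely generated group $G$ with finite generating set $A$ has exponential growth if the number $w(n)$ of elements of word length at most $n$ with respect to $A$ satisfies $\limsup_{n\to\infty}\frac1n\log w(n)>0$; this does not depend on $A$. *)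

(* Defs.v *)
From HB Require Import structures.
From mathcomp Require Import all_boot all_order all_algebra generic_quotient finmap.
From mathcomp Require Import all_classical all_reals all_analysis.
From mathcomp Require Import homotopy lra.

Set Implicit Arguments.
Unset Strict Implicit.
Unset Printing Implicit Defensive.

Import Order.TTheory GRing.Theory Num.Theory.
Import numFieldNormedType.Exports.

Local Open Scope classical_set_scope.
Local Open Scope ring_scope.

Definition unit_interval (R : realType) : Type :=
  set_type (`[0, 1]%classic : set R).

HB.instance Definition _ (R : realType) := Topological.copy (unit_interval R)
  (set_type (`[0, 1]%classic : set R)).

Section UnitInterval.
Variable R : realType.
Notation I := (unit_interval R).

Definition clamp (r : R) : R := Num.max 0 (Num.min 1 r).

Lemma clamp_itv r : clamp r \in (`[0, 1]%classic : set R).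
Proof.
by rewrite inE /= in_itv /= /clamp le_max lexx /= ge_max ler01 ge_min lexx.
Qed.

Lemma clamp_id r : 0 <= r <= 1 -> clamp r = r.
Proof. by case/andP => r0 r1; rewrite /clamp min_r // max_r. Qed.

Lemma clamp_le0 r : r <= 0 -> clamp r = 0.
Proof. by move=> r0; rewrite /clamp max_l // ge_min r0 orbT. Qed.

Lemma clamp_ge1 r : 1 <= r -> clamp r = 1.
Proof. by move=> r0; rewrite /clamp min_l // max_r. Qed.

Definition to_I (r : R) : I := exist _ (clamp r) (clamp_itv r).

Definition of_I (t : I) : R := \val t.

Lemma of_IP t : 0 <= of_I t <= 1.
Proof. by have := set_valP t; rewrite /= in_itv. Qed.

Lemma to_IK r : of_I (to_I r) = clamp r. Proof. by []. Qed.

Lemma of_IK t : to_I (of_I t) = t.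
Proof. by apply: val_inj => /=; exact/clamp_id/of_IP. Qed.

Lemma to_I0 r : r <= 0 -> to_I r = to_I 0.
Proof. by move=> r0; apply: val_inj; rewrite /= !clamp_le0. Qed.

Lemma to_I1 r : 1 <= r -> to_I r = to_I 1.
Proof. by move=> r0; apply: val_inj; rewrite /= !clamp_ge1. Qed.

Lemma to_I_neq : to_I 0 != to_I 1.
Proof.
apply/eqP => /(congr1 of_I); rewrite !to_IK clamp_le0 // clamp_ge1 //.
by move/eqP; rewrite eq_sym oner_eq0.
Qed.

HB.instance Definition _ := isBiPointed.Build I to_I_neq.

Lemma zeroI : (zero : I) = to_I 0. Proof. by []. Qed.
Lemma oneI : (one : I) = to_I 1. Proof. by []. Qed.

Lemma of_I_continuous : continuous of_I.
Proof. exact: initial_continuous. Qed.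


Lemma clamp_continuous : continuous clamp.
Proof.
move=> r; apply: (@continuous_max R R (cst 0) (Num.min 1)); first exact: cvg_cst.
by apply: (@continuous_min R R (cst 1) id); [exact: cvg_cst|exact: cvg_id].
Qed.

Lemma to_I_continuous : continuous to_I.
Proof.
apply/continuousP => _ [A oA <-].
by rewrite -comp_preimage; move/continuousP : clamp_continuous; apply.
Qed.

End UnitInterval.

Section Continuity.
Context {R : realType} {X : topologicalType}.
Implicit Types f g : X -> R.

Lemma cont_add f g : continuous f -> continuous g ->
  continuous (fun x => f x + g x).
Proof. by move=> cf cg x; apply: cvgD; [exact: cf|exact: cg]. Qed.

Lemma cont_opp f : continuous f -> continuous (fun x => - f x).
Proof. by move=> cf x; apply: cvgN; exact: cf. Qed.

Lemma cont_mul f g : continuous f -> continuous g ->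
  continuous (fun x => f x * g x).
Proof. by move=> cf cg x; apply: cvgM; [exact: cf|exact: cg]. Qed.

Lemma cont_min f g : continuous f -> continuous g ->
  continuous (fun x => Num.min (f x) (g x)).
Proof. by move=> cf cg x; exact: (continuous_min (cf x) (cg x)). Qed.

Lemma cont_max f g : continuous f -> continuous g ->
  continuous (fun x => Num.max (f x) (g x)).
Proof. by move=> cf cg x; exact: (continuous_max (cf x) (cg x)). Qed.

Lemma cont_comp {Y Z : topologicalType} (f : Y -> Z) (g : X -> Y) :
  continuous f -> continuous g -> continuous (fun x => f (g x)).
Proof. by move=> cf cg x; apply: continuous_comp; [exact: cg|exact: cf]. Qed.

Lemma cont_pair {Y Z : topologicalType} (f : X -> Y) (g : X -> Z) :
  continuous f -> continuous g -> continuous (fun x => (f x, g x)).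
Proof. by move=> cf cg x; exact: (cvg_pair (cf x) (cg x)). Qed.

Lemma cont_glue {Y : topologicalType} (h : X -> R) (c : R) (f g : X -> Y) :
  continuous h -> continuous f -> continuous g ->
  (forall x, h x = c -> f x = g x) ->
  continuous (fun x => if h x <= c then f x else g x).
Proof.
move=> ch cf cg fg x A nA.
suff : nbhs x [set y | A (if h y <= c then f y else g y)] by [].
move: nA => /=; case: (ltgtP (h x) c) => hx nA.
- have hn : \forall y \near x, h y < c by apply: (ch x [set r | r < c]); exact: lt_nbhsl.
  apply: (@filterS _ (nbhs x) _ _ _ _ (filterI hn (cf x _ nA))).
  move=> y [yc Ay] /=.
  by rewrite (ltW yc).
- have hn : \forall y \near x, c < h y by apply: (ch x [set r | c < r]); exact: lt_nbhsr.
  apply: (@filterS _ (nbhs x) _ _ _ _ (filterI hn (cg x _ nA))).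
  move=> y [yc Ay] /=.
  by rewrite leNgt yc.
- have fA : nbhs x [set y | A (f y)] := cf x _ nA.
  have gA : nbhs x [set y | A (g y)].
    by apply: (cg x A); rewrite -(fg _ hx).
  apply: (@filterS _ (nbhs x) _ _ _ _ (filterI fA gA)) => y [fy gy] /=.
  by case: (h y <= c).
Qed.

End Continuity.

Ltac cont := repeat first [ exact: cst_continuous
  | by move=> ?; exact: cvg_id | by move=> ?; exact: cvg_fst
  | by move=> ?; exact: cvg_snd | exact: of_I_continuous
  | exact: to_I_continuous | exact: clamp_continuous | exact: cts_fun
  | assumption
  | apply: cont_add | apply: cont_opp | apply: cont_mul | apply: cont_min
  | apply: cont_max | apply: cont_pair ].

Section Homotopy.
Context {R : realType} {M : topologicalType}.
Local Notation I := (unit_interval R).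
Implicit Types x y z : M.

Definition homotopic x y (p q : {path I from x to y in M}) : Prop :=
  exists H : I * I -> M, [/\ continuous H,
    forall t, H (zero, t) = p t, forall t, H (one, t) = q t,
    forall s, H (s, zero) = x & forall s, H (s, one) = y].

Lemma homotopicI x y (p q : {path I from x to y in M}) (K : R * R -> M) :
  continuous K ->
  (forall t, 0 <= t <= 1 -> K (0, t) = p (to_I t)) ->
  (forall t, 0 <= t <= 1 -> K (1, t) = q (to_I t)) ->
  (forall s, 0 <= s <= 1 -> K (s, 0) = x) ->
  (forall s, 0 <= s <= 1 -> K (s, 1) = y) -> homotopic p q.
Proof.
move=> cK K0 K1 Kx Ky; exists (fun u => K (of_I u.1, of_I u.2)).
have I0 : of_I (zero : I) = 0 by rewrite zeroI to_IK clamp_le0.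
have I1 : of_I (one : I) = 1 by rewrite oneI to_IK clamp_ge1.
split=> [|t|t|s|s] /=.
- apply: cont_comp => //; apply: cont_pair.
    by apply: cont_comp; cont.
  by apply: cont_comp; cont.
- by rewrite I0 K0 ?of_IP // of_IK.
- by rewrite I1 K1 ?of_IP // of_IK.
- by rewrite I0 Kx ?of_IP.
- by rewrite I1 Ky ?of_IP.
Qed.

Lemma path_le0 x y (p : {path I from x to y in M}) t : t <= 0 ->
  p (to_I t) = x.
Proof. by move=> t0; rewrite to_I0 // -zeroI path_zero. Qed.

Lemma path_ge1 x y (p : {path I from x to y in M}) t : 1 <= t ->
  p (to_I t) = y.
Proof. by move=> t0; rewrite to_I1 // -oneI path_one. Qed.

Lemma homotopicE x y (p q : {path I from x to y in M}) : homotopic p q ->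
  exists K : R * R -> M, [/\ continuous K,
    forall t, K (0, t) = p (to_I t), forall t, K (1, t) = q (to_I t),
    forall s t, t <= 0 -> K (s, t) = x & forall s t, 1 <= t -> K (s, t) = y].
Proof.
move=> [H [cH H0 H1 Hx Hy]]; exists (fun u => H (to_I u.1, to_I u.2)).
split=> [|t|t|s t t0|s t t1] /=.
- apply: cont_comp => //; apply: cont_pair.
    by apply: cont_comp; cont.
  by apply: cont_comp; cont.
- by rewrite -zeroI H0.
- by rewrite -oneI H1.
- by rewrite (to_I0 t0) -zeroI Hx.
- by rewrite (to_I1 t1) -oneI Hy.
Qed.

Lemma homotopic_reparam x y (p q : {path I from x to y in M}) (f : R -> M)
    (a b : R -> R) : continuous f -> continuous a -> continuous b ->
  a 0 = b 0 -> a 1 = b 1 ->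
  (forall t, 0 <= t <= 1 -> p (to_I t) = f (a t)) ->
  (forall t, 0 <= t <= 1 -> q (to_I t) = f (b t)) -> homotopic p q.
Proof.
move=> cf ca cb ab0 ab1 pf qf.
apply: (@homotopicI _ _ _ _
    (fun u => f ((1 - u.1) * a u.2 + u.1 * b u.2))) => [|t t01|t t01|s s01|s s01] /=.
- have ca2 : continuous (fun u : R * R => a u.2) by apply: cont_comp; cont.
  have cb2 : continuous (fun u : R * R => b u.2) by apply: cont_comp; cont.
  by apply: cont_comp; cont.
- by rewrite pf // subr0 mul1r mul0r addr0.
- by rewrite qf // subrr mul0r mul1r add0r.
- rewrite -ab0 -mulrDl subrK mul1r -pf ?lexx ?ler01 //; exact: path_le0.
- rewrite -ab1 -mulrDl subrK mul1r -pf ?lexx ?ler01 //; exact: path_ge1.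
Qed.

Lemma homotopic_refl x y (p : {path I from x to y in M}) : homotopic p p.
Proof.
apply: (@homotopic_reparam _ _ _ _ (fun t => p (to_I t)) id id) => //.
- by apply: cont_comp; cont.
- by cont.
- by cont.
Qed.

Lemma homotopic_sym x y (p q : {path I from x to y in M}) :
  homotopic p q -> homotopic q p.
Proof.
case/homotopicE => K [cK K0 K1 Kx Ky].
apply: (@homotopicI _ _ _ _ (fun u => K (1 - u.1, u.2))) => [|t _|t _|s _|s _] /=.
- by apply: cont_comp; cont.
- by rewrite subr0.
- by rewrite subrr.
- exact: Kx.
- exact: Ky.
Qed.

Lemma homotopic_trans x y (p q r : {path I from x to y in M}) :
  homotopic p q -> homotopic q r -> homotopic p r.
Proof.
case/homotopicE => K [cK K0 K1 Kx Ky] /homotopicE[L [cL L0 L1 Lx Ly]].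
apply: (@homotopicI _ _ _ _ (fun u => if u.1 <= 2^-1 then K (2 * u.1, u.2)
    else L (2 * u.1 - 1, u.2))) => [|t _|t _|s _|s _] /=.
- apply: cont_glue; [by cont|by apply: cont_comp; cont|by apply: cont_comp; cont|].
  by move=> u ->; rewrite divff // subrr K1 L0.
- by rewrite ifT ?mulr0 //; lra.
- by rewrite ifF ?mulr1 ?addrK //; lra.
- by case: ifP => _; [exact: Kx|exact: Lx].
- by case: ifP => _; [exact: Ky|exact: Ly].
Qed.

Section Concatenation.
Context (x y z : M) (p : {path I from x to y in M}) (q : {path I from y to z in M}).

Definition path_cat_fun (t : I) : M :=
  if of_I t <= 2^-1 then p (to_I (2 * of_I t)) else q (to_I (2 * of_I t - 1)).

Lemma path_cat_continuous : continuous path_cat_fun.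
Proof.
have c1 : continuous (fun t : I => to_I (2 * of_I t)).
  by apply: cont_comp; cont.
have c2 : continuous (fun t : I => to_I (2 * of_I t - 1)).
  by apply: cont_comp; cont.
apply: cont_glue; [by cont|by apply: cont_comp; cont|by apply: cont_comp; cont|].
by move=> t ->; rewrite divff // subrr path_ge1 // path_le0.
Qed.

Lemma path_cat_zero : path_cat_fun zero = x.
Proof.
rewrite /path_cat_fun zeroI to_IK clamp_le0 // ifT; last by lra.
by rewrite path_le0 // mulr0.
Qed.

Lemma path_cat_one : path_cat_fun one = z.
Proof.
rewrite /path_cat_fun oneI to_IK clamp_ge1 // ifF; last by lra.
by rewrite path_ge1 //; lra.
Qed.

Definition path_cat : {path I from x to z in M} :=
  mk_path path_cat_continuous path_cat_zero path_cat_one.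

Lemma path_catE t : path_cat (to_I t) =
  if t <= 2^-1 then p (to_I (2 * t)) else q (to_I (2 * t - 1)).
Proof.
rewrite -[LHS]/(path_cat_fun (to_I t)) /path_cat_fun to_IK.
have [t0|t0] := leP t 0.
  rewrite clamp_le0 // !ifT; [|by lra|by lra].
  by rewrite !path_le0 //; lra.
have [t1|t1] := leP 1 t.
  rewrite clamp_ge1 // !ifF; [|by lra|by lra].
  by rewrite !path_ge1 //; lra.
by rewrite clamp_id //; lra.
Qed.

End Concatenation.

Section Inverse.
Context (x y : M) (p : {path I from x to y in M}).

Definition path_inv_fun (t : I) : M := p (to_I (1 - of_I t)).

Lemma path_inv_continuous : continuous path_inv_fun.
Proof.
have c1 : continuous (fun t : I => to_I (1 - of_I t)).
  by apply: cont_comp; cont.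
by apply: cont_comp; cont.
Qed.

Lemma path_inv_zero : path_inv_fun zero = y.
Proof. by rewrite /path_inv_fun zeroI to_IK clamp_le0 // path_ge1 // subr0. Qed.

Lemma path_inv_one : path_inv_fun one = x.
Proof. by rewrite /path_inv_fun oneI to_IK clamp_ge1 // path_le0 // subrr. Qed.

Definition path_inv : {path I from y to x in M} :=
  mk_path path_inv_continuous path_inv_zero path_inv_one.

Lemma path_invE t : path_inv (to_I t) = p (to_I (1 - t)).
Proof.
rewrite -[LHS]/(path_inv_fun (to_I t)) /path_inv_fun to_IK.
have [t0|t0] := leP t 0; first by rewrite clamp_le0 // !path_ge1 //; lra.
have [t1|t1] := leP 1 t; first by rewrite clamp_ge1 // !path_le0 //; lra.
by rewrite clamp_id //; lra.
Qed.

End Inverse.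

Definition path_cst x : {path I from x to x in M} := @cst I M x.

Lemma path_ext_continuous x y (p : {path I from x to y in M}) :
  continuous (fun t : R => p (to_I t)).
Proof. by apply: cont_comp; cont. Qed.

Lemma homotopic_cat x y z (p p' : {path I from x to y in M})
    (q q' : {path I from y to z in M}) :
  homotopic p p' -> homotopic q q' -> homotopic (path_cat p q) (path_cat p' q').
Proof.
case/homotopicE => K [cK K0 K1 Kx Ky] /homotopicE[L [cL L0 L1 Lx Ly]].
apply: (@homotopicI _ _ _ _ (fun u => if u.2 <= 2^-1 then K (u.1, 2 * u.2)
    else L (u.1, 2 * u.2 - 1))) => [|t _|t _|s _|s _] /=.
- apply: cont_glue; [by cont|by apply: cont_comp; cont|by apply: cont_comp; cont|].
  by case=> s t /= ->; rewrite Ky ?Lx // ?divff ?subrr.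
- by rewrite path_catE K0 L0.
- by rewrite path_catE K1 L1.
- by rewrite ifT ?Kx //; lra.
- by rewrite ifF ?Ly //; lra.
Qed.

Lemma homotopic_inv x y (p p' : {path I from x to y in M}) :
  homotopic p p' -> homotopic (path_inv p) (path_inv p').
Proof.
case/homotopicE => K [cK K0 K1 Kx Ky].
apply: (@homotopicI _ _ _ _ (fun u => K (u.1, 1 - u.2))) => [|t _|t _|s _|s _] /=.
- by apply: cont_comp; cont.
- by rewrite path_invE K0.
- by rewrite path_invE K1.
- by rewrite Ky // subr0.
- by rewrite Kx // subrr.
Qed.

Lemma path_catA x y z w (p : {path I from x to y in M})
    (q : {path I from y to z in M}) (r : {path I from z to w in M}) :
  homotopic (path_cat p (path_cat q r)) (path_cat (path_cat p q) r).
Proof.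
pose f t := if t <= 1 then p (to_I t)
  else if t <= 2 then q (to_I (t - 1)) else r (to_I (t - 2)).
apply: (@homotopic_reparam _ _ _ _ f (fun t => Num.max (2 * t) (4 * t - 1))
  (fun t => Num.min (4 * t) (2 * t + 1))).
- have cq : continuous (fun t : R => q (to_I (t - 1))).
    by apply: (@cont_comp R R M (fun t => q (to_I t)) (fun t => t - 1));
      [exact: path_ext_continuous|cont].
  have cr : continuous (fun t : R => r (to_I (t - 2))).
    by apply: (@cont_comp R R M (fun t => r (to_I t)) (fun t => t - 2));
      [exact: path_ext_continuous|cont].
  apply: cont_glue; [by cont|exact: path_ext_continuous| |].
    apply: cont_glue; [by cont|by []|by []|].
    by move=> t ->; rewrite path_ge1 ?path_le0 //; lra.
  move=> t ->; rewrite ifT; last by lra.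
  by rewrite (path_ge1 p) // (path_le0 q) //; lra.
- by cont.
- by cont.
- by rewrite /Num.max /Num.min; do 2 case: ifP; lra.
- by rewrite /Num.max /Num.min; do 2 case: ifP; lra.
- move=> t t01; rewrite path_catE /f; have [t1|t1] := leP t 2^-1.
    by rewrite max_l; [rewrite ifT //; lra|lra].
  rewrite max_r; last by lra.
  rewrite ifF; last by lra.
  rewrite path_catE; have [t2|t2] := leP t (3 / 4).
    rewrite !ifT; [|lra|lra]; by congr (q (to_I _)); lra.
  rewrite !ifF; [|lra|lra]; by congr (r (to_I _)); lra.
- move=> t t01; rewrite path_catE /f; have [t1|t1] := leP t 2^-1.
    rewrite min_l; last by lra.
    rewrite path_catE; have [t2|t2] := leP t (1 / 4).
      rewrite !ifT; [|lra|lra]; by congr (p (to_I _)); lra.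
    rewrite [LHS]ifF; last by lra.
    rewrite ifF; last by lra.
    rewrite ifT; last by lra.
    by congr (q (to_I _)); lra.
  rewrite min_r; last by lra.
  rewrite !ifF; [|lra|lra]; by congr (r (to_I _)); lra.
Qed.

Lemma path_cat1p x y (p : {path I from x to y in M}) :
  homotopic (path_cat (path_cst x) p) p.
Proof.
apply: (@homotopic_reparam _ _ _ _ (fun t => p (to_I t))
  (fun t => Num.max 0 (2 * t - 1)) id).
- exact: path_ext_continuous.
- by cont.
- by cont.
- by rewrite /Num.max; case: ifP; lra.
- by rewrite /Num.max; case: ifP; lra.
- move=> t t01; rewrite path_catE; have [t1|t1] := leP t 2^-1.
    by rewrite max_l; [rewrite (path_le0 p)|lra].
  by rewrite max_r //; lra.
- by [].
Qed.

Lemma path_catp1 x y (p : {path I from x to y in M}) :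
  homotopic (path_cat p (path_cst y)) p.
Proof.
apply: (@homotopic_reparam _ _ _ _ (fun t => p (to_I t))
  (fun t => Num.min 1 (2 * t)) id).
- exact: path_ext_continuous.
- by cont.
- by cont.
- by rewrite /Num.min; case: ifP; lra.
- by rewrite /Num.min; case: ifP; lra.
- move=> t t01; rewrite path_catE; have [t1|t1] := leP t 2^-1.
    by rewrite min_r //; lra.
  by rewrite min_l; [rewrite (path_ge1 p)|lra].
- by [].
Qed.

Lemma path_catVp x y (p : {path I from x to y in M}) :
  homotopic (path_cat (path_inv p) p) (path_cst y).
Proof.
apply: (@homotopic_reparam _ _ _ _ (fun t => p (to_I t))
  (fun t => Num.max (1 - 2 * t) (2 * t - 1)) (fun=> 1)).
- exact: path_ext_continuous.
- by cont.
- by cont.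
- by rewrite /Num.max; case: ifP; lra.
- by rewrite /Num.max; case: ifP; lra.
- move=> t t01; rewrite path_catE; have [t1|t1] := leP t 2^-1.
    by rewrite path_invE max_l //; lra.
  by rewrite max_r //; lra.
- by move=> t _; rewrite (path_ge1 p).
Qed.

Lemma path_catpV x y (p : {path I from x to y in M}) :
  homotopic (path_cat p (path_inv p)) (path_cst x).
Proof.
apply: (@homotopic_reparam _ _ _ _ (fun t => p (to_I t))
  (fun t => Num.min (2 * t) (2 - 2 * t)) (fun=> 0)).
- exact: path_ext_continuous.
- by cont.
- by cont.
- by rewrite /Num.min; case: ifP; lra.
- by rewrite /Num.min; case: ifP; lra.
- move=> t t01; rewrite path_catE; have [t1|t1] := leP t 2^-1.
    by rewrite min_l //; lra.
  rewrite path_invE min_r; last by lra.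
  by congr (p (to_I _)); lra.
- by move=> t _; rewrite (path_le0 p).
Qed.

End Homotopy.

Section FundamentalGroup.
Local Open Scope quotient_scope.
Context {R : realType} {M : topologicalType} (x : M).
Local Notation loop := {path unit_interval R from x to x in M}.

Definition homotopicb : rel loop := fun p q => `[< homotopic p q >].

Lemma homotopicb_equiv : equiv_class_of homotopicb.
Proof.
split=> [p|p q|q p r].
- exact/asboolP/homotopic_refl.
- by apply: asbool_equiv_eq; split; exact: homotopic_sym.
- by move=> /asboolP pq /asboolP qr; apply/asboolP; exact: homotopic_trans qr.
Qed.

Canonical homotopicb_equivRel := EquivRelPack homotopicb_equiv.

Definition fundamental_group : Type := {eq_quot homotopicb}.

HB.instance Definition _ := Choice.on fundamental_group.
HB.instance Definition _ := EqQuotient.on fundamental_group.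

Local Notation cls := (\pi_fundamental_group).

Lemma pi1_eq (p q : loop) : homotopic p q <-> cls p = cls q.
Proof. by split=> [pq|/eqmodP/asboolP//]; apply/eqmodP/asboolP. Qed.

Lemma pi1_repr (p : loop) : homotopic (repr (cls p)) p.
Proof. by apply/pi1_eq; rewrite reprK. Qed.

Definition pi1_one : fundamental_group := cls (path_cst x).
Definition pi1_inv (a : fundamental_group) : fundamental_group :=
  cls (path_inv (repr a)).
Definition pi1_mul (a b : fundamental_group) : fundamental_group :=
  cls (path_cat (repr a) (repr b)).

Lemma pi1_mulE (p q : loop) : pi1_mul (cls p) (cls q) = cls (path_cat p q).
Proof. by apply/pi1_eq/homotopic_cat; exact: pi1_repr. Qed.

Lemma pi1_invE (p : loop) : pi1_inv (cls p) = cls (path_inv p).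
Proof. by apply/pi1_eq/homotopic_inv; exact: pi1_repr. Qed.

Lemma pi1_mulA : associative pi1_mul.
Proof.
elim/quotW => p; elim/quotW => q; elim/quotW => r.
rewrite (pi1_mulE q r) (pi1_mulE p q) (pi1_mulE p) (pi1_mulE _ r).
exact/pi1_eq/path_catA.
Qed.

Lemma pi1_mul1 : left_id pi1_one pi1_mul.
Proof. by elim/quotW => p; rewrite pi1_mulE; exact/pi1_eq/path_cat1p. Qed.

Lemma pi1_1mul : right_id pi1_one pi1_mul.
Proof. by elim/quotW => p; rewrite pi1_mulE; exact/pi1_eq/path_catp1. Qed.

Lemma pi1_mulV : left_inverse pi1_one pi1_inv pi1_mul.
Proof.
by elim/quotW => p; rewrite pi1_invE pi1_mulE; exact/pi1_eq/path_catVp.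
Qed.

Lemma pi1_Vmul : right_inverse pi1_one pi1_inv pi1_mul.
Proof.
by elim/quotW => p; rewrite pi1_invE pi1_mulE; exact/pi1_eq/path_catpV.
Qed.

HB.instance Definition _ := isGroup.Build fundamental_group
  pi1_mulA pi1_mul1 pi1_1mul pi1_mulV pi1_Vmul.

End FundamentalGroup.

Arguments fundamental_group R {M} x.

Definition word_ball (G : groupType) (A : seq G) (n : nat) : set G :=
  [set a | exists2 w : seq G,
    (size w <= n)%N /\ {subset w <= A ++ [seq (b^-1)%g | b <- A]} &
    a = (\prod_(b <- w) b)%g].

Definition generates (G : groupType) (A : seq G) : Prop :=
  forall a : G, exists n, word_ball A n a.

(** Finiteness of [word_ball A n] makes [fset_set] meaningful here. *)
Definition growth (G : groupType) (A : seq G) (n : nat) : nat :=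
  #|` fset_set (word_ball A n)|.

Definition exponential_growth (R : realType) (G : groupType) : Prop :=
  exists2 A : seq G, generates A &
    (0 < limn_esup (fun n => (ln (growth A n)%:R / n%:R : R)%:E))%E.

Section Smooth.
Context {R : realType} {n : nat}.

Definition partial (j : 'I_n) (f : 'rV[R]_n -> R) : 'rV[R]_n -> R :=
  fun u => 'D_(delta_mx 0 j) f u.

Fixpoint Ck_on (k : nat) (U : set 'rV[R]_n) (f : 'rV[R]_n -> R) : Prop :=
  if k is k'.+1 then
    forall j, (forall u, U u -> derivable f u (delta_mx 0 j)) /\
              Ck_on k' U (partial j f)
  else forall u, U u -> {for u, continuous f}.

(** Meant for [U] open. *)
Definition smooth_on (U : set 'rV[R]_n) (f : 'rV[R]_n -> R) : Prop :=
  forall k, Ck_on k U f.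

End Smooth.

(** The chart [i] is the homeomorphism [coord i] from [dom i] onto its image,
    with inverse [param i]; values outside these sets are irrelevant. *)
Record smooth_atlas (R : realType) (n : nat) (M : topologicalType) :=
  SmoothAtlas {
  chart : Type;
  dom : chart -> set M;
  coord : chart -> M -> 'rV[R]_n;
  param : chart -> 'rV[R]_n -> M;
  dom_open : forall i, open (dom i);
  image_open : forall i, open (coord i @` dom i);
  coordK : forall i x, dom i x -> param i (coord i x) = x;
  coord_continuous : forall i x, dom i x -> {for x, continuous (coord i)};
  param_continuous : forall i u, (coord i @` dom i) u ->
    {for u, continuous (param i)};
  dom_cover : forall x, exists i, dom i x;
  transition_smooth : forall i j k,
    smooth_on (coord i @` (dom i `&` dom j))
      (fun u => coord j (param i u) 0 k)
}.

Record closed_connected_manifold (R : realType) (n : nat) :=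
  ClosedConnectedManifold {
  manifold_space :> topologicalType;
  manifold_hausdorff : hausdorff_space manifold_space;
  manifold_compact : compact [set: manifold_space];
  manifold_connected : connected [set: manifold_space];
  manifold_atlas : smooth_atlas R n manifold_space
}.

Section Riemannian.
Context {R : realType} {n : nat}.
Variable M : closed_connected_manifold R n.
Local Notation A := (manifold_atlas M).
Local Notation chart := (chart A).
Local Notation dom := (@dom _ _ _ A).
Local Notation coord := (@coord _ _ _ A).
Local Notation param := (@param _ _ _ A).

(** [gram i u] is the Gram matrix of the metric in the coordinate frame of the
    chart [i] at the point with coordinates [u]. Tangent vectors are row
    vectors, on which the jacobian matrix acts on the right. *)
Record riemannian_metric := RiemannianMetric {
  gram : chart -> 'rV[R]_n -> 'M[R]_n;
  gram_smooth : forall i k l,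
    smooth_on (coord i @` dom i) (fun u => gram i u k l);
  gram_sym : forall i u, (coord i @` dom i) u -> (gram i u)^T = gram i u;
  gram_pos : forall i u, (coord i @` dom i) u ->
    forall v : 'rV[R]_n, v != 0 -> 0 < (v *m gram i u *m v^T) 0 0;
  gram_change : forall i j x, dom i x -> dom j x ->
    let J := jacobian (coord j \o param i) (coord i x) in
    gram i (coord i x) = J *m gram j (coord j x) *m J^T
}.

Variable g : riemannian_metric.

Definition christoffel (i : chart) (u : 'rV[R]_n) (m k l : 'I_n) : R :=
  2^-1 * \sum_p invmx (gram g i u) m p *
    (partial k (fun v => gram g i v l p) u +
     partial l (fun v => gram g i v k p) u -
     partial p (fun v => gram g i v k l) u).

(** [c] is the curve [gamma] read in the chart [i]. *)
Definition unit_speed_geodesic_on (J : set R) (gamma : R -> M) : Prop :=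
  forall s, J s -> {for s, continuous gamma} /\
    forall i, dom i (gamma s) ->
    let c := coord i \o gamma in let c' := derive1 c in
    [/\ derivable c s 1, derivable c' s 1,
      forall m, derive1 c' s 0 m =
        - \sum_k \sum_l christoffel i (c s) m k l * c' s 0 k * c' s 0 l
    & (c' s *m gram g i (c s) *m (c' s)^T) 0 0 = 1].

(** Only the restriction of [gamma] to [[0, L]] matters; as usual for smooth
    curves on a closed interval, the equation is required to hold on some open
    interval containing it. *)
Definition geodesic (x y : M) (L : R) (gamma : R -> M) : Prop :=
  [/\ 0 < L, gamma 0 = x, gamma L = y &
    exists2 e, 0 < e & unit_speed_geodesic_on `]- e, L + e[%classic gamma].

Definition passes_through (L : R) (gamma : R -> M) (z : M) : Prop :=
  exists2 s, 0 < s < L & gamma s = z.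

(** A geodesic of length [L] is encoded as a pair [(L, gamma)]. *)
Definition Gamma (t : R) (x y : M) : set (R * (R -> M)) :=
  [set c | [/\ geodesic x y c.1 c.2, c.1 <= t,
    ~ passes_through c.1 c.2 x & ~ passes_through c.1 c.2 y]].

Definition blocking_set (t : R) (x y : M) (B : set M) : Prop :=
  [/\ finite_set B, ~ B x, ~ B y & forall c, Gamma t x y c ->
    exists2 z, B z & passes_through c.1 c.2 z].

Definition blocking_threshold (t : R) (x y : M) : \bar R :=
  ereal_inf [set (#|` fset_set B|%:R)%:E | B in blocking_set t x y].

Definition blocking_cost (t : R) : \bar R :=
  ereal_sup (range (fun xy : M * M => blocking_threshold t xy.1 xy.2)).

End Riemannian.

(* Main.v *)
From HB Require Import structures.
Require Import Defs.
From mathcomp Require Import all_boot all_order all_algebra generic_quotient finmap.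
From mathcomp Require Import all_classical all_reals all_analysis.
From mathcomp Require Import homotopy ring lra.
Import Order.TTheory GRing.Theory Num.Theory.
Import numFieldNormedType.Exports.
Local Open Scope classical_set_scope.
Local Open Scope ring_scope.

Set Implicit Arguments.
Unset Strict Implicit.
Unset Printing Implicit Defensive.

(** A blocking point of a geodesic of length at most [t] cuts it into two pieces, one of which has length at most [t / 2],
    and this piece determines the geodesic. Hence the number [k t] of geodesics between two points that do not pass through
    these points satisfies [k t <= 2 (s t + 1) k (t / 2)], so that subexponential growth of [s] implies subexponential
    growth of [k]. A geodesic loop at [x0] is determined by its first return to [x0] and its approximate length, so the
    geodesic loops at [x0] of length at most [t] are also subexponentially many. On the other hand every nontrivial class of
    the fundamental group contains a geodesic loop whose length is at most linear in the word length of the class. The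
    latter is found by minimising the energy of broken geodesics with short edges: at a minimum there are no corners, by
    the first variation formula. The edges are solutions of the boundary value problem for the geodesic equation in small
    coordinate boxes, obtained by Picard iteration. *)

(** * Boxes in coordinate space and the mean value theorem *)

(** Global tools such as the exponential map, completeness and the injectivity radius are replaced
    by a finite cover with coordinate boxes and one constant [sigma]: geodesics of length at most
    [Num.sqrt sigma] are edges of these boxes, so they are determined by their endpoints and cannot
    close up. The recursion runs over the dyadic times [T0 * 2 ^+ i], where the cost is at most
    [expR (eps * t)] from [T0] on; the exponents form a geometric series bounded by twice the last
    one, and the factors [4 ^+ i] are polynomial in the time. Below [T0] mere finiteness of the cost
    is enough. Counting is done by codes in an initial segment of the naturals, because curves carry
    irrelevant values outside their interval. The minimisation stays in one homotopy class because
    the class of a broken path is locally constant in its vertices. Two obstacles shape it: a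
    minimising vertex may lie on the boundary of its box, and a geodesic must satisfy its equation
    beyond both endpoints, so edges are solved on a longer interval than the one between their
    endpoints. *)

Section SupNorm.
Context {R : realType} {n : nat}.
Implicit Types (u v w z : 'rV[R]_n) (B r : R).

Lemma rV_coord_le u j : `|u 0 j| <= `|u|.
Proof.
by rewrite [leRHS]/Num.Def.normr /= mx_normrE; apply/bigmax_geP; right => /=; exists (0, j).
Qed.

Lemma rV_normP u B : 0 <= B -> (forall j, `|u 0 j| <= B) -> `|u| <= B.
Proof.
move=> B0 uB; rewrite [leLHS]/Num.Def.normr /= mx_normrE; apply: bigmax_le => // -[i j] _.
by rewrite /= ord1.
Qed.

Definition cbox (z : 'rV[R]_n) (r : R) : set 'rV[R]_n := [set u | `|u - z| <= r].
Definition obox (z : 'rV[R]_n) (r : R) : set 'rV[R]_n := [set u | `|u - z| < r].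

Lemma obox_open z r : open (obox z r).
Proof.
rewrite openE => u uz; apply/nbhs_ballP; exists (r - `|u - z|) => /=.
  by rewrite subr_gt0.
move=> v; rewrite -ball_normE /= /obox /= => uv.
rewrite -(subrKA u) (le_lt_trans (ler_normD _ _)) // -(distrC u v).
by rewrite -ltrBrDr.
Qed.

Lemma cbox_closed z r : closed (cbox z r).
Proof.
have -> : cbox z r = (fun u => `|u - z|) @^-1` [set x | x <= r] by [].
apply: closed_comp; last exact: closed_le.
move=> u _; apply: (@cvg_norm _ _ _ (nbhs u) _ (fun u => u - z)).
by apply: cvgB; [exact: cvg_id|exact: cvg_cst].
Qed.

Lemma cbox_compact z r : compact (cbox z r).
Proof.
apply: bounded_closed_compact; last exact: cbox_closed.
exists (r + `|z|); split; first exact: num_real.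
move=> M rM u uz; apply: le_trans (ltW rM).
by rewrite -[u](subrK z) (le_trans (ler_normD _ _)) // lerD2r.
Qed.

Lemma sub_cbox z r r' : r <= r' -> cbox z r `<=` cbox z r'.
Proof. by move=> rr' u /= /le_trans; apply. Qed.

Lemma sub_ocbox z r : obox z r `<=` cbox z r.
Proof. by move=> u /ltW. Qed.

Lemma cboxP z r u : 0 <= r -> (forall j, `|u 0 j - z 0 j| <= r) -> cbox z r u.
Proof. by move=> r0 h; apply: rV_normP => // j; rewrite !mxE. Qed.

Lemma cbox_coord z r u j : cbox z r u -> `|u 0 j - z 0 j| <= r.
Proof. by apply: le_trans; have := rV_coord_le (u - z) j; rewrite !mxE. Qed.

Lemma cbox_conv z r u v (t : R) : 0 <= t <= 1 -> cbox z r u -> cbox z r v ->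
  cbox z r ((1 - t) *: u + t *: v).
Proof.
move=> /andP[t0 t1] zu zv; rewrite /cbox /=.
have -> : (1 - t) *: u + t *: v - z = (1 - t) *: (u - z) + t *: (v - z).
  by rewrite !scalerBr addrACA -opprD -scalerDl subrK scale1r.
rewrite (le_trans (ler_normD _ _)) // !normrZ !ger0_norm ?subr_ge0 //.
have -> : r = (1 - t) * r + t * r by rewrite -mulrDl subrK mul1r.
by rewrite lerD // ler_wpM2l ?subr_ge0.
Qed.

Lemma obox_conv z r u v (t : R) : 0 <= t <= 1 -> obox z r u -> obox z r v ->
  obox z r ((1 - t) *: u + t *: v).
Proof.
move=> t01 zu zv.
have : cbox z (Num.max `|u - z| `|v - z|) ((1 - t) *: u + t *: v).
  by apply: cbox_conv => //=; rewrite /cbox /= le_max lexx ?orbT.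
by move/le_lt_trans; apply; rewrite gt_max zu.
Qed.

Lemma cbox_trans z r u s v : cbox z r u -> cbox u s v -> cbox z (r + s) v.
Proof.
move=> zu uv; rewrite /cbox /= -(subrKA u) addrC (le_trans (ler_normD _ _)) //.
by rewrite lerD.
Qed.

Lemma ler_dist_via z u v : `|u - v| <= `|u - z| + `|v - z|.
Proof. by rewrite -(subrKA z) (distrC v) ler_normD. Qed.

Lemma nbhs_obox u r : 0 < r -> nbhs u (obox u r).
Proof. by move=> r0; apply: open_nbhs_nbhs; split; [exact: obox_open|rewrite /obox /= subrr normr0]. Qed.

Lemma nbhs_oboxP u (A : set 'rV[R]_n) : nbhs u A -> exists2 r, 0 < r & obox u r `<=` A.
Proof.
move=> /nbhs_ballP[r /= r0 rA]; exists r => // v uv; apply: rA.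
by rewrite -ball_normE /= distrC.
Qed.

End SupNorm.

Section MeanValue.
Context {R : realType}.

Lemma is_derive_continuous (f : R -> R) (x df : R) : is_derive x 1 f df ->
  {for x, continuous f}.
Proof. by case=> /derivable1_diffP/differentiable_continuous. Qed.

Lemma MVT_between (f df : R -> R) (a b : R) :
  (forall x, Num.min a b <= x <= Num.max a b -> is_derive x 1 f (df x)) ->
  exists2 c, Num.min a b <= c <= Num.max a b & f b - f a = df c * (b - a).
Proof.
wlog ab : a b / a <= b => [wl|].
  have [/wl//|] := boolP (a <= b); rewrite -ltNge => /ltW ba.
  rewrite minC maxC => fd; have [c cab fab] := wl _ _ ba fd; exists c => //.
  by rewrite -opprB fab -mulrN opprB.
rewrite min_l // max_r // => fd.
have [|//|c cab fab] := @MVT_segment R f df a b ab.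
- by move=> x; rewrite in_itv /= => /andP[ax xb]; apply: fd; rewrite !ltW.
- apply: derivable_within_continuous => x; rewrite in_itv /= => xab.
  by have [] := fd _ xab.
by exists c; rewrite // in_itv /= in cab *.
Qed.

Lemma MVT_bound (f df : R -> R) (a b B x y : R) :
  (forall s, a <= s <= b -> is_derive s 1 f (df s)) ->
  (forall s, a <= s <= b -> `|df s| <= B) ->
  a <= x <= b -> a <= y <= b -> `|f y - f x| <= B * `|y - x|.
Proof.
move=> fd fB xab yab.
have sub s : Num.min x y <= s <= Num.max x y -> a <= s <= b.
  by rewrite ge_min le_max; case/andP=> /orP[] ? /orP[] ?; lra.
have [c /sub cab ->] := MVT_between (fun s hs => fd s (sub s hs)).
by rewrite normrM ler_wpM2r // fB.
Qed.

End MeanValue.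

Section Partials.
Context {R : realType} {n : nat}.
Implicit Types (f : 'rV[R]_n -> R) (u v w z : 'rV[R]_n).

Lemma is_derive_line (W : normedModType R) (f : 'rV[R]_n -> W) w v (t : R) :
  derivable f (w + t *: v) v ->
  is_derive t 1 (fun s : R => f (w + s *: v)) ('D_v f (w + t *: v)).
Proof.
move=> df; have e : (fun h : R => h^-1 *: (((fun s : R => f (w + s *: v)) \o shift t) (h *: 1) - f (w + t *: v)))
   = (fun h : R => h^-1 *: ((f \o shift (w + t *: v)) (h *: v) - f (w + t *: v))).
  apply/funext => h /=; rewrite [h *: 1]mulr1 scalerDl.
  by congr (_ *: (f _ - _)); rewrite addrCA.
by apply: DeriveDef; rewrite /derivable /derive /= e.
Qed.

(** Moves from [u] to [v] one coordinate at a time and applies the one-variable theorem to each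
    axis-parallel step. Only derivatives along the axes enter, and the path stays in the box because
    a sup-norm box is a product. *)
Lemma mean_value_partial f z r u v :
  (forall w, cbox z r w -> forall j, derivable f w (delta_mx 0 j)) ->
  cbox z r u -> cbox z r v ->
  exists2 xi : 'I_n -> 'rV[R]_n,
    (forall j, cbox z r (xi j) /\ cbox u `|v - u| (xi j)) &
    f v - f u = \sum_j partial j f (xi j) * (v 0 j - u 0 j).
Proof.
move=> fd zu zv.
have r0 : 0 <= r by exact: le_trans zu.
pose p (k : nat) : 'rV[R]_n := \row_j (if (j < k)%N then v 0 j else u 0 j).
have -> : f v - f u = \sum_(j < n) (f (p j.+1) - f (p j)).
  have pn : p n = v by apply/rowP => j; rewrite mxE ltn_ord.
  have p0 : p 0%N = u by apply/rowP => j; rewrite mxE ltn0.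
  by rewrite -(big_mkord xpredT (fun j => f (p j.+1) - f (p j))) telescope_sumr // pn p0.
have step (j : 'I_n) : exists xi, [/\ cbox z r xi, cbox u `|v - u| xi &
    f (p j.+1) - f (p j) = partial j f xi * (v 0 j - u 0 j)].
  pose q (t : R) := p j + t *: delta_mx 0 j.
  have qE t (k : 'I_n) : q t 0 k = if k == j then u 0 j + t else p j 0 k.
    rewrite !mxE; have [->|kj] := eqVneq k j; first by rewrite ltnn eqxx mulr1.
    by rewrite eqxx /= mulr0 addr0.
  have in_range (t : R) : Num.min 0 (v 0 j - u 0 j) <= t <= Num.max 0 (v 0 j - u 0 j) ->
      cbox z r (q t) /\ cbox u `|v - u| (q t).
    move=> tr; split; apply: cboxP => // k; rewrite qE.
      have := cbox_coord k zu; have := cbox_coord k zv.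
      case: eqP => [->|_]; last by rewrite mxE; case: ifP.
      move: tr; rewrite /Num.min /Num.max; case: ifP => _ + /ler_normlP[? ?] /ler_normlP[? ?];
        by move=> ?; apply/ler_normlP; split; lra.
    have := rV_coord_le (v - u) k; rewrite !mxE.
    case: eqP => [->|_]; last by case: ifP => // _ _; rewrite subrr normr0.
    move: tr; rewrite /Num.min /Num.max => + /(le_trans _); rewrite addrAC subrr add0r.
    move=> tr; apply; move: tr; case: ifP => h ?.
      by rewrite [leRHS]gtr0_norm // ger0_norm; lra.
    by rewrite [leRHS]ler0_norm ?ler0_norm; lra.
  have [t tr ft] := @MVT_between R (fun t => f (q t)) (fun t => partial j f (q t)) 0 (v 0 j - u 0 j)
    (fun t tr => is_derive_line (fd _ (in_range t tr).1 j)).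
  exists (q t); have [? ?] := in_range t tr; split=> //.
  rewrite -[RHS]/(partial j f (q t) * _) -[v 0 j - u 0 j]subr0 -ft.
  congr (f _ - f _).
    apply/rowP => k; rewrite qE subrKC mxE ltnS leq_eqVlt.
    by have [->|kj] := eqVneq k j; rewrite ?eqxx // (inj_eq val_inj) (negPf kj) /= mxE.
  by rewrite /q scale0r addr0.
have [xi xiP] := choice step; exists xi.
  by move=> j; have [] := xiP j.
by apply: eq_bigr => j _; have [] := xiP j.
Qed.

Lemma sum_abs_le (F G : 'I_n -> R) (B C : R) : 0 <= B ->
  (forall j, `|F j| <= B) -> (forall j, `|G j| <= C) ->
  `|\sum_j F j * G j| <= n%:R * B * C.
Proof.
move=> B0 FB GC; rewrite (le_trans (ler_norm_sum _ _ _)) //.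
rewrite (@le_trans _ _ (\sum_(j < n) B * C)) //; last first.
  by rewrite sumr_const card_ord -[leLHS]mulr_natl mulrA.
by apply: ler_sum => j _; rewrite normrM ler_pM.
Qed.

Lemma partial_lipschitz f z r B :
  (forall w, cbox z r w -> forall j, derivable f w (delta_mx 0 j)) ->
  0 <= B -> (forall w, cbox z r w -> forall j, `|partial j f w| <= B) ->
  forall u v, cbox z r u -> cbox z r v -> `|f v - f u| <= n%:R * B * `|v - u|.
Proof.
move=> fd B0 fB u v zu zv; have [xi xiP ->] := mean_value_partial fd zu zv.
apply: sum_abs_le => // [j|j]; first by apply: fB; have [] := xiP j.
by have := rV_coord_le (v - u) j; rewrite !mxE.
Qed.

(** The partials in the mean value formula are taken within distance [|v - u|] of [u], so replacing
    them by those at [u] costs one Lipschitz estimate. *)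
Lemma partial_taylor f z r L :
  (forall w, cbox z r w -> forall j, derivable f w (delta_mx 0 j)) ->
  0 <= L -> (forall u v, cbox z r u -> cbox z r v -> forall j,
    `|partial j f v - partial j f u| <= L * `|v - u|) ->
  forall u v, cbox z r u -> cbox z r v ->
    `|f v - f u - \sum_j partial j f u * (v 0 j - u 0 j)| <= n%:R * L * `|v - u| ^+ 2.
Proof.
move=> fd L0 fL u v zu zv; have [xi xiP ->] := mean_value_partial fd zu zv.
rewrite -sumrB (eq_bigr (fun j => (partial j f (xi j) - partial j f u) * (v 0 j - u 0 j))); last first.
  by move=> j _; rewrite mulrBl.
rewrite expr2 mulrA -(mulrA n%:R); apply: sum_abs_le => // [|j|j]; first exact: mulr_ge0.
  have [zx ux] := xiP j; rewrite (le_trans (fL _ _ zu zx j)) // ler_wpM2l //.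
by have := rV_coord_le (v - u) j; rewrite !mxE.
Qed.

End Partials.

(** * Smooth functions on open sets *)

Section Smooth.
Context {R : realType} {n : nat}.
Implicit Types (f : 'rV[R]_n -> R) (u v w z : 'rV[R]_n) (U : set 'rV[R]_n).

Lemma smooth_derivable U f u j : smooth_on U f -> U u -> derivable f u (delta_mx 0 j).
Proof. by move=> /(_ 1%N) /(_ j)[+ _]; apply. Qed.

Lemma smooth_continuous U f u : smooth_on U f -> U u -> {for u, continuous f}.
Proof. by move=> /(_ 0%N); apply. Qed.

Lemma smooth_partial U f j : smooth_on U f -> smooth_on U (partial j f).
Proof. by move=> fs k; have [_] := fs k.+1 j. Qed.

Lemma cbox_bounded f z r : (forall u, cbox z r u -> {for u, continuous f}) ->
  exists2 B, 0 <= B & forall u, cbox z r u -> `|f u| <= B.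
Proof.
move=> fc; have : bounded_set (f @` cbox z r).
  apply: compact_bounded; apply: continuous_compact; last exact: cbox_compact.
  by apply: continuous_in_subspaceT => u /set_mem /fc.
move=> [M [_ Mf]]; exists (Num.max 0 (M + 1)); first by rewrite le_max lexx.
move=> u zu; rewrite le_max; apply/orP; right; apply: Mf; first by rewrite ltrDl.
by exists u.
Qed.

Lemma smooth_bounded U f z r : smooth_on U f -> cbox z r `<=` U ->
  exists2 B, 0 <= B & forall u, cbox z r u -> `|f u| <= B.
Proof. by move=> fs zU; apply: cbox_bounded => u /zU; exact: smooth_continuous. Qed.

Lemma smooth_bounded_partial U f z r : smooth_on U f -> cbox z r `<=` U ->
  exists2 B, 0 <= B & forall u, cbox z r u -> forall j, `|partial j f u| <= B.
Proof.
move=> fs zU.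
have [B BP] := choice (fun j => (exists2P _ _).1 (smooth_bounded (smooth_partial j fs) zU)).
exists (\sum_j B j); first by apply: sumr_ge0 => j _; have [] := BP j.
move=> u zu j; rewrite (le_trans ((BP j).2 _ zu)) // (bigD1 j) //= lerDl.
by apply: sumr_ge0 => k _; have [] := BP k.
Qed.

Lemma smooth_lipschitz U f z r : smooth_on U f -> cbox z r `<=` U ->
  exists2 L, 0 <= L & forall u v, cbox z r u -> cbox z r v -> `|f v - f u| <= L * `|v - u|.
Proof.
move=> fs zU; have [B B0 BP] := smooth_bounded_partial fs zU.
exists (n%:R * B); first exact: mulr_ge0.
move=> u v zu zv; apply: partial_lipschitz zu zv => // w /zU zw j.
exact: smooth_derivable fs zw.
Qed.

Lemma smooth_taylor U f z r : smooth_on U f -> cbox z r `<=` U ->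
  exists2 L, 0 <= L & forall u v, cbox z r u -> cbox z r v ->
    `|f v - f u - \sum_j partial j f u * (v 0 j - u 0 j)| <= L * `|v - u| ^+ 2.
Proof.
move=> fs zU.
have [L LP] := choice (fun j => (exists2P _ _).1 (smooth_lipschitz (smooth_partial j fs) zU)).
have LE j : L j <= \sum_j L j.
  by rewrite (bigD1 j) //= lerDl; apply: sumr_ge0 => k _; have [] := LP k.
have L0 : 0 <= \sum_j L j by apply: sumr_ge0 => k _; have [] := LP k.
exists (n%:R * \sum_j L j); first exact: mulr_ge0.
move=> u v zu zv; apply: partial_taylor zu zv => // [w /zU zw j|u' v' zu zv j].
  exact: smooth_derivable fs zw.
by rewrite (le_trans ((LP j).2 _ _ zu zv)) // ler_wpM2r.
Qed.

Lemma open_cbox U u : open U -> U u -> exists2 r, 0 < r & cbox u r `<=` U.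
Proof.
move=> oU Uu; have [r r0 rU] := nbhs_oboxP (open_nbhs_nbhs (conj oU Uu)).
exists (r / 2); first by rewrite divr_gt0.
by move=> v uv; apply: rU; rewrite /obox /= (le_lt_trans uv) //; lra.
Qed.

(** [smooth_on] only speaks of iterated derivatives along the axes. Total differentiability, on
    which the chain rule rests, comes from the quadratic remainder in [smooth_taylor]. *)
Lemma smooth_is_diff U f u : open U -> smooth_on U f -> U u ->
  differentiable f u /\ forall v, 'd f u v = \sum_j partial j f u * v 0 j.
Proof.
move=> oU fs Uu; have [r r0 rU] := open_cbox oU Uu.
have [L L0 LP] := smooth_taylor fs rU.
pose df (v : 'rV[R]_n) : R := \sum_j partial j f u * v 0 j.
have dfl : linear df.
  move=> a v w; rewrite /df scaler_sumr -big_split; apply: eq_bigr => j _ /=.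
  by rewrite !mxE mulrDr /GRing.scale /= mulrCA.
pose dfL := GRing.isLinear.Build _ _ _ _ _ dfl.
pose DF : {linear 'rV[R]_n -> R} := HB.pack df dfL.
have dfc : continuous DF.
  apply: (@continuous_big R 'I_n +%R 0 xpredT); first exact: add_continuous.
  move=> j _ v; apply: (@cvgM _ _ (nbhs v) _ (cst (partial j f u))).
    exact: cvg_cst.
  exact: coord_continuous.
have e : f \o shift u = cst (f u) + DF +o_ (0 : 'rV[R]_n) id.
  apply/eqaddoP => e e0; near=> h.
  rewrite /= -[(_ - _) h]/(f (h + u) - (f u + df h)) opprD addrA.
  have hr : cbox u r (h + u).
    rewrite /cbox /= addrK; near: h; apply: (@filterS _ _ _ (obox 0 r)).
      by move=> h /ltW; rewrite /obox /= subr0.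
    exact: nbhs_obox.
  have uu : cbox u r u by rewrite /cbox /= subrr normr0 ltW.
  have := LP _ _ uu hr; rewrite addrK.
  rewrite (eq_bigr (fun j => partial j f u * h 0 j)) => [|j _]; last first.
    by rewrite mxE addrK.
  move=> /le_trans; apply; rewrite expr2 mulrA ler_wpM2r //.
  near: h; apply: (@filterS _ _ _ (obox 0 (e / (L + 1)))).
    move=> h; rewrite /obox /= subr0 => hL.
    rewrite (@le_trans _ _ (L * (e / (L + 1)))) //; first by rewrite ler_wpM2l // ltW.
    rewrite mulrCA ler_piMr ?ltW // ltr_pdivrMr; lra.
  by apply: nbhs_obox; rewrite divr_gt0 //; lra.
have dfE : 'd f u = DF :> ('rV[R]_n -> R) by apply: diff_unique dfc e.
split; last by move=> v; rewrite dfE.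
apply/diff_locallyP; rewrite dfE; split; first exact: dfc.
exact: e.
Unshelve. all: by end_near. Qed.

Lemma smooth_is_derive_comp U f (c : R -> 'rV[R]_n) (s : R) (v : 'rV[R]_n) :
  open U -> smooth_on U f -> U (c s) ->
  (forall j, is_derive s 1 (fun t => c t 0 j) (v 0 j)) ->
  is_derive s 1 (f \o c) (\sum_j partial j f (c s) * v 0 j).
Proof.
move=> oU fs Uc cv; have [fd fE] := smooth_is_diff oU fs Uc.
have cd : derivable c s 1.
  by apply/derivable_mxP => i j; rewrite ord1; have [] := cv j.
have cD : 'D_1 c s = v.
  rewrite derive_mx //; apply/rowP => j; rewrite mxE.
  by have [_] := cv j.
have /derivable1_diffP cdf := cd.
apply: DeriveDef; first by apply/derivable1_diffP/differentiable_comp.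
rewrite deriveE; last exact: differentiable_comp.
have /(congr1 (fun F => F 1)) -> := diff_comp cdf fd.
by rewrite /= -(@deriveE _ _ _ c) // cD fE.
Qed.

(* The second difference of [f] over a small square is [h^2] times a mixed partial. *)
Lemma second_difference U f u (h : R) i j : smooth_on U f -> 0 < h ->
  cbox u (2 * h) `<=` U ->
  exists2 xi, cbox u (2 * h) xi &
    f (u + h *: delta_mx 0 i + h *: delta_mx 0 j) - f (u + h *: delta_mx 0 i)
    - f (u + h *: delta_mx 0 j) + f u = h * h * partial j (partial i f) xi.
Proof.
move=> fs h0 hU.
have nd (k : 'I_n) : `|delta_mx 0 k : 'rV[R]_n| <= 1.
  by apply: rV_normP => // l; rewrite mxE; case: (_ && _); rewrite ?normr0 ?normr1.
have inb (s t : R) k l : 0 <= s <= h -> 0 <= t <= h ->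
    cbox u (2 * h) (u + s *: delta_mx 0 k + t *: delta_mx 0 l).
  move=> /andP[s0 sh] /andP[t0 th]; rewrite /cbox /= addrAC [u + _]addrC addrK.
  rewrite (le_trans (ler_normD _ _)) // !normrZ !ger0_norm // mulrDl mul1r.
  by rewrite lerD // (le_trans (ler_wpM2l _ (nd _))) ?mulr1.
pose g (s : R) := f (u + h *: delta_mx 0 j + s *: delta_mx 0 i) - f (u + s *: delta_mx 0 i).
pose g' (s : R) := partial i f (u + h *: delta_mx 0 j + s *: delta_mx 0 i) - partial i f (u + s *: delta_mx 0 i).
have inb1 (s : R) k : 0 <= s <= h -> cbox u (2 * h) (u + s *: delta_mx 0 k).
  move=> sh; have := inb s 0 k k sh; rewrite scale0r addr0; apply; lra.
have [|s sh] := @MVT_between R g g' 0 h.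
  rewrite min_l ?max_r; [|exact: ltW|exact: ltW] => s sh.
  apply: is_deriveB; apply: is_derive_line; apply: smooth_derivable fs (hU _ _).
    by apply: inb => //; lra.
  exact: inb1.
rewrite min_l ?max_r in sh; [|exact: ltW|exact: ltW].
have [|t th] := @MVT_between R (fun t => partial i f (u + s *: delta_mx 0 i + t *: delta_mx 0 j))
   (fun t => partial j (partial i f) (u + s *: delta_mx 0 i + t *: delta_mx 0 j)) 0 h.
  rewrite min_l ?max_r; [|exact: ltW|exact: ltW] => t th.
  apply: (@is_derive_line _ _ _ (partial i f)).
  apply: smooth_derivable (smooth_partial _ fs) (hU _ _); exact: inb.
rewrite min_l ?max_r in th; [|exact: ltW|exact: ltW].
move=> e2 e1; exists (u + s *: delta_mx 0 i + t *: delta_mx 0 j); first exact: inb.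
move: e1 e2; rewrite /g /g' !subr0 !scale0r !addr0 => e1 e2.
rewrite [u + s *: delta_mx 0 i + h *: _]addrAC in e2; rewrite e2 in e1.
rewrite [u + h *: delta_mx 0 i + _]addrAC mulrC mulrA mulrAC -e1; ring.
Qed.

Lemma eq_of_near_eq f g u : {for u, continuous f} -> {for u, continuous g} ->
  (forall e, 0 < e -> exists x y, [/\ cbox u e x, cbox u e y & f x = g y]) -> f u = g u.
Proof.
move=> fc gc H; apply/eqP/negPn/negP => fg.
pose e := `|f u - g u| / 2.
have e0 : 0 < e by rewrite divr_gt0 // normr_gt0 subr_eq0.
have /nbhs_oboxP[d d0 dP] : nbhs u [set x | `|f u - f x| < e /\ `|g u - g x| < e].
  apply: (@filterI _ (nbhs u)).
    by move/cvgrPdist_lt : fc; apply.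
  by move/cvgrPdist_lt : gc; apply.
have [x [y [ux uy fxy]]] := H (d / 2) (divr_gt0 d0 (ltr0n R 2)).
have [fx _] : `|f u - f x| < e /\ `|g u - g x| < e.
  by apply: dP; rewrite /obox /= (le_lt_trans ux) //; lra.
have [_ gy] : `|f u - f y| < e /\ `|g u - g y| < e.
  by apply: dP; rewrite /obox /= (le_lt_trans uy) //; lra.
have : `|f u - g u| < e + e.
  have -> : f u - g u = (f u - f x) - (g u - g y) by rewrite fxy; ring.
  by rewrite (le_lt_trans (ler_normB _ _)) // ltrD.
by rewrite /e -mulrDl -mulr2n -[_ *+ 2]mulr_natr mulfK ?ltxx // pnatr_eq0.
Qed.

(** The second difference of [f] over a square does not depend on the order of the two axes, while
    [second_difference] reads it as [h * h] times either mixed partial at a nearby point; continuity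
    then identifies the two at [u]. *)
Lemma partialC U f u i j : open U -> smooth_on U f -> U u ->
  partial i (partial j f) u = partial j (partial i f) u.
Proof.
move=> oU fs Uu; have [r r0 rU] := open_cbox oU Uu.
have fc k l : {for u, continuous (partial k (partial l f))}.
  exact: smooth_continuous (smooth_partial _ (smooth_partial _ fs)) Uu.
apply: (eq_of_near_eq (fc i j) (fc j i)) => e e0; have [h [h0 h2e h2r]] : exists h : R, [/\ 0 < h, 2 * h <= e & 2 * h <= r].
  exists (Num.min e r / 2); rewrite divr_gt0 ?lt_min ?e0 // mulrC divfK //.
  by rewrite !ge_min !lexx orbT.
have hU : cbox u (2 * h) `<=` U by apply: subset_trans rU; exact: sub_cbox.
have he : cbox u (2 * h) `<=` cbox u e by exact: sub_cbox.
have [x ux xE] := second_difference j i fs h0 hU.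
have [y uy yE] := second_difference i j fs h0 hU.
exists x, y; split; [exact: he|exact: he|].
have hh : h * h != 0 by rewrite mulf_neq0 // lt0r_neq0.
apply: (mulfI hh); apply: etrans (esym xE) (etrans _ yE).
by rewrite [u + h *: delta_mx 0 j + h *: delta_mx 0 i]addrAC; congr (_ + _); exact: addrAC.
Qed.

Lemma near_partial f g u j : (\near u, f u = g u) -> partial j f u = partial j g u.
Proof. exact: near_eq_derive. Qed.

End Smooth.

(** * Second-order equations *)

Section SelfBound.
Context {R : realType}.

(** Absorption argument in place of Gronwall's inequality: the supremum of [f] satisfies its own
    improved bound, which forces it below [B]. The a priori bound makes the supremum finite. *)
Lemma self_bound {T : Type} (X : set T) (f : T -> R) (B : R) :
  (exists C, forall s, X s -> f s <= C) ->
  (forall A, (forall s, X s -> f s <= A) -> forall s, X s -> f s <= B / 2 + A / 2) ->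
  forall s, X s -> f s <= B.
Proof.
move=> [C fC] H s Xs.
have fS : has_sup (f @` X).
  by split; [exists (f s), s|exists C => _ [t Xt <-]; exact: fC].
have fsup t : X t -> f t <= sup (f @` X).
  by move=> Xt; apply: (ub_le_sup fS.2); exists t.
have : sup (f @` X) <= B / 2 + sup (f @` X) / 2.
  by apply: ge_sup; [exact: fS.1|move=> _ [t Xt <-]; exact: H].
by have := fsup _ Xs; lra.
Qed.

(** The intervals of radius [2 * C * 2^-1 ^+ k] around [u k] are nested; the supremum of their left
    ends lies in all of them, which gives the rate along with the limit. *)
Lemma geometric_limit (u : nat -> R) (C : R) :
  (forall k, `|u k.+1 - u k| <= C * 2^-1 ^+ k) ->
  exists l, forall k, `|l - u k| <= 2 * C * 2^-1 ^+ k.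
Proof.
move=> uC.
have h0 (k : nat) : 0 < (2^-1 : R) ^+ k by rewrite exprn_gt0.
have C0 : 0 <= C by have := uC 0%N; rewrite expr0 mulr1; exact: le_trans.
pose lo k := u k - 2 * C * 2^-1 ^+ k.
pose hi k := u k + 2 * C * 2^-1 ^+ k.
have hS k : (2^-1 : R) ^+ k.+1 = 2^-1 ^+ k / 2 by rewrite exprSr.
have los k : lo k <= lo k.+1.
  by have := uC k; rewrite /lo hS ler_norml => /andP[]; lra.
have his k : hi k.+1 <= hi k.
  by have := uC k; rewrite /hi hS ler_norml => /andP[]; lra.
have lom j k : (j <= k)%N -> lo j <= lo k.
  by move/subnK <-; elim: (k - j)%N => // i /le_trans; apply; exact: los.
have him j k : (j <= k)%N -> hi k <= hi j.
  by move/subnK <-; elim: (k - j)%N => // i; exact: le_trans (his _).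
have lohi j k : lo j <= hi k.
  rewrite (le_trans (lom j _ (leq_maxl j k))) //.
  rewrite (le_trans _ (him _ _ (leq_maxr j k))) // /lo /hi.
  by have := mulr_ge0 C0 (ltW (h0 (maxn j k))); lra.
exists (sup (range lo)) => k.
have lS : has_ubound (range lo) by exists (hi 0%N) => _ [j _ <-].
have l1 : lo k <= sup (range lo) by apply: (ub_le_sup lS); exists k.
have l2 : sup (range lo) <= hi k.
  by apply: ge_sup; [exists (lo 0%N), 0%N|move=> _ [j _ <-]].
by rewrite ler_norml; move: l1 l2; rewrite /lo /hi; lra.
Qed.

Lemma half_power_small (C e : R) : 0 <= C -> 0 < e -> exists k, C * 2^-1 ^+ k < e.
Proof.
move=> C0 e0; have [k kP] : exists k : nat, C / e < k%:R.
  by exists (Num.bound (C / e)); rewrite archi_boundP // divr_ge0 // ltW.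
exists k; rewrite exprVn ltr_pdivrMr ?exprn_gt0 // mulrC -ltr_pdivrMr //.
rewrite (lt_le_trans kP) // -natrX ler_nat ltnW //; exact: ltn_expl.
Qed.

Lemma eq_half_power (W : normedZmodType R) (x y : W) (C : R) : (forall k, `|x - y| <= C * 2^-1 ^+ k) -> x = y.
Proof.
move=> H; apply/eqP; rewrite -subr_eq0 -normr_eq0 eq_le normr_ge0 andbT.
rewrite leNgt; apply/negP => e0.
have C0 : 0 <= C by have := H 0%N; rewrite expr0 mulr1; exact: le_trans.
by have [k] := half_power_small C0 e0; rewrite ltNge H.
Qed.

End SelfBound.

(** * Curves in coordinate space and estimates for boundary value problems *)

Section Curves.
Context {R : realType} {n : nat}.
Local Notation V := 'rV[R]_n.
Implicit Types (c v w : R -> V) (s t a b A B : R).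

Definition vderive c s (d : V) := forall j, is_derive s 1 (fun t => c t 0 j) (d 0 j).

Lemma vderiveB c1 c2 s d1 d2 : vderive c1 s d1 -> vderive c2 s d2 ->
  vderive (fun t => c1 t - c2 t) s (d1 - d2).
Proof.
move=> h1 h2 j; have e : (fun t => (c1 t - c2 t) 0 j) = (fun t => c1 t 0 j) - (fun t => c2 t 0 j).
  by apply/funext => t; rewrite !mxE.
by rewrite e !mxE; apply: is_deriveB.
Qed.

Lemma vderive_continuous c s d : vderive c s d -> {for s, continuous c}.
Proof.
move=> cd; have : derivable c s 1.
  by apply/derivable_mxP => i j; rewrite ord1; have [] := cd j.
by move/derivable1_diffP/differentiable_continuous.
Qed.

Lemma vderive_unique c s d d' : vderive c s d -> vderive c s d' -> d = d'.
Proof. by move=> h h'; apply/rowP => j; case: (h j) (h' j) => _ <- [_ <-]. Qed.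

Lemma vderive_near c c' s d : (\near s, c s = c' s) -> vderive c s d -> vderive c' s d.
Proof.
move=> cc h j; apply: near_eq_is_derive (h j).
by apply: (@filterS _ (nbhs s) _ _ _ _ cc) => t ->.
Qed.

Lemma vderive_derive1 c s d : vderive c s d <-> derivable c s 1 /\ derive1 c s = d.
Proof.
split=> [cd|[cd <-] j].
  have dc : derivable c s 1 by apply/derivable_mxP => i j; rewrite ord1; have [] := cd j.
  split=> //; rewrite derive1E derive_mx //; apply/rowP => j; rewrite mxE.
  by have [] := cd j.
rewrite derive1E derive_mx // mxE; apply/derivableP.
by move/derivable_mxP : cd; apply.
Qed.

Lemma is_derive_affine (f : R -> R) s a b (d : R) : is_derive (a * s + b) 1 f d ->
  is_derive s 1 (fun t => f (a * t + b)) (a * d).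
Proof.
pose l : R -> R := a *: (id : R -> R) + cst b; have ls : a * s + b = l s by [].
rewrite ls => fd; have ld : is_derive s 1 l (a *: (1 : R) + 0) by exact: _.
have := @is_derive1_comp _ f l s _ _ fd ld.
by rewrite addr0 mulrC; have -> : a%:A = a :> R by exact: mulr1.
Qed.

Lemma vderive_affine c s a b d : vderive c (a * s + b) d ->
  vderive (fun t => c (a * t + b)) s (a *: d).
Proof. by move=> cd j; rewrite mxE; exact: (is_derive_affine (cd j)). Qed.

Lemma vderive_bound c v a b B x y :
  (forall s, a <= s <= b -> vderive c s (v s)) -> 0 <= B ->
  (forall s, a <= s <= b -> `|v s| <= B) ->
  a <= x <= b -> a <= y <= b -> `|c y - c x| <= B * `|y - x|.
Proof.
move=> cd B0 vB xab yab; apply: rV_normP => [|j]; first exact: mulr_ge0.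
rewrite !mxE; apply: (@MVT_bound _ (fun t => c t 0 j) (fun t => v t 0 j) a b) => // s sab.
  exact: cd.
by rewrite (le_trans (rV_coord_le _ _)) // vB.
Qed.

(* Going beyond the interval [[0, 1]] of the boundary conditions is what later lets a minimising
   edge be a geodesic on a neighbourhood of its closed parameter interval. *)
Lemma bvp_estimate c v w a b A B :
  -1 <= a <= 0 -> 1 <= b <= 2 ->
  (forall s, a <= s <= b -> vderive c s (v s)) ->
  (forall s, a <= s <= b -> vderive v s (w s)) -> 0 <= A -> 0 <= B ->
  (forall s, a <= s <= b -> `|w s| <= A) -> `|c 0| <= B -> `|c 1| <= B ->
  forall s, a <= s <= b -> `|v s| <= 2 * B + 2 * A /\ `|c s| <= 5 * B + 4 * A.
Proof.
move=> a01 b12 cd vd A0 B0 wA c0 c1.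
have vB s : a <= s <= b -> `|v s| <= 2 * B + 2 * A.
  move=> sab; apply: rV_normP => [|j]; first lra.
  (* At some [xi] in [[0, 1]] the [j]-th velocity equals the increment between the two boundary
     values, hence is at most [2 * B]; no point of [[-1, 2]] is further than [2] from [xi]. *)
  have [|xi x01] := @MVT_between _ (fun t => c t 0 j) (fun t => v t 0 j) 0 1.
    by rewrite min_l ?max_r // => x x01; apply: cd; lra.
  rewrite min_l ?max_r // subr0 mulr1 in x01 * => vxi.
  have vxi2 : `|v xi 0 j| <= 2 * B.
    rewrite -vxi (le_trans (ler_normB _ _)) // mulrDl mul1r lerD //.
      exact: le_trans (rV_coord_le _ _) c1.
    exact: le_trans (rV_coord_le _ _) c0.
  have xab : a <= xi <= b by lra.
  have vd2 : `|v s 0 j - v xi 0 j| <= 2 * A.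
    apply: (@le_trans _ _ (A * `|s - xi|)).
      have := vderive_bound vd A0 wA xab sab.
      by apply: le_trans; have := rV_coord_le (v s - v xi) j; rewrite !mxE.
    by rewrite mulrC ler_wpM2r // ler_norml; lra.
  rewrite -[v s 0 j](subrK (v xi 0 j)) (le_trans (ler_normD _ _)) //; lra.
move=> s sab; split; first exact: vB.
have /(vderive_bound cd _ vB) /(_ sab) : a <= 0 <= b by lra.
rewrite subr0 => cs.
rewrite -[c s](subrK (c 0)) (le_trans (ler_normD _ _)) //.
have : `|c s - c 0| <= (2 * B + 2 * A) * 2.
  rewrite (le_trans (cs _)) //; first lra.
  by rewrite ler_wpM2l //; [lra|rewrite ler_norml; lra].
lra.
Qed.

Definition ode (F : V -> V -> V) (X : set R) c v :=
  forall s, X s -> vderive c s (v s) /\ vderive v s (F (c s) (v s)).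

Section Dependence.
Variables (F : V -> V -> V) (z : V) (r eta L M : R).
Hypothesis F_bounded : forall u v : V, cbox z r u -> cbox 0 eta v -> `|F u v| <= M.
Hypothesis F_lipschitz : forall u u' v v' : V, cbox z r u -> cbox z r u' ->
  cbox 0 eta v -> cbox 0 eta v' -> `|F u v - F u' v'| <= L * (`|u - u'| + `|v - v'|).

(** With a Lipschitz constant of [1 / 100], a bound [A] on the difference of accelerations returns
    as [(7 * B + 6 * A) / 100], so [self_bound] makes that difference at most [B]. For [B = 0] this
    is uniqueness in the boundary value problem. *)
Lemma bvp_dependence c1 v1 c2 v2 a b B :
  -1 <= a <= 0 -> 1 <= b <= 2 -> 0 <= L <= 1 / 100 ->
  ode F [set s | a <= s <= b] c1 v1 -> ode F [set s | a <= s <= b] c2 v2 ->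
  (forall s, a <= s <= b -> cbox z r (c1 s) /\ cbox 0 eta (v1 s)) ->
  (forall s, a <= s <= b -> cbox z r (c2 s) /\ cbox 0 eta (v2 s)) ->
  `|c1 0 - c2 0| <= B -> `|c1 1 - c2 1| <= B ->
  forall s, a <= s <= b -> `|v1 s - v2 s| <= 10 * B /\ `|c1 s - c2 s| <= 10 * B.
Proof.
move=> a01 b12 L01 o1 o2 i1 i2 h0 h1.
have B0 : 0 <= B by exact: le_trans h0.
pose w s := F (c1 s) (v1 s) - F (c2 s) (v2 s).
have key A : 0 <= A -> (forall s, a <= s <= b -> `|w s| <= A) -> forall s, a <= s <= b ->
    `|v1 s - v2 s| <= 2 * B + 2 * A /\ `|c1 s - c2 s| <= 5 * B + 4 * A.
  move=> A0 wA; apply: (bvp_estimate (w := w)) => // s sab.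
    by apply: vderiveB; [have [] := o1 s sab|have [] := o2 s sab].
  by apply: vderiveB; [have [] := o1 s sab|have [] := o2 s sab].
have wB s : a <= s <= b -> `|w s| <= B.
  apply: (@self_bound _ _ [set s | a <= s <= b] (fun s => `|w s|)).
    exists (M + M) => t tab; rewrite (le_trans (ler_normB _ _)) // lerD //.
      by have [? ?] := i1 t tab; exact: F_bounded.
    by have [? ?] := i2 t tab; exact: F_bounded.
  move=> A wA t tab; have A0 : 0 <= A by exact: le_trans (wA t tab).
  have [k1 k2] := key A A0 wA t tab.
  have [? ?] := i1 t tab; have [? ?] := i2 t tab.
  rewrite (le_trans (F_lipschitz _ _ _ _)) //.
  have : L * (`|c1 t - c2 t| + `|v1 t - v2 t|) <= 1 / 100 * (7 * B + 6 * A).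
    by apply: ler_pM; [lra|exact: addr_ge0|lra|lra].
  lra.
by move=> s /(key B B0 wB s); lra.
Qed.

(** [L] is arbitrary here; smallness comes from the length of the interval, on which the mean value
    estimate halves any common bound for the differences of positions and velocities. *)
Lemma ivp_local_unique c1 v1 c2 v2 s0 d : 0 < d -> 0 <= L ->
  ode F [set s | `|s - s0| < d] c1 v1 -> ode F [set s | `|s - s0| < d] c2 v2 ->
  (forall s, `|s - s0| < d -> cbox z r (c1 s) /\ cbox 0 eta (v1 s)) ->
  (forall s, `|s - s0| < d -> cbox z r (c2 s) /\ cbox 0 eta (v2 s)) ->
  c1 s0 = c2 s0 -> v1 s0 = v2 s0 ->
  exists2 e, 0 < e & forall s, `|s - s0| < e -> c1 s = c2 s /\ v1 s = v2 s.
Proof.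
move=> d0 L0 o1 o2 i1 i2 hc hv.
(* [e < d] keeps both solutions in range, [e <= 1 / 2] halves the bound on positions, and
   [2 * L * e <= 1 / 2] halves the one on velocities. *)
pose e := Num.min (d / 2) (Num.min (1 / 2) (1 / (4 * L + 4))).
have [e0 e1 e2 e3] : [/\ 0 < e, e < d, e <= 1 / 2 & 2 * L * e <= 1 / 2].
  have e3 : 0 < 1 / (4 * L + 4) by rewrite divr_gt0 //; lra.
  have e4 : e <= 1 / (4 * L + 4) by rewrite /e !ge_min lexx !orbT.
  split.
  - by rewrite /e !lt_min e3; lra.
  - by rewrite /e gt_min; apply/orP; left; lra.
  - by rewrite /e !ge_min lexx orbT.
  rewrite (@le_trans _ _ (2 * L * (1 / (4 * L + 4)))) //.
    by rewrite ler_wpM2l //; lra.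
  by rewrite mulrA ler_pdivrMr; lra.
exists e => // s se.
pose X := [set s | s0 - e <= s <= s0 + e].
have Xd t : X t -> `|t - s0| < d by rewrite /X /= ltr_norml; lra.
have Xs0 : X s0 by rewrite /X /=; lra.
have Xn t : X t -> `|t - s0| <= e by rewrite /X /= ler_norml; lra.
have Xs : X s by move: se; rewrite /X /= ltr_norml; lra.
pose f s := Num.max `|c1 s - c2 s| `|v1 s - v2 s|.
have key t : X t -> f t <= 0.
  apply: (@self_bound _ _ X f 0).
    exists (Num.max (r + r) (eta + eta)) => u /Xd ud; rewrite /f.
    have [/= k1 k2] := i1 u ud; have [/= k3 k4] := i2 u ud.
    rewrite /cbox /= subr0 in k2; rewrite /cbox /= subr0 in k4.
    rewrite ge_max !le_max; apply/andP; split; apply/orP; [left|right].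
      rewrite -(subrKA z) (le_trans (ler_normD _ _)) // lerD //; by rewrite distrC.
    by rewrite (le_trans (ler_normB _ _)) // lerD.
  move=> A fA u Xu; have A0 : 0 <= A.
    by apply: le_trans (fA _ Xu); rewrite /f le_max normr_ge0.
  have cA t' : X t' -> `|c1 t' - c2 t'| <= A by move/fA; rewrite /f ge_max => /andP[].
  have vA t' : X t' -> `|v1 t' - v2 t'| <= A by move/fA; rewrite /f ge_max => /andP[].
  rewrite mul0r add0r /f ge_max; apply/andP; split.
    have := @vderive_bound (fun t => c1 t - c2 t) (fun t => v1 t - v2 t) _ _ A s0 u _ A0 vA Xs0 Xu.
    rewrite hc subrr subr0 => H; apply: le_trans (H _) _.
      move=> t' /Xd td; apply: vderiveB; [by have [] := o1 t' td|by have [] := o2 t' td].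
    by apply: ler_wpM2l => //; rewrite (le_trans (Xn _ Xu)) //; lra.
  have wA t' : X t' -> `|F (c1 t') (v1 t') - F (c2 t') (v2 t')| <= L * (A + A).
    move=> Xt; have [? ?] := i1 _ (Xd _ Xt); have [? ?] := i2 _ (Xd _ Xt).
    rewrite (le_trans (F_lipschitz _ _ _ _)) // ler_wpM2l // lerD //; [exact: cA|exact: vA].
  have LA : 0 <= L * (A + A) by rewrite mulr_ge0 // addr_ge0.
  have := @vderive_bound (fun t => v1 t - v2 t) (fun t => F (c1 t) (v1 t) - F (c2 t) (v2 t)) _ _ _ s0 u _ LA wA Xs0 Xu.
  rewrite hv subrr subr0 => H; apply: le_trans (H _) _.
    move=> t' /Xd td; apply: vderiveB; [by have [] := o1 t' td|by have [] := o2 t' td].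
  apply: (@le_trans _ _ (L * (A + A) * e)); first by rewrite ler_wpM2l // Xn.
  have := ler_wpM2l A0 e3; lra.
have := key s Xs; rewrite /f ge_max !normr_le0 !subr_eq0 => /andP[/eqP ? /eqP ?].
by [].
Qed.

End Dependence.
End Curves.

Lemma fun_choice (X Y : Type) (P : X -> Y -> Prop) :
  (forall x, exists y, P x y) -> exists f, forall x, P x (f x).
Proof. by move=> /choice[f fP]; exists f. Qed.

Definition wide {R : realType} : set R := [set s | -1 <= s <= 2].

Lemma wide_left {R : realType} : -1 <= (-1 : R) <= 0.
Proof. lra. Qed.

Lemma wide_right {R : realType} : 1 <= (2 : R) <= 2.
Proof. lra. Qed.

(** * Picard iteration for the boundary value problem *)

Section Picard.
Context {R : realType} {n : nat}.
Local Notation V := 'rV[R]_n.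

Lemma derive1_is_derive (G : R -> R) s d : derivable G s 1 -> derive1 G s = d ->
  is_derive s 1 G d.
Proof. by move=> Gd <-; apply: DeriveDef => //; rewrite derive1E. Qed.

Lemma antiderivative (f : R -> R) : continuous f ->
  exists G, forall s : R, -3 < s < 3 -> is_derive s 1 G (f s).
Proof.
move=> fc; exists (fun x => \int[lebesgue_measure]_(t in [set` `[-3, x]]) (f t))%R.
move=> s /andP[s3 s3'].
have fi : lebesgue_measure.-integrable `[(-3 : R), 3] (EFin \o f).
  apply: continuous_compact_integrable; first exact: segment_compact.
  exact: continuous_subspaceT.
have [d e] := continuous_FTC1_closed s3' fi s3 (fc s).
exact: derive1_is_derive d e.
Qed.

Lemma is_derive_add (f g : R -> R) (s d e : R) : is_derive s 1 f d ->
  is_derive s 1 g e -> is_derive s 1 (fun t => f t + g t) (d + e).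
Proof. exact: is_deriveD. Qed.

Lemma is_derive_linear (a b s : R) : is_derive s 1 (fun t => a * t + b) a.
Proof.
have : is_derive s 1 (a *: (id : R -> R) + cst b) (a *: (1 : R) + 0) by exact: _.
by have -> : a%:A + 0 = a :> R by rewrite addr0; exact: mulr1.
Qed.

(** Integrates [w] twice in each coordinate and corrects by an affine function to meet the two
    boundary values. *)
Lemma linear_bvp (w : R -> V) (p q : V) : continuous w ->
  exists cv : (R -> V) * (R -> V), [/\ cv.1 0 = p, cv.1 1 = q &
    forall s : R, wide s -> vderive cv.1 s (cv.2 s) /\ vderive cv.2 s (w s)].
Proof.
move=> wc; have cvj j : exists cv : (R -> R) * (R -> R),
    [/\ cv.1 0 = p 0 j, cv.1 1 = q 0 j & forall s : R, wide s ->
      is_derive s 1 cv.1 (cv.2 s) /\ is_derive s 1 cv.2 (w s 0 j)].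
  have wjc : continuous (fun s => w s 0 j).
    move=> s; apply: (@continuous_comp _ _ _ w (fun u : V => u 0 j)); first exact: wc.
    exact: coord_continuous.
  have [G GP] := antiderivative wjc.
  (* [antiderivative] wants a function continuous on the whole line, whereas [G] is controlled only
     on [(-3, 3)]. Clamping the time at [-2] and [5 / 2] repairs this without changing [G] near the
     points of [wide]. *)
  pose pi (s : R) : R := Num.max (-2) (Num.min (5 / 2) s).
  have pic : continuous pi.
    move=> s; apply: (@continuous_max R R (cst (-2)) (Num.min (5 / 2))); first exact: cvg_cst.
    by apply: (@continuous_min R R (cst (5 / 2)) id); [exact: cvg_cst|exact: cvg_id].
  have pir s : -3 < pi s < 3.
    by rewrite /pi lt_max gt_max gt_min; apply/andP; split; [apply/orP; left; lra|lra].
  have Gc : continuous (G \o pi).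
    move=> s; apply: continuous_comp; first exact: pic.
    exact: is_derive_continuous (GP _ (pir s)).
  have piE s : wide s -> \forall t \near s, G t = (G \o pi) t.
    move=> /andP[s1 s2]; have h1 : \forall t \near s, -2 < t by apply: lt_nbhsr; lra.
    have h2 : \forall t \near s, t < 5 / 2 by apply: lt_nbhsl; lra.
    apply: (@filterS2 _ (nbhs s) _ _ _ _ _ h1 h2) => t t1 t2.
    by rewrite /= /pi min_r ?max_r // ltW.
  have [H HP] := antiderivative Gc; move: (G \o pi) Gc piE HP => G2 _ G2E HP.
  pose a := q 0 j - p 0 j - (H 1 - H 0).
  exists (fun t => H t + (a * t + (p 0 j - H 0)), fun t => G2 t + (0 * t + a)); split=> /=.
  - by ring.
  - by rewrite /a; ring.
  move=> s s12; have /andP[s1 s2] := s12; split.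
    have Hs : is_derive s 1 H (G2 s) by apply: HP; lra.
    have := is_derive_add Hs (is_derive_linear a (p 0 j - H 0) s).
    by rewrite mul0r add0r.
  have Gs : is_derive s 1 G (w s 0 j) by apply: GP; lra.
  have := is_derive_add (near_eq_is_derive (G2E s s12) Gs) (is_derive_linear 0 a s).
  by rewrite addr0.
have [cv cvP] := fun_choice cvj.
exists (fun s => \row_j (cv j).1 s, fun s => \row_j (cv j).2 s); split=> /=.
- by apply/rowP => j; rewrite mxE; have [] := cvP j.
- by apply/rowP => j; rewrite mxE; have [] := cvP j.
have fE (g : 'I_n -> R -> R) j : (fun t => (\row_j g j t) 0 j) = g j.
  by apply/funext => t; rewrite mxE.
move=> s s12; split=> j; rewrite /= fE; have [_ _ /(_ s s12)[d1 d2]] := cvP j => //.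
by rewrite mxE.
Qed.

Lemma pointwise_limit (u : nat -> R -> V) (C : R) :
  (forall k s, wide s -> `|u k.+1 s - u k s| <= C * 2^-1 ^+ k) ->
  exists l : R -> V, forall s, wide s -> forall k, `|l s - u k s| <= 2 * C * 2^-1 ^+ k.
Proof.
move=> uC; apply: (@fun_choice _ _ (fun s l => wide s -> forall k, `|l - u k s| <= 2 * C * 2^-1 ^+ k)) => s.
have [s12|ns] := pselect (wide s); last by exists 0.
have C0 : 0 <= C by have := uC 0%N s s12; rewrite expr0 mulr1; exact: le_trans.
have lj j : exists l : R, forall k, `|l - u k s 0 j| <= 2 * C * 2^-1 ^+ k.
  apply: geometric_limit => k; apply: le_trans (uC k s s12).
  by have := rV_coord_le (u k.+1 s - u k s) j; rewrite !mxE.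
have [l lP] := fun_choice lj; exists (\row_j l j) => _ k.
apply: rV_normP => [|j]; first by rewrite mulr_ge0 ?mulr_ge0 // exprn_ge0.
by rewrite !mxE.
Qed.

Section Truncated.
Variables (F : V -> V -> V) (L M : R).
Hypothesis L_ge0 : 0 <= L.
Hypothesis L_small : L <= 1 / 100.
Hypothesis F_bounded : forall u v : V, `|F u v| <= M.
Hypothesis F_lipschitz : forall u u' v v' : V,
  `|F u v - F u' v'| <= L * (`|u - u'| + `|v - v'|).
Variables (p q : V).

(** Freezing the time outside [wide] makes the force of an iterate continuous on the whole line, as
    [linear_bvp] requires, although the iterate is controlled only on [wide]. *)
Let pi (s : R) : R := Num.max (-1) (Num.min 2 s).
Let force (x : (R -> V) * (R -> V)) (s : R) : V := F (x.1 (pi s)) (x.2 (pi s)).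

Let pi_id (s : R) : wide s -> pi s = s.
Proof. by move=> /andP[a b]; rewrite /pi min_r // max_r. Qed.

Let pi_in (s : R) : wide (pi s).
Proof. by rewrite /wide /= /pi le_max lexx /= ge_max ge_min lexx /=; lra. Qed.

Let pi_continuous : continuous pi.
Proof.
move=> s; apply: (@continuous_max R R (cst (-1)) (Num.min 2)); first exact: cvg_cst.
by apply: (@continuous_min R R (cst 2) id); [exact: cvg_cst|exact: cvg_id].
Qed.

Let force_continuous (x : (R -> V) * (R -> V)) : (forall s : R, wide s -> {for s, continuous x.1} /\ {for s, continuous x.2}) ->
  continuous (force x).
Proof.
move=> xc s; apply/cvgrPdist_lt => e e0.
have [c1 c2] := xc _ (pi_in s).
have h1 : x.1 \o pi @ s --> x.1 (pi s) by apply: continuous_comp; [exact: pi_continuous|exact: c1].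
have h2 : x.2 \o pi @ s --> x.2 (pi s) by apply: continuous_comp; [exact: pi_continuous|exact: c2].
move/cvgrPdist_lt : h1 => /(_ e e0) h1; move/cvgrPdist_lt : h2 => /(_ e e0) h2.
apply: (@filterS2 _ (nbhs s) _ _ _ _ _ h1 h2) => t /= k1 k2.
rewrite (le_lt_trans (F_lipschitz _ _ _ _)) //.
apply: (@le_lt_trans _ _ (1 / 100 * (e + e))); last lra.
by apply: ler_pM; [exact: L_ge0|exact: addr_ge0|exact: L_small|rewrite lerD // ltW].
Qed.

Let force_bounded x s : `|force x s| <= M.
Proof. exact: F_bounded. Qed.

Let good (x : (R -> V) * (R -> V)) := continuous (force x).
Let solves (w : R -> V) (x : (R -> V) * (R -> V)) := [/\ x.1 0 = p, x.1 1 = q &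
    forall s : R, wide s -> vderive x.1 s (x.2 s) /\ vderive x.2 s (w s)].

Let solves_good w x : solves w x -> good x.
Proof.
move=> [_ _ xd]; apply: force_continuous => s /xd[d1 d2].
by split; exact: vderive_continuous; eassumption.
Qed.

Let close (A : R) (x y : (R -> V) * (R -> V)) := forall s : R, wide s ->
  `|x.2 s - y.2 s| <= 2 * A /\ `|x.1 s - y.1 s| <= 4 * A.

Let solves_dist w x w' x' (A : R) : 0 <= A -> solves w x -> solves w' x' ->
  (forall s, `|w s - w' s| <= A) ->
  close A x x'.
Proof.
move=> A0 [p1 q1 d1] [p2 q2 d2] ww s s12.
have := @bvp_estimate _ _ (fun s => x.1 s - x'.1 s) (fun s => x.2 s - x'.2 s) (fun s => w s - w' s)
  (-1) 2 A 0.
rewrite !mulr0 !add0r; apply => //; [lra|lra|move=> t t12|move=> t t12| | ].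
- by apply: vderiveB; [have [] := d1 t t12|have [] := d2 t t12].
- by apply: vderiveB; [have [] := d1 t t12|have [] := d2 t t12].
- by rewrite p1 p2 subrr normr0.
- by rewrite q1 q2 subrr normr0.
Qed.

(** This is the contraction: forces at distance [A] give positions at distance [4 * A] and
    velocities at distance [2 * A], and [6 * A / 100 <= A / 2]. *)
Let force_dist x y (A : R) : close A x y -> 0 <= A ->
  forall s, `|force x s - force y s| <= A / 2.
Proof.
move=> xyA A0 s; have [y1 y2] := xyA _ (pi_in s).
rewrite (le_trans (F_lipschitz _ _ _ _)) //.
apply: (@le_trans _ _ (1 / 100 * (4 * A + 2 * A))); last lra.
by apply: ler_pM; [exact: L_ge0|exact: addr_ge0|exact: L_small|rewrite lerD].
Qed.

Lemma bvp_exists_truncated : exists c v : R -> V, [/\ c 0 = p, c 1 = q &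
  ode F wide c v].
Proof.
have M0 : 0 <= M by exact: le_trans (F_bounded 0 0).
have stepH x : exists y, good x -> solves (force x) y.
  have [gx|ngx] := pselect (good x); last by exists x.
  by have [y yP] := linear_bvp p q gx; exists y.
have [step stepP] := fun_choice stepH.
have [x x0g xs] : exists2 x : nat -> (R -> V) * (R -> V),
    good (x 0%N) & forall k, good (x k) -> solves (force (x k)) (x k.+1).
  exists (fun k => iter k step (cst p, cst 0)) => [|k gk]; last exact: stepP.
  by apply: force_continuous => s _; split; exact: cvg_cst.
have {x0g} xg k : good (x k).
  by elim: k => [|k /xs]; [exact: x0g|exact: solves_good].
have {stepH} {}xs k : solves (force (x k)) (x k.+1) by exact: xs.
have h0 k : 0 <= M * 2^-1 ^+ k by rewrite mulr_ge0 // exprn_ge0.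
have hS k : M * 2^-1 ^+ k.+1 = M * 2^-1 ^+ k / 2 by rewrite exprSr mulrA.
have fk k s : `|force (x k.+1) s - force (x k) s| <= 2 * (M * 2^-1 ^+ k).
  elim: k s => [|k ih] s.
    rewrite expr0 mulr1 mulrDl mul1r (le_trans (ler_normB _ _)) //.
    exact: lerD (force_bounded _ _) (force_bounded _ _).
  have h2 : 0 <= 2 * (M * 2^-1 ^+ k) by have := h0 k; lra.
  by have := force_dist (solves_dist h2 (xs k.+1) (xs k) ih) h2 s; rewrite hS; lra.
have xk k s : wide s -> `|(x k.+2).2 s - (x k.+1).2 s| <= 4 * M * 2^-1 ^+ k
    /\ `|(x k.+2).1 s - (x k.+1).1 s| <= 8 * M * 2^-1 ^+ k.
  move=> s12; have h2 : 0 <= 2 * (M * 2^-1 ^+ k) by have := h0 k; lra.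
  by have := solves_dist h2 (xs k.+1) (xs k) (fk k) s12; rewrite -!(mulrA _ M); lra.
have [y2 y2P] := pointwise_limit (fun k s s12 => (xk k s s12).1).
have [y1 y1P] := pointwise_limit (fun k s s12 => (xk k s s12).2).
pose y : (R -> V) * (R -> V) := (y1, y2).
have yP k : close (4 * (M * 2^-1 ^+ k)) y (x k.+1).
  by move=> s s12; have := y2P s s12 k; have := y1P s s12 k; rewrite /y /= => ? ?; split; lra.
have {y1P y2P xk} h4 k : 0 <= 4 * (M * 2^-1 ^+ k) by have := h0 k; lra.
have fy k s := force_dist (yP k) (h4 k) s.
have yg : good y.
  move=> s; apply/cvgrPdist_lt => e e0.
  have e3 : 0 < e / 3 by lra.
  have [k kP] := half_power_small M0 (divr_gt0 e3 (ltr0n R 2)).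
  have := xg k.+1 s; move/cvgrPdist_lt => /(_ _ e3); apply: filterS => t tP.
  have -> : force y s - force y t = (force y s - force (x k.+1) s) +
      ((force (x k.+1) s - force (x k.+1) t) - (force y t - force (x k.+1) t)).
    by rewrite opprB !subrKA.
  have := fy k s; have := fy k t => ? ?.
  rewrite (le_lt_trans (ler_normD _ _)) // (le_lt_trans (lerD (lexx _) (ler_normB _ _))) //.
  lra.
(* The pointwise limit [y] is never differentiated. One more step from [y] is a genuine solution for
   the force of [y], and it coincides with [y] on [wide] because both are within a geometric error
   of the iterates. *)
have ys := stepP _ yg.
have yE s : wide s -> (step y).2 s = y.2 s /\ (step y).1 s = y.1 s.
  move=> s12; have H k : `|(step y).2 s - y.2 s| <= 50 * M * 2^-1 ^+ k /\
     `|(step y).1 s - y.1 s| <= 50 * M * 2^-1 ^+ k.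
    have h2 : 0 <= 4 * (M * 2^-1 ^+ k) / 2 by have := h0 k; lra.
    have [d2 d1] := solves_dist h2 ys (xs k.+1) (fy k) s12.
    have [e2 e1] := yP k.+1 s s12; have h0k := h0 k; have hSk := hS k.
    split.
      by rewrite (le_trans (ler_dist_via ((x k.+2).2 s) _ _)) //; lra.
    by rewrite (le_trans (ler_dist_via ((x k.+2).1 s) _ _)) //; lra.
  by split; apply: (@eq_half_power _ _ _ _ (50 * M)) => k; have [] := H k.
have [p0 q0 yd] := ys; exists (step y).1, (step y).2; split=> // s /= s12.
have [d1 d2] := yd s s12; split=> //.
by have [-> ->] := yE s s12; rewrite /force pi_id in d2.
Qed.

End Truncated.

Section Truncation.
Implicit Types (u v z : V) (r : R).

(** Coordinatewise retraction onto the box. It is 1-Lipschitz in the sup norm, so a field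
    precomposed with it keeps its bound and its Lipschitz constant on the whole space. *)
Definition clamp_box z r u : V := \row_j Num.max (z 0 j - r) (Num.min (z 0 j + r) (u 0 j)).

Lemma clamp_box_in z r u : 0 <= r -> cbox z r (clamp_box z r u).
Proof.
move=> r0; apply: cboxP => // j; rewrite mxE /Num.max /Num.min ler_norml.
by case: (ltP (z 0 j + r)) => ?; case: ltP => ?; lra.
Qed.

Lemma clamp_box_id z r u : cbox z r u -> clamp_box z r u = u.
Proof.
move=> zu; apply/rowP => j; have := cbox_coord j zu; rewrite mxE ler_norml => ?.
by rewrite min_r ?max_r //; lra.
Qed.

Lemma clamp_box_lipschitz z r u v : `|clamp_box z r u - clamp_box z r v| <= `|u - v|.
Proof.
apply: rV_normP => // j; have := rV_coord_le (u - v) j; rewrite !mxE !ler_norml /Num.max /Num.min.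
case: (ltP _ (u 0 j)) => ?; case: (ltP _ (v 0 j)) => ?; do 2 case: ltP => ?; lra.
Qed.

Variables (F : V -> V -> V) (z : V) (r eta L M : R).
Hypothesis F_bounded : forall u v : V, cbox z r u -> cbox 0 eta v -> `|F u v| <= M.
Hypothesis F_lipschitz : forall u u' v v' : V, cbox z r u -> cbox z r u' ->
  cbox 0 eta v -> cbox 0 eta v' -> `|F u v - F u' v'| <= L * (`|u - u'| + `|v - v'|).

(** The field is truncated outside the box, and the solution is shown never to leave it. Its
    velocity differs from that of the straight line by at most [2 * M <= 2 * rho], and the line has
    speed at most [4 * rho], whence [eta = 6 * rho]; in time at most [2] the curve then stays within
    [2 * rho + 12 * rho <= 20 * rho] of the centre. *)
Lemma bvp_exists p q rho : 0 <= L <= 1 / 100 -> 0 <= rho ->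
  cbox z (2 * rho) p -> cbox z (2 * rho) q -> r = 20 * rho -> eta = 6 * rho -> M <= rho ->
  exists c v : R -> V, [/\ c 0 = p, c 1 = q, ode F wide c v &
    forall s : R, wide s -> cbox z r (c s) /\ cbox 0 eta (v s)].
Proof.
move=> L01 rho0 zp zq rE etaE Mrho.
have r0 : 0 <= r by lra.
have eta0 : 0 <= eta by lra.
pose G u v := F (clamp_box z r u) (clamp_box 0 eta v).
have GM u v : `|G u v| <= M by apply: F_bounded; exact: clamp_box_in.
have GL u u' v v' : `|G u v - G u' v'| <= L * (`|u - u'| + `|v - v'|).
  rewrite (le_trans (F_lipschitz _ _ _ _)) //; try exact: clamp_box_in.
  by rewrite ler_wpM2l //; [lra|rewrite lerD // clamp_box_lipschitz].
have /andP[L0 L1] := L01.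
have [c [v [c0 c1 cd]]] := bvp_exists_truncated L0 L1 GM GL p q.
have pq : `|q - p| <= 4 * rho.
  by rewrite (le_trans (ler_dist_via z _ _)) //; move: zp zq; rewrite /cbox /=; lra.
have M0 : 0 <= M by exact: le_trans (GM 0 0).
have vB s : wide s -> cbox 0 eta (v s).
  move=> s12; have ld t : vderive (fun t => t *: (q - p) + p) t (q - p).
    move=> j; have := is_derive_linear ((q - p) 0 j) (p 0 j) t; congr (is_derive _ _ _ _).
    by apply/funext => x; rewrite !mxE mulrC.
  have ld2 t : vderive (fun=> q - p) t (0 : V) by move=> j; rewrite [(0 : V) 0 j]mxE; exact: (@is_derive_cst _ R R ((q - p) 0 j) t 1).
  have := @bvp_estimate _ _ _ _ _ (-1) 2 M 0 wide_left wide_right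
    (fun t t12 => vderiveB (cd t t12).1 (ld t)) (fun t t12 => vderiveB (cd t t12).2 (ld2 t)) M0 (lexx 0).
  rewrite c0 c1 scale0r add0r scale1r subrK !subrr normr0 !mulr0 !add0r.
  move=> /(_ _ (lexx 0) (lexx 0) s s12)[|vs _]; first by move=> t _; rewrite subr0.
  rewrite /cbox /= subr0 -[v s](subrK (q - p)) (le_trans (ler_normD _ _)) //; lra.
have cB s : wide s -> cbox z r (c s).
  move=> s12; have h0 : wide (0 : R) by rewrite /wide /=; lra.
  have vB' t : wide t -> `|v t| <= eta by move/vB; rewrite /cbox /= subr0.
  have cs := vderive_bound (fun t t12 => (cd t t12).1) eta0 vB' h0 s12.
  apply: (@sub_cbox _ _ _ (2 * rho + eta * 2)); first by rewrite rE etaE; lra.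
  apply: cbox_trans zp _; rewrite /cbox /= -c0 (le_trans cs) // ler_wpM2l //.
  by move: s12; rewrite /wide /= subr0 ler_norml; lra.
exists c, v; split=> // s s12; last by split; [exact: cB|exact: vB].
by have := cd s s12; rewrite /G !clamp_box_id //; [exact: vB|exact: cB].
Qed.

End Truncation.
End Picard.

(** * Quadratic forms and the energy *)

Section BoundedLipschitz.
Context {R : realType} {n : nat}.
Local Notation V := 'rV[R]_n.
Variables (z : V) (r : R).
Implicit Types (f g : V -> R).

(** A class stable under sums, products and inverses of nonvanishing functions. It carries
    quantitative bounds from the metric coefficients to the inverse matrix and the Christoffel
    symbols without differentiating the inverse. *)
Definition bounded_lipschitz f := exists2 B, 0 <= B &
  (forall u, cbox z r u -> `|f u| <= B) /\
  (forall u u', cbox z r u -> cbox z r u' -> `|f u - f u'| <= B * `|u - u'|).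

Lemma bl_smooth (U : set V) f : smooth_on U f -> cbox z r `<=` U -> bounded_lipschitz f.
Proof.
move=> fs zU; have [B B0 Bf] := smooth_bounded fs zU; have [L L0 Lf] := smooth_lipschitz fs zU.
exists (B + L); first exact: addr_ge0.
split=> [u zu|u u' zu zu']; first by rewrite (le_trans (Bf _ zu)) // lerDl.
by rewrite (le_trans (Lf _ _ zu' zu)) // ler_wpM2r // lerDr.
Qed.

Lemma bl_cst a : bounded_lipschitz (fun=> a).
Proof.
by exists `|a| => //; split=> [//|u u' _ _]; rewrite subrr normr0 mulr_ge0.
Qed.

Lemma bl_ext f g : (forall u, cbox z r u -> f u = g u) -> bounded_lipschitz f -> bounded_lipschitz g.
Proof.
move=> fg [B B0 [Bf Lf]]; exists B => //.
by split=> [u zu|u u' zu zu']; rewrite -?fg //; [exact: Bf|exact: Lf].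
Qed.

Lemma bl_add f g : bounded_lipschitz f -> bounded_lipschitz g ->
  bounded_lipschitz (fun u => f u + g u).
Proof.
move=> [B B0 [Bf Lf]] [C C0 [Cg Lg]]; exists (B + C); first exact: addr_ge0.
split=> [u zu|u u' zu zu'].
  by rewrite (le_trans (ler_normD _ _)) // lerD // ?Bf ?Cg.
rewrite opprD addrACA (le_trans (ler_normD _ _)) // mulrDl.
by apply: lerD; [exact: Lf|exact: Lg].
Qed.

Lemma bl_mul f g : bounded_lipschitz f -> bounded_lipschitz g ->
  bounded_lipschitz (fun u => f u * g u).
Proof.
move=> [B B0 [Bf Lf]] [C C0 [Cg Lg]]; exists (B * C + B * C).
  by rewrite addr_ge0 // mulr_ge0.
split=> [u zu|u u' zu zu'].
  rewrite normrM (@le_trans _ _ (B * C)) //; last by rewrite lerDl mulr_ge0.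
  by rewrite ler_pM // ?Bf ?Cg.
have -> : f u * g u - f u' * g u' = f u * (g u - g u') + (f u - f u') * g u' by ring.
rewrite (le_trans (ler_normD _ _)) // !normrM mulrDl; apply: lerD.
  by rewrite -mulrA ler_pM //; [exact: Bf|exact: Lg].
rewrite [B * C]mulrC -mulrA [leLHS]mulrC; apply: ler_pM => //; [exact: Cg|exact: Lf].
Qed.

Lemma bl_opp f : bounded_lipschitz f -> bounded_lipschitz (fun u => - f u).
Proof.
by move=> fb; apply: bl_ext (bl_mul (bl_cst (-1)) fb) => u _; rewrite mulN1r.
Qed.

Lemma bl_sum (I : Type) (s : seq I) (P : pred I) (F : I -> V -> R) : (forall i, bounded_lipschitz (F i)) ->
  bounded_lipschitz (fun u => \sum_(i <- s | P i) F i u).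
Proof.
move=> Fb; elim: s => [|i s ih].
  by apply: bl_ext (bl_cst 0) => u _; rewrite big_nil.
case Pi : (P i).
  by apply: bl_ext (bl_add (Fb i) ih) => u _; rewrite big_cons Pi.
by apply: bl_ext ih => u _; rewrite big_cons Pi.
Qed.

Lemma bl_prod (I : Type) (s : seq I) (P : pred I) (F : I -> V -> R) : (forall i, bounded_lipschitz (F i)) ->
  bounded_lipschitz (fun u => \prod_(i <- s | P i) F i u).
Proof.
move=> Fb; elim: s => [|i s ih].
  by apply: bl_ext (bl_cst 1) => u _; rewrite big_nil.
case Pi : (P i).
  by apply: bl_ext (bl_mul (Fb i) ih) => u _; rewrite big_cons Pi.
by apply: bl_ext ih => u _; rewrite big_cons Pi.
Qed.

Lemma bl_det m (A : V -> 'M[R]_m) : (forall i j, bounded_lipschitz (fun u => A u i j)) ->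
  bounded_lipschitz (fun u => \det (A u)).
Proof.
move=> Ab; apply: bl_sum => s; apply: bl_mul; first exact: bl_cst.
by apply: bl_prod => i; exact: Ab.
Qed.

Lemma bl_within_continuous f : bounded_lipschitz f -> {within cbox z r, continuous f}.
Proof.
move=> [B B0 [_ Lf]]; apply/subspace_continuousP => u zu.
apply/cvgrPdist_lt => e e0; rewrite near_withinE.
have : nbhs u (obox u (e / (B + 1))) by apply: nbhs_obox; rewrite divr_gt0 //; lra.
apply: filterS => v uv zv.
rewrite (le_lt_trans (Lf _ _ zu zv)) //.
apply: (@le_lt_trans _ _ (B * (e / (B + 1)))).
  by rewrite ler_wpM2l // distrC ltW.
rewrite mulrCA gtr_pMr // ltr_pdivrMr; lra.
Qed.

Lemma bl_inv f : bounded_lipschitz f -> (forall u, cbox z r u -> f u != 0) ->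
  bounded_lipschitz (fun u => (f u)^-1).
Proof.
move=> fb f0; have [e e0 ef] : exists2 e, 0 < e & forall u, cbox z r u -> e <= `|f u|.
  have [z0|zN0] := eqVneq (cbox z r) set0; first by exists 1 => // u; rewrite z0.
  have fc : {within cbox z r, continuous (fun u => `|f u|)}.
    move=> u; apply: (@continuous_comp _ _ _ (f : subspace (cbox z r) -> R) (@Num.Def.normr _ R)).
      exact: bl_within_continuous.
    exact: norm_continuous.
  have [|c /set_mem zc cP] := compact_EVT_min _ (@cbox_compact _ _ z r) fc; first exact/set0P.
  exists `|f c|; first by rewrite normr_gt0 f0.
  by move=> u zu; apply: cP; exact/mem_set.
have [B B0 [Bf Lf]] := fb.
have i0 u : cbox z r u -> `|(f u)^-1| <= e^-1.
  by move=> zu; rewrite normfV lef_pV2 ?posrE ?normr_gt0 ?f0 // ef.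
exists (e^-1 + e^-1 * (B * e^-1)).
  by rewrite addr_ge0 ?mulr_ge0 ?invr_ge0 // ltW.
split=> [u zu|u u' zu zu'].
  by rewrite (le_trans (i0 _ zu)) // lerDl mulr_ge0 ?mulr_ge0 ?invr_ge0 // ltW.
have -> : (f u)^-1 - (f u')^-1 = (f u)^-1 * ((f u' - f u) * (f u')^-1).
  by have := f0 _ zu; have := f0 _ zu' => ? ?; field; apply/andP.
rewrite [leRHS]mulrDl; apply: ler_wpDl; first by rewrite mulr_ge0 // invr_ge0 ltW.
rewrite !normrM distrC -mulrA; apply: ler_pM => //; first exact: i0.
by rewrite [leRHS]mulrAC; apply: ler_pM => //; [exact: Lf|exact: i0].
Qed.

End BoundedLipschitz.

Section PositiveForms.
Context {R : realType} {n : nat}.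
Implicit Types (A : 'M[R]_n) (u v w a : 'rV[R]_n).

Definition form A v w : R := (v *m A *m w^T) 0 0.

Lemma formE A v w : form A v w = \sum_k \sum_l A k l * v 0 k * w 0 l.
Proof.
rewrite /form mxE (eq_bigr (fun l => \sum_k A k l * v 0 k * w 0 l)); last first.
  by move=> l _; rewrite !mxE big_distrl /=; apply: eq_bigr => k _; ring.
exact: exchange_big.
Qed.

Lemma formDl A v v' w : form A (v + v') w = form A v w + form A v' w.
Proof. by rewrite /form !mulmxDl mxE. Qed.

Lemma formDr A v w w' : form A v (w + w') = form A v w + form A v w'.
Proof. by rewrite /form linearD /= mulmxDr mxE. Qed.

Lemma formZl A (k : R) v w : form A (k *: v) w = k * form A v w.
Proof. by rewrite /form -!scalemxAl mxE. Qed.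

Lemma formZr A (k : R) v w : form A v (k *: w) = k * form A v w.
Proof. by rewrite /form linearZ /= -!scalemxAr mxE. Qed.

Lemma formBl A v v' w : form A (v - v') w = form A v w - form A v' w.
Proof. by rewrite -scaleN1r formDl formZl mulN1r. Qed.

Lemma formBr A v w w' : form A v (w - w') = form A v w - form A v w'.
Proof. by rewrite -scaleN1r formDr formZr mulN1r. Qed.

Lemma formC A v w : A^T = A -> form A v w = form A w v.
Proof.
move=> sA; have e : (v *m A *m w^T)^T = w *m A *m v^T.
  by rewrite !trmx_mul trmxK sA mulmxA.
by rewrite /form -e [RHS]mxE.
Qed.

Lemma form_bound A v w B : 0 <= B -> (forall k l, `|A k l| <= B) ->
  `|form A v w| <= n%:R * (n%:R * B) * (`|v| * `|w|).
Proof.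
move=> B0 AB; rewrite formE (le_trans (ler_norm_sum _ _ _)) //.
have inner k : `|\sum_l A k l * v 0 k * w 0 l| <= n%:R * B * (`|v| * `|w|).
  have := @sum_abs_le R n (fun l => A k l * v 0 k) (fun l => w 0 l) (B * `|v|) `|w|.
  rewrite -!mulrA; apply => [|l|l]; last exact: rV_coord_le.
    exact: mulr_ge0.
  by rewrite normrM ler_pM // rV_coord_le.
apply: (@le_trans _ _ (\sum_(k < n) n%:R * B * (`|v| * `|w|))); first exact: ler_sum.
by rewrite sumr_const card_ord -[leLHS]mulr_natl !mulrA.
Qed.

Definition positive A := A^T = A /\ forall v, v != 0 -> 0 < form A v v.

Lemma positive_ge0 A v : positive A -> 0 <= form A v v.
Proof.
move=> [_ Ap]; have [->|/Ap/ltW //] := eqVneq v 0.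
by rewrite /form !mul0mx mxE.
Qed.

Lemma positive_unitmx A : positive A -> A \in unitmx.
Proof.
move=> [_ Ap]; rewrite -row_free_unit -kermx_eq0; apply/eqP/row_matrixP => i.
rewrite row0; apply/eqP/negPn/negP => k0.
have := Ap _ k0; rewrite /form.
have -> : row i (kermx A) *m A = 0 by rewrite -row_mul mulmx_ker row0.
by rewrite mul0mx mxE ltxx.
Qed.

Lemma form_cauchy_schwarz A v w : positive A ->
  form A v w ^+ 2 <= form A v v * form A w w.
Proof.
move=> pA; have [sA _] := pA; have [->|w0] := eqVneq w 0.
  by rewrite /form trmx0 !mulmx0 mxE expr0n /= mulr0.
have ww : 0 < form A w w by apply: pA.2.
have := positive_ge0 (form A w w *: v - form A v w *: w) pA.
rewrite -scaleNr !(formDl, formDr, formZl, formZr) (formC w v) //.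
set a := form A w w in ww *; set b := form A v w; set c := form A v v.
have -> : a * (a * c + - b * b) + (a * (- b * b) + - b * (- b * a)) = a * (c * a - b ^+ 2) by ring.
by rewrite pmulr_rge0 // subr_ge0.
Qed.

End PositiveForms.

(** * The geodesic equation as an Euler-Lagrange equation *)

Section MetricField.
Context {R : realType} {n : nat}.
Local Notation V := 'rV[R]_n.
Variables (U : set V) (G : V -> 'M[R]_n).
Hypothesis U_open : open U.
Hypothesis G_smooth : forall k l, smooth_on U (fun u => G u k l).
Hypothesis G_positive : forall u, U u -> positive (G u).
Implicit Types (u v w z a : V).

Local Notation dG q k l u := (partial q (fun v => G v k l) u).

Definition chr u (m k l : 'I_n) : R :=
  2^-1 * \sum_p invmx (G u) m p * (dG k l p u + dG l k p u - dG p k l u).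

Definition geod_rhs u v : V := \row_m (- \sum_k \sum_l chr u m k l * v 0 k * v 0 l).

(* The Euler-Lagrange covector of the energy at position [u], velocity [v], acceleration [a]. *)
Definition euler_lagrange u v a p : R :=
  \sum_m G u p m * a 0 m + \sum_k \sum_l dG k p l u * v 0 k * v 0 l
  - 2^-1 * \sum_k \sum_l dG p k l u * v 0 k * v 0 l.

Lemma GC u k l : U u -> G u k l = G u l k.
Proof. by move=> /G_positive[s _]; rewrite -{1}s mxE. Qed.

Lemma dGC q k l u : U u -> dG q k l u = dG q l k u.
Proof.
move=> Uu; apply: near_partial; have : nbhs u U by exact: open_nbhs_nbhs.
by apply: (@filterS _ (nbhs u)) => w Uw; rewrite GC.
Qed.

(** Lowering the index cancels the inverse matrix. Two of the three derivative terms then coincide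
    after exchanging [k] and [l], which uses up the factor [2^-1] in front of them. *)
Lemma lower_chr u v p : U u ->
  \sum_m G u p m * geod_rhs u v 0 m =
  - (\sum_k \sum_l dG k p l u * v 0 k * v 0 l - 2^-1 * \sum_k \sum_l dG p k l u * v 0 k * v 0 l).
Proof.
move=> Uu; have iG := positive_unitmx (G_positive Uu).
pose S q k l := dG k l q u + dG l k q u - dG q k l u.
have -> : \sum_m G u p m * geod_rhs u v 0 m =
    - (2^-1 * \sum_k \sum_l S p k l * v 0 k * v 0 l).
  transitivity (- (2^-1 * \sum_m \sum_k \sum_l \sum_q
      G u p m * invmx (G u) m q * (S q k l * v 0 k * v 0 l))).
    rewrite mulr_sumr -sumrN; apply: eq_bigr => m _.
    rewrite mxE mulrN mulr_sumr mulr_sumr; congr (- _); apply: eq_bigr => k _.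
    rewrite mulr_sumr [RHS]mulr_sumr; apply: eq_bigr => l _.
    transitivity (2^-1 * ((\sum_q invmx (G u) m q * S q k l) * (G u p m * v 0 k * v 0 l))).
      by rewrite /chr; ring.
    by congr (_ * _); rewrite mulr_suml; apply: eq_bigr => q _; ring.
  congr (- (_ * _)); rewrite exchange_big /=; apply: eq_bigr => k _.
  rewrite exchange_big /=; apply: eq_bigr => l _.
  rewrite exchange_big /= (bigD1 p) //= [X in _ + X]big1 ?addr0 => [|q qp].
    rewrite -mulr_suml; have := mulmxV iG => /matrixP/(_ p p); rewrite !mxE eqxx => ->.
    by rewrite mul1r.
  rewrite -mulr_suml; have := mulmxV iG => /matrixP/(_ p q); rewrite !mxE eq_sym (negPf qp) => ->.
  by rewrite mul0r.
congr (- _).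
transitivity (2^-1 * (\sum_k \sum_l dG k p l u * v 0 k * v 0 l + \sum_k \sum_l dG k p l u * v 0 k * v 0 l
   - \sum_k \sum_l dG p k l u * v 0 k * v 0 l)); last by field.
congr (_ * _); rewrite [X in _ + X - _]exchange_big /= -big_split -sumrB /=.
apply: eq_bigr => k _; rewrite -big_split -sumrB /=; apply: eq_bigr => l _.
by rewrite /S (dGC k l p Uu) (dGC l k p Uu); ring.
Qed.

Lemma euler_lagrangeP u v a : U u -> (forall p, euler_lagrange u v a p = 0) <-> a = geod_rhs u v.
Proof.
move=> Uu; split=> [EL|-> p]; last by rewrite /euler_lagrange lower_chr //; ring.
have iG := positive_unitmx (G_positive Uu).
suff e : G u *m a^T = G u *m (geod_rhs u v)^T.
  by apply: trmx_inj; rewrite -[a^T](mulKmx iG) e mulKmx.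
apply/matrixP => p j; rewrite !mxE ord1.
have := EL p; rewrite /euler_lagrange => /eqP.
rewrite -addrA addr_eq0 -(lower_chr v p Uu) => /eqP h.
have e b : \sum_m G u p m * b^T m 0 = \sum_m G u p m * b 0 m.
  by apply: eq_bigr => m _; rewrite mxE.
by rewrite !e.
Qed.

Lemma is_derive_mul (f g : R -> R) (s d e : R) : is_derive s 1 f d -> is_derive s 1 g e ->
  is_derive s 1 (fun t => f t * g t) (d * g s + f s * e).
Proof.
move=> fd ge; have h := @is_deriveM _ _ f g s 1 d e fd ge.
by rewrite addrC [d * _]mulrC.
Qed.

Lemma is_derive_bigsum m (F : 'I_m -> R -> R) (s : R) (d : 'I_m -> R) :
  (forall i, is_derive s 1 (F i) (d i)) -> is_derive s 1 (fun t => \sum_i F i t) (\sum_i d i).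
Proof.
move=> Fd; have -> : (fun t => \sum_i F i t) = \sum_i F i by apply/funext => t; rewrite fct_sumE.
exact: is_derive_sum.
Qed.

Definition dgram u w : 'M[R]_n := \matrix_(k, l) \sum_q dG q k l u * w 0 q.

Lemma form_derive (c v w : R -> V) (s : R) (d v' w' : V) :
  U (c s) -> vderive c s d -> vderive v s v' -> vderive w s w' ->
  is_derive s 1 (fun t => form (G (c t)) (v t) (w t))
    (form (dgram (c s) d) (v s) (w s) + form (G (c s)) v' (w s) + form (G (c s)) (v s) w').
Proof.
move=> Uc cd vd wd.
have -> : (fun t => form (G (c t)) (v t) (w t)) =
    (fun t => \sum_k \sum_l G (c t) k l * v t 0 k * w t 0 l).
  by apply/funext => t; rewrite formE.
rewrite !formE -!big_split /=; apply: is_derive_bigsum => k.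
rewrite -!big_split /=; apply: is_derive_bigsum => l.
rewrite -mulrDl mxE; apply: is_derive_mul (wd l).
apply: is_derive_mul (vd k).
exact: (smooth_is_derive_comp U_open (G_smooth k l) Uc cd).
Qed.

Lemma dgramC u w : U u -> (dgram u w)^T = dgram u w.
Proof.
by move=> Uu; apply/matrixP => k l; rewrite !mxE; apply: eq_bigr => q _; rewrite dGC.
Qed.

Lemma euler_lagrange_contract u v a (h : V) : U u ->
  \sum_p h 0 p * euler_lagrange u v a p =
  form (G u) a h + form (dgram u v) v h - 2^-1 * form (dgram u h) v v.
Proof.
move=> Uu; rewrite (formC _ _ (G_positive Uu).1) (formC _ _ (dgramC v Uu)) !formE.
transitivity (\sum_p (\sum_m G u p m * h 0 p * a 0 m + \sum_l dgram u v p l * h 0 p * v 0 l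
    - 2^-1 * (h 0 p * \sum_k \sum_l dG p k l u * v 0 k * v 0 l))).
  apply: eq_bigr => p _; rewrite /euler_lagrange mulrBr mulrDr; congr (_ + _ - _); last by ring.
    by rewrite mulr_sumr; apply: eq_bigr => m _; ring.
  rewrite exchange_big /= mulr_sumr; apply: eq_bigr => l _; rewrite mxE !mulr_suml mulr_sumr.
  by apply: eq_bigr => k _; ring.
rewrite big_split /= big_split /=; congr (_ + _ + _).
rewrite sumrN -mulr_sumr; congr (- (_ * _)).
transitivity (\sum_p \sum_k \sum_l h 0 p * (dG p k l u * v 0 k * v 0 l)).
  apply: eq_bigr => p _; rewrite mulr_sumr; apply: eq_bigr => k _; exact: mulr_sumr.
rewrite exchange_big /=; apply: eq_bigr => k _; rewrite exchange_big /=.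
apply: eq_bigr => l _; rewrite mxE !mulr_suml; apply: eq_bigr => p _; ring.
Qed.

(** Tested against arbitrary vectors [h], the geodesic equation contains neither indices nor the
    inverse matrix. Conservation of energy, the first variation and covariance under change of chart
    are all read off from this form by choosing [h]. *)
Lemma euler_lagrange_contractP u v a : U u ->
  (forall h, form (G u) a h + form (dgram u v) v h - 2^-1 * form (dgram u h) v v = 0) <->
  a = geod_rhs u v.
Proof.
move=> Uu; split=> [EL|/(euler_lagrangeP v a Uu) EL h].
  apply/(euler_lagrangeP v a Uu) => p.
  have := EL (delta_mx 0 p); rewrite -euler_lagrange_contract // (bigD1 p) //= big1 ?addr0 => [|k kp].
    by rewrite mxE !eqxx mul1r.
  by rewrite mxE (negPf kp) andbF mul0r.
by rewrite -euler_lagrange_contract // big1 // => p _; rewrite EL mulr0.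
Qed.

(** Conservation of energy is the geodesic equation tested against the velocity itself. *)
Lemma energy_derive (c v : R -> V) (s : R) : U (c s) ->
  vderive c s (v s) -> vderive v s (geod_rhs (c s) (v s)) ->
  is_derive s 1 (fun t => form (G (c t)) (v t) (v t)) 0.
Proof.
move=> Uc cd vd; have := form_derive Uc cd vd vd.
have /(_ (v s)) := (euler_lagrange_contractP (v s) _ Uc).2 (erefl (geod_rhs (c s) (v s))).
rewrite (formC (v s) (geod_rhs _ _) (G_positive Uc).1) => h.
by congr (is_derive _ _ _ _); lra.
Qed.

End MetricField.

(** * Uniform bounds in a box and the first variation formula *)

Section MetricBounds.
Context {R : realType} {n : nat}.
Local Notation V := 'rV[R]_n.

Lemma bl_uniform (I : finType) (z : V) r (F : I -> V -> R) :
  (forall i, bounded_lipschitz z r (F i)) ->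
  exists2 B, 0 <= B & forall i, (forall u, cbox z r u -> `|F i u| <= B) /\
  (forall u u', cbox z r u -> cbox z r u' -> `|F i u - F i u'| <= B * `|u - u'|).
Proof.
move=> Fb; have [B BP] := choice (fun i => (exists2P _ _).1 (Fb i)).
have B0 i : 0 <= B i by have [] := BP i.
have BE i : B i <= \sum_i B i by rewrite (bigD1 i) //= lerDl sumr_ge0.
exists (\sum_i B i); first exact: sumr_ge0.
move=> i; have [_ [Bi Li]] := BP i; split=> [u zu|u u' zu zu'].
  exact: le_trans (Bi u zu) (BE i).
by rewrite (le_trans (Li u u' zu zu')) // ler_wpM2r.
Qed.

Lemma formBm (A A' : 'M[R]_n) (v w : V) : form (A - A') v w = form A v w - form A' v w.
Proof. by rewrite /form mulmxBr mulmxBl mxE [in X in _ + X]mxE. Qed.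

Lemma form_diff (A A' : 'M[R]_n) (v v' : V) :
  form A v v - form A' v' v' = form (A - A') v v + form A' (v - v') v + form A' v' (v - v').
Proof.
rewrite formBm formBl formBr; ring.
Qed.

Variables (U : set V) (G : V -> 'M[R]_n).
Hypothesis U_open : open U.
Hypothesis G_smooth : forall k l, smooth_on U (fun u => G u k l).
Hypothesis G_positive : forall u, U u -> positive (G u).
Local Notation dG q k l u := (partial q (fun v => G v k l) u).
Variables (z : V) (r : R).
Hypothesis box_sub : cbox z r `<=` U.

Lemma bl_gram k l : bounded_lipschitz z r (fun u => G u k l).
Proof. exact: bl_smooth (G_smooth k l) box_sub. Qed.

Lemma bl_dgram q k l : bounded_lipschitz z r (fun u => dG q k l u).
Proof. exact: bl_smooth (smooth_partial q (G_smooth k l)) box_sub. Qed.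

(** Cramer's rule: the inverse is the matrix of cofactors, polynomial in the entries, divided by the
    determinant. *)
Lemma bl_invmx_gram k l : bounded_lipschitz z r (fun u => invmx (G u) k l).
Proof.
have dN0 u : cbox z r u -> \det (G u) != 0.
  by move=> /box_sub/G_positive/positive_unitmx; rewrite unitmxE unitfE.
have d : bounded_lipschitz z r (fun u => \det (G u)) by apply: bl_det => i j; exact: bl_gram.
have a : bounded_lipschitz z r (fun u => \adj (G u) k l).
  apply: (bl_ext (f := fun u => cofactor (G u) l k)); first by move=> u _; rewrite mxE.
  apply: bl_mul; first exact: bl_cst.
  apply: bl_det => i j; apply: (bl_ext (f := fun u => G u (lift l i) (lift k j))).
    by move=> u _; rewrite !mxE.
  exact: bl_gram.
apply: bl_ext (bl_mul (bl_inv d dN0) a) => u zu.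
by rewrite /invmx (positive_unitmx (G_positive (box_sub zu))) [RHS]mxE.
Qed.

Lemma bl_chr m k l : bounded_lipschitz z r (fun u => chr G u m k l).
Proof.
apply: bl_mul; first exact: bl_cst.
apply: bl_sum => p; apply: bl_mul; first exact: bl_invmx_gram.
by apply: bl_add; [apply: bl_add|apply: bl_opp]; exact: bl_dgram.
Qed.

(** The right-hand side is quadratic in the velocity, so on velocities up to [eta] it has size of
    order [eta ^+ 2] and Lipschitz constant of order [eta]. It is this gain of one power of [eta]
    that makes small boxes good. *)
Lemma geod_rhs_bounds : exists2 C, 0 <= C & forall eta : R, 0 <= eta <= 1 ->
  (forall u v, cbox z r u -> cbox 0 eta v -> `|geod_rhs G u v| <= C * eta ^+ 2) /\
  (forall u u' v v', cbox z r u -> cbox z r u' -> cbox 0 eta v -> cbox 0 eta v' ->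
    `|geod_rhs G u v - geod_rhs G u' v'| <= C * eta * (`|u - u'| + `|v - v'|)).
Proof.
have [B B0 BP] := bl_uniform (fun x : 'I_n * 'I_n * 'I_n => bl_chr x.1.1 x.1.2 x.2).
pose A u m : 'M[R]_n := \matrix_(k, l) chr G u m k l.
have FE u v m : geod_rhs G u v 0 m = - form (A u m) v v.
  rewrite mxE formE; congr (- _); apply: eq_bigr => k _; apply: eq_bigr => l _.
  by rewrite mxE.
have n0 : 0 <= n%:R :> R by [].
pose K : R := n%:R * (n%:R * B).
have K0 : 0 <= K by rewrite !mulr_ge0.
have AB u : cbox z r u -> forall m k l, `|A u m k l| <= B.
  by move=> zu m k l; rewrite mxE; exact: (BP (m, k, l)).1.
exists (2 * K) => [|eta /andP[eta0 eta1]]; first by rewrite mulr_ge0.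
split=> [u v zu|u u' v v' zu zu']; rewrite /cbox /= !subr0.
  move=> ve; apply: rV_normP => [|m]; first by rewrite !mulr_ge0 // exprn_ge0.
  rewrite FE normrN (le_trans (form_bound _ _ B0 (AB u zu m))) //.
  rewrite -/K (@le_trans _ _ (K * eta ^+ 2)) //.
    by rewrite ler_wpM2l // expr2 ler_pM.
  by rewrite ler_wpM2r ?exprn_ge0 //; lra.
move=> ve ve'; apply: rV_normP => [|m].
  by rewrite !mulr_ge0 // addr_ge0.
rewrite mxE [X in _ + X]mxE !FE -opprD normrN form_diff.
have h1 : `|form (A u m - A u' m) v v| <= K * `|u - u'| * (eta * eta).
  have B1 : 0 <= B * `|u - u'| by rewrite mulr_ge0.
  have h k l : `|(A u m - A u' m) k l| <= B * `|u - u'|.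
    by rewrite !mxE; exact: (BP (m, k, l)).2.
  rewrite (le_trans (form_bound _ _ B1 h)) //.
  rewrite [n%:R * (B * _)]mulrA [n%:R * (_ * `|u - u'|)]mulrA -/K.
  by rewrite ler_wpM2l // ?mulr_ge0 // ler_pM.
have h2 : `|form (A u' m) (v - v') v| <= K * (`|v - v'| * eta).
  by rewrite (le_trans (form_bound _ _ B0 (AB u' zu' m))) // ler_wpM2l // ler_wpM2l.
have h3 : `|form (A u' m) v' (v - v')| <= K * (eta * `|v - v'|).
  by rewrite (le_trans (form_bound _ _ B0 (AB u' zu' m))) // ler_wpM2l // ler_wpM2r.
rewrite (le_trans (ler_normD _ _)) // (le_trans (lerD (ler_normD _ _) (lexx _))) //.
apply: le_trans (lerD (lerD h1 h2) h3) _.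
have e2 : eta * eta <= 2 * eta by rewrite ler_wpM2r //; lra.
have := ler_wpM2l (mulr_ge0 K0 (normr_ge0 (u - u'))) e2; lra.
Qed.

(** For the lower bound, [v] is recovered from the covector [v *m G u]: Cauchy-Schwarz bounds the
    entries of the latter by a multiple of the square root of the energy, and the inverse matrix is
    bounded on the box. *)
Lemma gram_elliptic : exists lam Lam, [/\ 0 < lam, 0 <= Lam & forall u v, cbox z r u ->
  lam * `|v| ^+ 2 <= form (G u) v v /\ form (G u) v v <= Lam * `|v| ^+ 2].
Proof.
have [B B0 BP] := bl_uniform (fun x : 'I_n * 'I_n => bl_gram x.1 x.2).
have [D D0 DP] := bl_uniform (fun x : 'I_n * 'I_n => bl_invmx_gram x.1 x.2).
have n0 : 0 <= n%:R :> R by [].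
pose K : R := (n%:R * D) ^+ 2 * B.
have K0 : 0 <= K by rewrite mulr_ge0 // exprn_ge0 // mulr_ge0.
exists (K + 1)^-1, (n%:R * (n%:R * B)); split; first by rewrite invr_gt0; lra.
  by rewrite !mulr_ge0.
move=> u v zu; have GP := G_positive (box_sub zu); split; last first.
  have AB k l : `|G u k l| <= B by exact: (BP (k, l)).1.
  by rewrite expr2 (le_trans (ler_norm _)) // form_bound.
pose E := form (G u) v v.
have E0 : 0 <= E by exact: positive_ge0.
have fd w j : form (G u) w (delta_mx 0 j) = (w *m G u) 0 j.
  rewrite /form mxE (bigD1 j) //= big1 ?addr0 => [|k kj].
    by have -> : (delta_mx 0 j : V)^T j 0 = 1; rewrite ?mulr1 // !mxE !eqxx.
  by have -> : (delta_mx 0 j : V)^T k 0 = 0; rewrite ?mulr0 // !mxE (negPf kj) andbF.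
have xE j : `|(v *m G u) 0 j| <= Num.sqrt (E * B).
  rewrite -fd -sqrtr_sqr ler_wsqrtr // (le_trans (form_cauchy_schwarz _ _ GP)) // ler_wpM2l //.
  rewrite fd -rowE mxE (le_trans (ler_norm _)) //; exact: (BP (j, j)).1.
have vB : `|v| <= n%:R * D * Num.sqrt (E * B).
  apply: rV_normP => [|m]; first by rewrite !mulr_ge0 // sqrtr_ge0.
  rewrite -[v](mulmxK (positive_unitmx GP)) mxE.
  rewrite (eq_bigr (fun j => invmx (G u) j m * (v *m G u) 0 j)) => [|j _]; last by rewrite mulrC.
  by apply: sum_abs_le => // j; exact: (DP (j, m)).1.
have v2 : `|v| ^+ 2 <= K * E.
  have : `|v| ^+ 2 <= (n%:R * D * Num.sqrt (E * B)) ^+ 2.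
    by rewrite lerXn2r ?nnegrE // !mulr_ge0 // sqrtr_ge0.
  rewrite exprMn sqr_sqrtr ?mulr_ge0 // => /le_trans; apply.
  by rewrite /K; lra.
by rewrite -/E ler_pdivrMl; lra.
Qed.

Lemma energy_constant (c v : R -> V) a b s t :
  ode (geod_rhs G) [set s | a <= s <= b] c v -> (forall s, a <= s <= b -> cbox z r (c s)) ->
  a <= s <= b -> a <= t <= b -> form (G (c s)) (v s) (v s) = form (G (c t)) (v t) (v t).
Proof.
move=> o cz sab tab; apply/eqP; rewrite -subr_eq0 -normr_le0.
rewrite -(mul0r `|s - t|).
apply: (@MVT_bound _ (fun s => form (G (c s)) (v s) (v s)) (fun=> 0) a b) => //.
  move=> x xab; have [cd vd] := o x xab.
  exact: (energy_derive U_open G_smooth G_positive (box_sub (cz x xab)) cd vd).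
by move=> x _; rewrite normr0.
Qed.

(** Energy is constant along each solution, so the difference of energies may be evaluated at any
    time. At the time supplied by the mean value theorem for the pairing of [v] with [c2 - c], the
    boundary terms become the linear part of this difference; this takes the place of an integration
    by parts. *)
Lemma first_variation (eta : R) : 0 <= eta -> exists2 C, 0 <= C &
  forall (c v c2 v2 : R -> V) (B : R),
  ode (geod_rhs G) [set s | 0 <= s <= 1] c v -> ode (geod_rhs G) [set s | 0 <= s <= 1] c2 v2 ->
  (forall s, 0 <= s <= 1 -> cbox z r (c s) /\ cbox 0 eta (v s)) ->
  (forall s, 0 <= s <= 1 -> cbox z r (c2 s) /\ cbox 0 eta (v2 s)) ->
  0 <= B -> (forall s, 0 <= s <= 1 -> `|v2 s - v s| <= B /\ `|c2 s - c s| <= B) ->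
  `|form (G (c2 0)) (v2 0) (v2 0) - form (G (c 0)) (v 0) (v 0)
    - 2 * (form (G (c 1)) (v 1) (c2 1 - c 1) - form (G (c 0)) (v 0) (c2 0 - c 0))| <= C * B ^+ 2.
Proof.
move=> eta0; have [D D0 DP] := bl_uniform (fun x : 'I_n * 'I_n * 'I_n => bl_dgram x.1.1 x.1.2 x.2).
have [E E0 EP] := bl_uniform (fun x : 'I_n * 'I_n => bl_gram x.1 x.2).
have [T TP] := choice (fun x : 'I_n * 'I_n => (exists2P _ _).1 (smooth_taylor (G_smooth x.1 x.2) box_sub)).
pose L := \sum_x T x.
have T0 x : 0 <= T x by have [] := TP x.
have TL x : T x <= L by rewrite /L (bigD1 x) //= lerDl sumr_ge0.
have L0 : 0 <= L by exact: sumr_ge0.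
have n0 : 0 <= n%:R :> R by [].
exists (n%:R * (n%:R * L) * (eta * eta) + 2 * (n%:R * (n%:R * (n%:R * D)) * eta) + n%:R * (n%:R * E)).
  by rewrite !addr_ge0 // !mulr_ge0.
move=> c v c2 v2 B o o2 i i2 B0 close.
pose h s := c2 s - c s.
pose phi s := form (G (c s)) (v s) (h s).
pose phi' s := 2^-1 * form (dgram G (c s) (h s)) (v s) (v s) + form (G (c s)) (v s) (v2 s - v s).
have [|s] := @MVT_between R phi phi' 0 1.
  rewrite min_l ?max_r // => s s01; have [cd vd] := o s s01; have [cd2 _] := o2 s s01.
  have Uc := box_sub (i s s01).1.
  have := form_derive U_open G_smooth Uc cd vd (vderiveB cd2 cd).
  have /(_ (h s)) := (euler_lagrange_contractP U_open G_positive (v s) _ Uc).2 erefl.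
  by move=> e; congr (is_derive _ _ _ (_ + _)); lra.
rewrite min_l ?max_r // subr0 mulr1 => s01 phiE.
have s0 : 0 <= (0 : R) <= 1 by lra.
have := energy_constant o (fun s s01 => (i s s01).1) s0 s01 => ->.
have := energy_constant o2 (fun s s01 => (i2 s s01).1) s0 s01 => ->.
rewrite -/(h 1) -/(h 0) -/(phi 1) -/(phi 0) phiE /phi'.
have [zc zv] := i s s01; have [zc2 zv2] := i2 s s01; have [k1 h1] := close s s01.
rewrite /cbox /= subr0 in zv; rewrite /cbox /= subr0 in zv2.
set A := G (c s); set A2 := G (c2 s); set x := v s in k1 zv *; set y := v2 s in k1 zv2 *.
have sA : A^T = A := (G_positive (box_sub zc)).1.
set S := dgram G (c s) (h s).
(* [A2 - A - S] is the second-order Taylor remainder of the metric; every other term on the right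
   has two factors of size [B]. *)
have -> : form A2 y y - form A x x - 2 * (2^-1 * form S x x + form A x (y - x)) =
    form (A2 - A - S) y y + (form S (y - x) y + form S x (y - x)) + form A (y - x) (y - x).
  by rewrite !formBm !formBl !formBr (formC y x sA); lra.
have b1 : `|form (A2 - A - S) y y| <= n%:R * (n%:R * (L * B ^+ 2)) * (eta * eta).
  have LB : 0 <= L * B ^+ 2 by rewrite mulr_ge0 // exprn_ge0.
  have e k l : `|(A2 - A - S) k l| <= L * B ^+ 2.
    rewrite !mxE; have [_ /(_ _ _ zc zc2)] := TP (k, l).
    rewrite (eq_bigr (fun q => dG q k l (c s) * h s 0 q)); last by move=> q _; rewrite !mxE.
    move=> /le_trans; apply; apply: ler_pM; [exact: T0|exact: exprn_ge0|exact: TL|].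
    by rewrite lerXn2r ?nnegrE.
  rewrite (le_trans (form_bound _ _ LB e)) // ler_wpM2l ?mulr_ge0 // ler_pM //.
have b2 : `|form S (y - x) y + form S x (y - x)| <= 2 * (n%:R * (n%:R * (n%:R * D * B)) * (B * eta)).
  have DB : 0 <= n%:R * D * B by rewrite !mulr_ge0.
  have e k m : `|S k m| <= n%:R * D * B.
    rewrite mxE; apply: sum_abs_le => // q; last by rewrite (le_trans (rV_coord_le _ _)).
    exact: (DP (q, k, m)).1.
  rewrite (le_trans (ler_normD _ _)) // mulrDl mul1r; apply: lerD.
    rewrite (le_trans (form_bound _ _ DB e)) // ler_wpM2l ?mulr_ge0 // ler_pM //.
  rewrite (le_trans (form_bound _ _ DB e)) // ler_wpM2l ?mulr_ge0 // mulrC ler_pM //.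
have b3 : `|form A (y - x) (y - x)| <= n%:R * (n%:R * E) * (B * B).
  have e k l : `|A k l| <= E by exact: (EP (k, l)).1.
  rewrite (le_trans (form_bound _ _ E0 e)) // ler_wpM2l ?mulr_ge0 // ler_pM //.
rewrite (le_trans (ler_normD _ _)) // (le_trans (lerD (ler_normD _ _) (lexx _))) //.
apply: le_trans (lerD (lerD b1 b2) b3) _.
by rewrite expr2; lra.
Qed.

End MetricBounds.

(** * Geodesics in charts *)

(** Passes from points to neighbourhoods: [P] also holds near each point near [s], so derivatives
    there may be computed from local identities between functions. *)
Lemma near_deep {R : realType} (P Q : R -> Prop) (s : R) :
  (\forall t \near s, P t) -> (forall t, (\forall t' \near t, P t') -> Q t) ->
  \forall t \near s, Q t.
Proof.
by move=> /nbhs_interior H PQ; apply: (@filterS _ (nbhs s) _ _ _ _ H) => t; exact: PQ.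
Qed.

Lemma geod_rhsE {R : realType} {n : nat} (G : 'rV[R]_n -> 'M[R]_n) u v m :
  geod_rhs G u v 0 m = - \sum_k \sum_l chr G u m k l * v 0 k * v 0 l.
Proof. by rewrite mxE. Qed.

Section Covariance.
Context {R : realType} {n : nat}.
Local Notation V := 'rV[R]_n.
Variables (M : closed_connected_manifold R n) (g : riemannian_metric M).
Local Notation A := (manifold_atlas M).
Local Notation chart := (Defs.chart A).
Local Notation dom := (@Defs.dom _ _ _ A).
Local Notation coord := (@Defs.coord _ _ _ A).
Local Notation param := (@Defs.param _ _ _ A).
Implicit Types (i j : chart) (u v w a : V) (x y : M).

Definition chart_image i : set V := coord i @` dom i.

Lemma coord_image i x : dom i x -> chart_image i (coord i x).
Proof. by move=> ix; exists x. Qed.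

Lemma param_dom i u : chart_image i u -> dom i (param i u).
Proof. by move=> [x ix <-]; rewrite coordK. Qed.

Lemma paramK i u : chart_image i u -> coord i (param i u) = u.
Proof. by move=> [x ix <-]; rewrite coordK. Qed.

Lemma gram_positive i u : chart_image i u -> positive (gram g i u).
Proof. by move=> iu; split=> [|v v0]; [exact: gram_sym|exact: gram_pos]. Qed.

Definition overlap i j : set V := coord i @` (dom i `&` dom j).

Lemma overlapP i j u : overlap i j u <-> chart_image i u /\ dom j (param i u).
Proof.
split=> [[x [ix jx] <-]|[[x ix <-]]]; first by split; [exists x|rewrite coordK].
by rewrite coordK // => jx; exists x.
Qed.

Lemma overlap_open i j : open (overlap i j).
Proof.
rewrite openE => u /overlapP[iu ju].
have iN : nbhs u (chart_image i) by apply: open_nbhs_nbhs; split; [exact: image_open|].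
have jN : nbhs u (param i @^-1` dom j).
  by apply: (param_continuous iu); apply: open_nbhs_nbhs; split; [exact: dom_open|].
by apply: filterS2 iN jN => w iw jw; apply/overlapP.
Qed.

Definition transition i j k (u : V) : R := coord j (param i u) 0 k.

Lemma transition_is_smooth i j k : smooth_on (overlap i j) (transition i j k).
Proof. exact: transition_smooth. Qed.

Lemma chart_image_open i : open (chart_image i).
Proof. exact: image_open. Qed.

Lemma gram_is_smooth i k l : smooth_on (chart_image i) (fun u => gram g i u k l).
Proof. exact: gram_smooth. Qed.

Definition transition_jacobian i j u : 'M[R]_n := \matrix_(p, k) partial p (transition i j k) u.

Lemma transition_jacobianE i j u : overlap i j u ->
  jacobian (coord j \o param i) u = transition_jacobian i j u.
Proof.
move=> iju; have ts k := transition_is_smooth i j k.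
have td k : differentiable (transition i j k) u.
  exact: (smooth_is_diff (@overlap_open i j) (ts k) iju).1.
have fE : coord j \o param i = \sum_k (fun w => transition i j k w *: (delta_mx 0 k : V)).
  by apply/funext => w; rewrite fct_sumE [LHS]row_sum_delta.
have fd : differentiable (coord j \o param i) u.
  by rewrite fE; apply: differentiable_sum => k; apply: differentiableZl.
apply/row_matrixP => p; rewrite [LHS]rowE -deriveEjacobian //.
rewrite derive_mx; last exact: diff_derivable.
by apply/rowP => k; rewrite !mxE.
Qed.

Lemma gram_transition i j u : overlap i j u ->
  let J := transition_jacobian i j u in
  gram g i u = J *m gram g j (coord j (param i u)) *m J^T.
Proof.
move=> iju; have [iu ju] := (overlapP i j u).1 iju.
have := gram_change g (param_dom iu) ju; rewrite paramK // -transition_jacobianE //.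
Qed.

Lemma form_transition i j u v w : overlap i j u ->
  let J := transition_jacobian i j u in
  form (gram g i u) v w = form (gram g j (coord j (param i u))) (v *m J) (w *m J).
Proof. by move=> iju J; rewrite (gram_transition iju) /form trmx_mul !mulmxA. Qed.

Lemma transition_jacobian_unit i j u : overlap i j u -> transition_jacobian i j u \in unitmx.
Proof.
move=> iju; have [iu ju] := (overlapP i j u).1 iju.
have := positive_unitmx (gram_positive iu); rewrite (gram_transition iju) !unitmx_mul.
by case/andP => /andP[].
Qed.

Definition transition_hessian i j u w : 'M[R]_n :=
  \matrix_(q, k) \sum_p partial p (partial q (transition i j k)) u * w 0 p.

Lemma transition_hessianC i j u v w : overlap i j u ->
  v *m transition_hessian i j u w = w *m transition_hessian i j u v.
Proof.
move=> iju; apply/rowP => k; rewrite !mxE.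
transitivity (\sum_q \sum_p v 0 q * (partial p (partial q (transition i j k)) u * w 0 p)).
  by apply: eq_bigr => q _; rewrite mxE mulr_sumr.
rewrite exchange_big /=; apply: eq_bigr => p _; rewrite mxE mulr_sumr; apply: eq_bigr => q _.
have -> := partialC p q (@overlap_open i j) (@transition_is_smooth i j k) iju.
by rewrite /transition; ring.
Qed.

Lemma vderive_transition i j (c : R -> V) s d : overlap i j (c s) -> vderive c s d ->
  vderive (fun t => coord j (param i (c t))) s (d *m transition_jacobian i j (c s)).
Proof.
move=> ijc cd k; have ts := transition_is_smooth i j k.
have := smooth_is_derive_comp (@overlap_open i j) ts ijc cd.
congr (is_derive _ _ _ _); rewrite mxE; apply: eq_bigr => q _.
by rewrite mxE mulrC.
Qed.

Lemma vderive_pushforward i j (c v : R -> V) s d v' : overlap i j (c s) -> vderive c s d ->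
  vderive v s v' ->
  vderive (fun t => v t *m transition_jacobian i j (c t)) s
    (v' *m transition_jacobian i j (c s) + v s *m transition_hessian i j (c s) d).
Proof.
move=> ijc cd vd k; have ts := transition_is_smooth i j k.
have -> : (fun t => (v t *m transition_jacobian i j (c t)) 0 k) =
    (fun t => \sum_q v t 0 q * partial q (transition i j k) (c t)).
  by apply/funext => t; rewrite mxE; apply: eq_bigr => q _; rewrite mxE.
rewrite !mxE -big_split /=; apply: is_derive_bigsum => q; rewrite !mxE.
apply: is_derive_mul (vd q) _.
exact: (smooth_is_derive_comp (@overlap_open i j) (smooth_partial q ts) ijc cd).
Qed.

(** Differentiates the transformation law of the metric along the line [u + t *: h], with [v] and
    [w] fixed in the chart [i]; both sides are the derivative at [0] of one function. *)
Lemma dgram_transition i j u v w h : overlap i j u ->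
  let J := transition_jacobian i j u in let H := transition_hessian i j u h in
  let Gj := gram g j (coord j (param i u)) in
  form (dgram (gram g i) u h) v w =
  form (dgram (gram g j) (coord j (param i u)) (h *m J)) (v *m J) (w *m J) +
  form Gj (v *m H) (w *m J) + form Gj (v *m J) (w *m H).
Proof.
move=> iju J H Gj; have [iu ju] := (overlapP i j u).1 iju.
pose c (t : R) := u + t *: h.
have c0 : c 0 = u by rewrite /c scale0r addr0.
have cd : vderive c 0 h.
  move=> k; have := is_derive_linear (h 0 k) (u 0 k) 0; congr (is_derive _ _ _ _).
  by apply/funext => t; rewrite !mxE addrC mulrC.
have kd (x : V) : vderive (fun=> x) (0 : R) 0.
  by move=> k; rewrite [(0 : V) 0 k]mxE; exact: (@is_derive_cst _ R R (x 0 k) 0 1).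
have d1 := form_derive (@chart_image_open i) (@gram_is_smooth i) _ cd (kd v) (kd w).
rewrite c0 in d1; have {}d1 := d1 iu.
have ijc : overlap i j (c 0) by rewrite c0.
have d2 := form_derive (@chart_image_open j) (@gram_is_smooth j)
  _ (vderive_transition ijc cd) (vderive_pushforward ijc cd (kd v)) (vderive_pushforward ijc cd (kd w)).
have jc : chart_image j (coord j (param i (c 0))) by rewrite c0; exact: coord_image.
have {}d2 := d2 jc; rewrite c0 !mul0mx !add0r in d2.
have e : \forall t \near (0 : R), form (gram g j (coord j (param i (c t)))) (v *m transition_jacobian i j (c t))
    (w *m transition_jacobian i j (c t)) = form (gram g i (c t)) v w.
  have : \forall t \near (0 : R), overlap i j (c t).
    apply: (vderive_continuous cd); rewrite c0.
    by apply: open_nbhs_nbhs; split; [exact: overlap_open|].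
  by apply: (@filterS _ (nbhs (0 : R))) => t ijt; rewrite (form_transition v w ijt).
have [_ d1E] := d1; have [_ d2E] := near_eq_is_derive e d2.
have f0 (B : 'M[R]_n) (x : V) : form B 0 x = 0 /\ form B x 0 = 0.
  by rewrite /form !mul0mx trmx0 mulmx0 mxE.
by move: d2E; rewrite d1E (f0 _ w).1 (f0 _ v).2 !addr0.
Qed.

(** In the tested equation the second derivatives of the transition enter through [dgram_transition]
    and cancel by their symmetry up to one term, which is the correction to the acceleration. The
    transformation law of the Christoffel symbols is never written out. *)
Lemma geod_rhs_transition i j u v a : overlap i j u -> a = geod_rhs (gram g i) u v ->
  let J := transition_jacobian i j u in
  a *m J + v *m transition_hessian i j u v = geod_rhs (gram g j) (coord j (param i u)) (v *m J).
Proof.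
move=> iju aE J; have [iu ju] := (overlapP i j u).1 iju.
have jiu : chart_image j (coord j (param i u)) by exact: coord_image.
apply/(euler_lagrange_contractP (@chart_image_open j) (@gram_positive j) _ _ jiu) => h'.
pose h := h' *m invmx J; have hJ : h' = h *m J by rewrite mulmxKV // transition_jacobian_unit.
have /(_ h) := (euler_lagrange_contractP (@chart_image_open i) (@gram_positive i) v a iu).2 aE.
rewrite (form_transition _ _ iju) !(dgram_transition _ _ _ iju) -/J -hJ.
rewrite (transition_hessianC v h iju) (formC (h *m _) _ (gram_positive jiu).1) formDl.
rewrite (transition_hessianC h v iju).
lra.
Qed.

Definition local_solution i (gamma : R -> M) (e : R) (c v : R -> V) (s : R) :=
  [/\ chart_image i (c s), gamma s = param i (c s), vderive c s (v s),
    vderive v s (geod_rhs (gram g i) (c s) (v s)) & form (gram g i (c s)) (v s) (v s) = e].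

(* [e] is the squared speed, so that [e = 0] stands for a constant curve. *)
Definition geodesic_at (e : R) (gamma : R -> M) (s : R) :=
  exists i (c v : R -> V), \forall t \near s, local_solution i gamma e c v t.

Lemma geodesic_at_continuous e gamma s : geodesic_at e gamma s -> {for s, continuous gamma}.
Proof.
move=> [i [c [v H]]]; have [ic gs cd _ _] := nbhs_singleton H.
have gc : {for s, continuous (param i \o c)}.
  by apply: continuous_comp; [exact: vderive_continuous cd|exact: param_continuous].
move=> B; rewrite gs => /gc; apply: (@filterS2 _ (nbhs s) _ _ _ _ _ H) => t [_ gt _ _ _] /=.
by rewrite gt.
Qed.

(** [geodesic_at] only provides some chart. By covariance every chart around the point will do, with
    the velocity pushed forward by the transition. *)
Lemma geodesic_at_chart e gamma s j : geodesic_at e gamma s -> dom j (gamma s) ->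
  \forall t \near s, local_solution j gamma e (coord j \o gamma) (derive1 (coord j \o gamma)) t.
Proof.
move=> gat js; have gc := geodesic_at_continuous gat; have [i [c [v H]]] := gat.
have jN : \forall t \near s, dom j (gamma t).
  by apply: gc; apply: open_nbhs_nbhs; split; [exact: dom_open|].
pose v2 t := v t *m transition_jacobian i j (c t).
have K1 : \forall t \near s, [/\ local_solution i gamma e c v t, overlap i j (c t) &
    vderive (coord j \o gamma) t (v2 t)].
  apply: (near_deep (filterI H jN)) => t tP.
  have [[ic gt cd vd E] jt] := nbhs_singleton tP.
  have ijc : overlap i j (c t) by apply/overlapP; rewrite -gt.
  split=> //; apply: vderive_near (vderive_transition ijc cd).
  by apply: (@filterS _ (nbhs t) _ _ _ _ tP) => t' [[_ gt' _ _ _] _] /=; rewrite gt'.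
apply: (near_deep K1) => t tP.
have [[ic gt cd vd E] ijc jd] := nbhs_singleton tP.
have jt : dom j (gamma t) by have := (overlapP i j (c t)).1 ijc; rewrite -gt; case.
have d1E : derive1 (coord j \o gamma) t = v2 t by have [] := (vderive_derive1 _ _ _).1 jd.
have gE : coord j (param i (c t)) = (coord j \o gamma) t by rewrite /= gt.
split.
- exact: coord_image.
- by rewrite /= coordK.
- by rewrite d1E.
- rewrite d1E -gE -(geod_rhs_transition ijc erefl).
  apply: vderive_near (vderive_pushforward ijc cd vd).
  by apply: (@filterS _ (nbhs t) _ _ _ _ tP) => t' [_ _ /vderive_derive1[_ ->]].
- by rewrite d1E -gE -E (form_transition _ _ ijc).
Qed.

Lemma geodesic_at_ext e (gamma gamma' : R -> M) s : (\near s, gamma s = gamma' s) ->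
  geodesic_at e gamma s -> geodesic_at e gamma' s.
Proof.
move=> gg [i [c [v H]]]; exists i, c, v.
by apply: (@filterS2 _ (nbhs s) _ _ _ _ _ gg H) => t gt [ic E ? ? ?]; split=> //; rewrite -gt.
Qed.

Lemma geodesic_at_affine e gamma (a b s : R) : geodesic_at e gamma (a * s + b) ->
  geodesic_at (a ^+ 2 * e) (fun t => gamma (a * t + b)) s.
Proof.
move=> [i [c [v H]]]; exists i, (fun t => c (a * t + b)), (fun t => a *: v (a * t + b)).
have lc : {for s, continuous (fun t : R => a * t + b)}.
  exact: is_derive_continuous (is_derive_linear a b s).
apply: (@filterS _ (nbhs s) _ _ _ _ (lc _ H)) => t [ic gt cd vd E]; split=> //.
- exact: vderive_affine.
- have -> : geod_rhs (gram g i) (c (a * t + b)) (a *: v (a * t + b)) =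
      a *: (a *: geod_rhs (gram g i) (c (a * t + b)) (v (a * t + b))).
    apply/rowP => m; rewrite !mxE !mulrN !mulr_sumr; congr (- _); apply: eq_bigr => k _.
    by rewrite !mulr_sumr; apply: eq_bigr => l _; rewrite !mxE; ring.
  move=> j; have h := vderive_affine vd j.
  have -> : (fun t0 => (a *: v (a * t0 + b)) 0 j) = (fun t0 => a * v (a * t0 + b) 0 j).
    by apply/funext => t0; rewrite mxE.
  have := is_derive_mul (@is_derive_cst _ R R a t 1) h; rewrite mul0r add0r.
  by move=> h2; apply: (is_derive_eq h2); rewrite /= !mxE.
- by rewrite formZl formZr E; ring.
Qed.

Lemma unit_speed_geodesic_at J gamma : open J ->
  unit_speed_geodesic_on g J gamma <-> forall s, J s -> geodesic_at 1 gamma s.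
Proof.
move=> oJ; split=> [H s Js|H s Js].
  have [i is_] := @dom_cover _ _ _ A (gamma s).
  have [gc _] := H s Js.
  have : \forall t \near s, J t /\ dom i (gamma t).
    apply: filterI; first exact: open_nbhs_nbhs.
    by apply: gc; apply: open_nbhs_nbhs; split; [exact: dom_open|].
  move=> HJ; exists i, (coord i \o gamma), (derive1 (coord i \o gamma)).
  apply: (@filterS _ (nbhs s) _ _ _ _ HJ) => t [Jt it]; have [_ /(_ i it)[cd c'd c'E E]] := H t Jt.
  split=> //.
  - exact: coord_image.
  - by rewrite /= coordK.
  - exact/vderive_derive1.
  - apply/vderive_derive1; split=> //; apply/rowP => m; rewrite c'E mxE; congr (- _).
have gat := H s Js; split; first exact: geodesic_at_continuous gat.
move=> i is_ c c'; have [ic _ /vderive_derive1[cd _] /vderive_derive1[c'd c'E] E] :=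
  nbhs_singleton (geodesic_at_chart gat is_).
split; [exact: cd|exact: c'd|move=> m|exact: E].
exact: etrans (congr1 (fun w : V => w 0 m) c'E) (geod_rhsE _ _ _ m).
Qed.

End Covariance.

(** * Small coordinate boxes *)

Section RealInduction.
Context {R : realType}.

(** The supremum of the times [t] such that [P] holds on [[a, t]] is attained by the last hypothesis
    and cannot lie below [b] by the one before it. *)
Lemma real_induction (P : R -> Prop) (a b : R) : a <= b -> P a ->
  (forall t, a <= t < b -> (forall s, a <= s <= t -> P s) ->
     exists2 e, 0 < e & forall s, t < s < t + e -> P s) ->
  (forall t, a < t <= b -> (forall s, a <= s < t -> P s) -> P t) ->
  forall s, a <= s <= b -> P s.
Proof.
move=> ab Pa Pr Pl; pose S := [set t | a <= t <= b /\ forall s, a <= s <= t -> P s].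
have Sa : S a by rewrite /S /= lexx ab; split=> // s; rewrite -eq_le => /eqP <-.
have Sub : has_ubound S by exists b => t [/andP[]].
have Ssup : has_sup S by split; [exists a|].
pose T := sup S; have aT : a <= T by exact: ub_le_sup.
have Tb : T <= b by apply: ge_sup; [exists a|move=> t [/andP[]]].
have ltT s : a <= s < T -> P s.
  move=> /andP[as_ sT]; have d0 : 0 < T - s by rewrite subr_gt0.
  have [t [_ Pt]] := sup_adherent d0 Ssup; rewrite -/T subKr => st.
  by apply: Pt; rewrite as_ ltW.
have PT : P T.
  have [<- //|aT'] := eqVneq a T; apply: Pl => [|s]; last exact: ltT.
  by rewrite lt_neqAle aT' aT.
have leT s : a <= s <= T -> P s.
  by rewrite [s <= T]le_eqVlt => /andP[as_ /orP[/eqP -> //|sT]]; apply: ltT; rewrite as_.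
have [TbE|Tb'] := eqVneq T b; first by rewrite -TbE.
have {Tb'}Tb' : T < b by rewrite lt_neqAle Tb'.
have [|e e0 eP] := Pr T _ leT; first by rewrite aT.
pose t := Num.min b (T + e / 2).
have Tt : T < t by rewrite /t lt_min Tb' /=; lra.
have : S t.
  split=> [|s /andP[as_ st]].
    by rewrite (le_trans aT (ltW Tt)) /= /t ge_min lexx.
  have [sT|Ts] := leP s T; first by apply: leT; rewrite as_.
  by apply: eP; rewrite Ts (le_lt_trans st) // /t gt_min; apply/orP; right; lra.
by move/(ub_le_sup Sub); rewrite leNgt Tt.
Qed.

Lemma closed_left_limit (X : topologicalType) (gamma : R -> X) (C : set X) (a t : R) :
  a < t -> closed C -> {for t, continuous gamma} -> (forall s, a <= s < t -> C (gamma s)) -> C (gamma t).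
Proof.
move=> at_ cC gc gC; apply: contrapT => nC.
have : nbhs (gamma t) (~` C) by apply: open_nbhs_nbhs; split=> //; exact: closed_openC.
move/gc => /nbhs_ballP[e /= e0 eP].
pose s := Num.max a (t - e / 2).
have st : s < t by rewrite /s gt_max at_ /=; lra.
apply: (eP s); last by apply: gC; rewrite st andbT /s le_max lexx.
rewrite /ball /= gtr0_norm ?subr_gt0 // /s ltrBlDr -ltrBlDl lt_max; apply/orP; right; lra.
Qed.

End RealInduction.

Section GoodBoxes.
Context {R : realType} {n : nat}.
Local Notation V := 'rV[R]_n.
Variables (M : closed_connected_manifold R n) (g : riemannian_metric M).
Local Notation A := (manifold_atlas M).
Local Notation chart := (Defs.chart A).
Local Notation dom := (@Defs.dom _ _ _ A).
Local Notation coord := (@Defs.coord _ _ _ A).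
Local Notation param := (@Defs.param _ _ _ A).
Implicit Types (i j : chart) (u v w a : V) (x y : M).

(* Around every point, a coordinate box of size [20 * rho] so small that the boundary value
   problem for geodesics is solvable and well-posed between points of the box of size [2 * rho]. *)
Record good_box := GoodBox {
  box_chart : chart;
  center : V;
  rho : R;
  lam : R;
  Lam : R;
  box_rho_gt0 : 0 < rho;
  box_image : cbox center (20 * rho) `<=` chart_image box_chart;
  box_rhs_bounded : forall u v, cbox center (20 * rho) u -> cbox 0 (6 * rho) v ->
    `|geod_rhs (gram g box_chart) u v| <= rho;
  box_rhs_lipschitz : forall u u' v v', cbox center (20 * rho) u -> cbox center (20 * rho) u' ->
    cbox 0 (6 * rho) v -> cbox 0 (6 * rho) v' ->
    `|geod_rhs (gram g box_chart) u v - geod_rhs (gram g box_chart) u' v'|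
      <= 1 / 100 * (`|u - u'| + `|v - v'|);
  lam_gt0 : 0 < lam;
  Lam_ge0 : 0 <= Lam;
  box_elliptic : forall u v, cbox center (20 * rho) u ->
    lam * `|v| ^+ 2 <= form (gram g box_chart u) v v /\ form (gram g box_chart u) v v <= Lam * `|v| ^+ 2
}.

Lemma good_box_exists x : exists b : good_box, dom (box_chart b) x /\ coord (box_chart b) x = center b.
Proof.
have [i ix] := @dom_cover _ _ _ A x.
have [r0 r00 r0P] := open_cbox (@chart_image_open _ _ M i) (coord_image ix).
have [C C0 CP] := geod_rhs_bounds (@gram_is_smooth _ _ M g i) (@gram_positive _ _ M g i) r0P.
have [lam [Lam [lam0 Lam0 ell]]] := gram_elliptic (@gram_is_smooth _ _ M g i) (@gram_positive _ _ M g i) r0P.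
(* With [rho <= K^-1] and [eta = 6 * rho] one has [C * eta ^+ 2 = 36 * C * rho ^+ 2 <= rho] and
   [C * eta <= 1 / 100]; the bound [rho <= r0 / 20] makes the box fit into the chart. *)
pose K := 6 * (100 * (C + 1)); have K0 : 0 < K by rewrite /K; lra.
pose rho := Num.min (r0 / 20) K^-1.
have r1 : 0 < K^-1 by rewrite invr_gt0.
have rho0 : 0 < rho by rewrite /rho lt_min r1 andbT; lra.
have rho1 : 20 * rho <= r0 by have : rho <= r0 / 20; [rewrite /rho ge_min lexx|lra].
have rho2 : 6 * (100 * (C + 1)) * rho <= 1.
  rewrite -/K mulrC -ler_pdivlMr // mul1r; by rewrite /rho ge_min lexx orbT.
have sub := sub_cbox (z := coord i x) rho1.
have Crho : 0 <= C * rho by rewrite mulr_ge0 // ltW.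
have eta01 : 0 <= 6 * rho <= 1 by lra.
have [Fb Fl] := CP _ eta01.
unshelve eexists (@GoodBox i (coord i x) rho lam Lam rho0 _ _ _ lam0 Lam0 _) => //.
- exact: subset_trans r0P.
- move=> u v /sub zu zv; rewrite (le_trans (Fb _ _ zu zv)) //.
  have -> : C * (6 * rho) ^+ 2 = 36 * (C * rho) * rho by ring.
  by rewrite ler_piMl //; [exact: ltW|lra].
- move=> u u' v v' /sub zu /sub zu' zv zv'; rewrite (le_trans (Fl _ _ _ _ zu zu' zv zv')) //.
  by rewrite ler_wpM2r ?addr_ge0 //; lra.
- by move=> u v /sub zu; exact: ell.
Qed.

Section OneBox.
Variable b : good_box.
Local Notation i := (box_chart b).
Local Notation z := (center b).
Local Notation r := (rho b).
Local Notation G := (gram g i).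
Local Notation F := (geod_rhs G).

Let r0 : 0 < r := box_rho_gt0 b.

Definition in_box (s : R) : set M := [set x | dom i x /\ obox z s (coord i x)].
Definition in_cbox (s : R) : set M := [set x | dom i x /\ cbox z s (coord i x)].

Lemma in_box_open s : open (in_box s).
Proof.
rewrite openE => x [ix zx]; have dN : nbhs x (dom i).
  by apply: open_nbhs_nbhs; split; [exact: dom_open|].
have oN : nbhs x (coord i @^-1` obox z s).
  by apply: (Defs.coord_continuous ix); apply: open_nbhs_nbhs; split; [exact: obox_open|].
by apply: filterS2 dN oN.
Qed.

Lemma sub_in_cbox s t : s <= t -> in_cbox s `<=` in_cbox t.
Proof. by move=> st x [ix zx]; split=> //; exact: sub_cbox zx. Qed.

Lemma in_box_cbox s : in_box s `<=` in_cbox s.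
Proof. by move=> x [ix /ltW zx]. Qed.

Lemma in_cbox_box s t : s < t -> in_cbox s `<=` in_box t.
Proof. by move=> st x [ix zx]; split=> //; exact: le_lt_trans st. Qed.

Lemma param_in_cbox s u : s <= 20 * r -> cbox z s u -> in_cbox s (param i u) /\ coord i (param i u) = u.
Proof.
move=> s20 zu; have iu : chart_image i u by apply: (@box_image b); exact: sub_cbox zu.
by rewrite /in_cbox /= paramK //; split=> //; split=> //; exact: param_dom.
Qed.

Lemma in_cboxE s : s <= 20 * r -> in_cbox s = param i @` cbox z s.
Proof.
move=> s20; apply/seteqP; split=> x.
  by move=> [ix zx]; exists (coord i x) => //; exact: coordK.
by move=> [u zu <-]; have [] := param_in_cbox s20 zu.
Qed.

Lemma in_cbox_compact s : s <= 20 * r -> compact (in_cbox s).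
Proof.
move=> s20; rewrite in_cboxE //; apply: continuous_compact; last exact: cbox_compact.
apply: continuous_in_subspaceT => u /set_mem zu.
by apply: param_continuous; apply: (@box_image b); exact: sub_cbox zu.
Qed.

Lemma in_cbox_closed s : s <= 20 * r -> closed (in_cbox s).
Proof. by move=> s20; apply: compact_closed; [exact: manifold_hausdorff|exact: in_cbox_compact]. Qed.

Lemma edge_exists : exists edge : V -> V -> (R -> V) * (R -> V), forall u w,
  cbox z (2 * r) u -> cbox z (2 * r) w ->
  [/\ (edge u w).1 0 = u, (edge u w).1 1 = w, ode F wide (edge u w).1 (edge u w).2 &
   forall s, wide s -> cbox z (20 * r) ((edge u w).1 s) /\ cbox 0 (6 * r) ((edge u w).2 s)].
Proof.
have L01 : 0 <= (1 / 100 : R) <= 1 / 100 by lra.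
have H (uw : V * V) : exists cv : (R -> V) * (R -> V), cbox z (2 * r) uw.1 -> cbox z (2 * r) uw.2 ->
    [/\ cv.1 0 = uw.1, cv.1 1 = uw.2, ode F wide cv.1 cv.2 &
     forall s, wide s -> cbox z (20 * r) (cv.1 s) /\ cbox 0 (6 * r) (cv.2 s)].
  have [zu|nu] := pselect (cbox z (2 * r) uw.1); last by exists (cst 0, cst 0).
  have [zw|nw] := pselect (cbox z (2 * r) uw.2); last by exists (cst 0, cst 0).
  have [c [v P]] := bvp_exists (@box_rhs_bounded b) (@box_rhs_lipschitz b) L01 (ltW r0) zu zw erefl erefl (lexx r).
  by exists (c, v).
have [e eP] := fun_choice H; exists (fun u w => e (u, w)) => u w zu zw.
exact: (eP (u, w) zu zw).
Qed.

End OneBox.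
End GoodBoxes.

(** * Geodesic edges *)

Section Edges.
Context {R : realType} {n : nat}.
Local Notation V := 'rV[R]_n.
Variables (M : closed_connected_manifold R n) (g : riemannian_metric M).
Local Notation A := (manifold_atlas M).
Local Notation dom := (@Defs.dom _ _ _ A).
Local Notation coord := (@Defs.coord _ _ _ A).
Local Notation param := (@Defs.param _ _ _ A).
Variable b : good_box g.
Local Notation i := (box_chart b).
Local Notation z := (center b).
Local Notation r := (rho b).
Local Notation G := (gram g i).
Local Notation F := (geod_rhs G).
Implicit Types (u w : V) (e : R) (gamma : R -> M).

Let r0 : 0 < r := box_rho_gt0 b.

Definition unit_itv : set R := [set s | 0 <= s <= 1].

Lemma unit_wide s : unit_itv s -> wide s.
Proof. by rewrite /unit_itv /wide /=; lra. Qed.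

Definition box_solution (X : set R) (c v : R -> V) :=
  ode F X c v /\ forall s, X s -> cbox z (20 * r) (c s) /\ cbox 0 (6 * r) (v s).

Lemma box_solution_sub (X Y : set R) c v : Y `<=` X -> box_solution X c v -> box_solution Y c v.
Proof. by move=> YX [ho h]; split=> s /YX Xs; [exact: ho|exact: h]. Qed.

Definition edge : V -> V -> (R -> V) * (R -> V) := sval (cid (edge_exists b)).

Lemma edgeP u w : cbox z (2 * r) u -> cbox z (2 * r) w ->
  [/\ (edge u w).1 0 = u, (edge u w).1 1 = w & box_solution wide (edge u w).1 (edge u w).2].
Proof.
move=> zu zw; have [e0 e1 eo eb] := svalP (cid (edge_exists b)) u w zu zw.
by split.
Qed.

Definition edge_energy u w : R := form (G u) ((edge u w).2 0) ((edge u w).2 0).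

Lemma box_bvp_dependence c1 v1 c2 v2 B : box_solution unit_itv c1 v1 -> box_solution unit_itv c2 v2 ->
  `|c1 0 - c2 0| <= B -> `|c1 1 - c2 1| <= B ->
  forall s, unit_itv s -> `|v1 s - v2 s| <= 10 * B /\ `|c1 s - c2 s| <= 10 * B.
Proof.
move=> [ho1 i1] [ho2 i2] h0 h1.
have a0 : -1 <= (0 : R) <= 0 by lra.
have a1 : 1 <= (1 : R) <= 2 by lra.
have L0 : 0 <= (1 / 100 : R) <= 1 / 100 by lra.
exact: (bvp_dependence (@box_rhs_bounded _ _ _ _ b) (@box_rhs_lipschitz _ _ _ _ b) a0 a1 L0 ho1 ho2 i1 i2 h0 h1).
Qed.

Lemma box_solution_unique c1 v1 c2 v2 : box_solution unit_itv c1 v1 -> box_solution unit_itv c2 v2 ->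
  c1 0 = c2 0 -> c1 1 = c2 1 -> forall s, unit_itv s -> v1 s = v2 s /\ c1 s = c2 s.
Proof.
move=> b1 b2 h0 h1 s s01.
have := box_bvp_dependence (B := 0) b1 b2; rewrite h0 h1 !subrr normr0 lexx mulr0 => /(_ isT isT s s01).
by rewrite !normr_le0 !subr_eq0 => -[/eqP ? /eqP ?].
Qed.

Lemma const_solution u : cbox z (20 * r) u -> box_solution unit_itv (fun=> u) (fun=> 0).
Proof.
move=> zu; split=> s _; last by split=> //; rewrite /cbox /= subrr normr0; have := r0; lra.
have k0 (x : V) : vderive (fun=> x) s 0.
  by move=> k; rewrite [(0 : V) 0 k]mxE; exact: (@is_derive_cst _ R R (x 0 k) s 1).
split; first exact: k0.
suff -> : F u 0 = 0 by exact: k0.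
apply/rowP => m; rewrite geod_rhsE mxE big1 ?oppr0 // => k _; rewrite big1 // => l _.
by rewrite [(0 : V) 0 l]mxE mulr0.
Qed.

Lemma box_energy X c v a a' s t : (forall s, a <= s <= a' -> X s) -> box_solution X c v -> a <= s <= a' -> a <= t <= a' ->
  form (G (c s)) (v s) (v s) = form (G (c t)) (v t) (v t).
Proof.
move=> aX [ho h]; apply: (energy_constant (@chart_image_open _ _ M i) (@gram_is_smooth _ _ M g i)
  (@gram_positive _ _ M g i) (@box_image _ _ _ _ b)) => [x /aX Xx|x /aX Xx]; [exact: ho|exact: (h x Xx).1].
Qed.

Lemma edge_energyE u w s : cbox z (2 * r) u -> cbox z (2 * r) w -> wide s ->
  form (G ((edge u w).1 s)) ((edge u w).2 s) ((edge u w).2 s) = edge_energy u w.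
Proof.
move=> zu zw s12; have [e0 _ eb] := edgeP zu zw.
rewrite /edge_energy -{4}e0; apply: (box_energy (a := -1) (a' := 2) _ eb) => //.
by lra.
Qed.

Lemma edge_energy_ge0 u w : cbox z (2 * r) u -> 0 <= edge_energy u w.
Proof.
move=> zu; apply: positive_ge0; apply: gram_positive; apply: (@box_image _ _ _ _ b).
by apply: sub_cbox zu; have := r0; lra.
Qed.

(** Compares the edge with the constant curve at [u]: by continuous dependence its initial speed is
    at most [10 * |w - u|]. *)
Lemma edge_energy_bound u w : cbox z (2 * r) u -> cbox z (2 * r) w ->
  edge_energy u w <= 100 * Lam b * `|w - u| ^+ 2.
Proof.
move=> zu zw; have [e0 e1 eb] := edgeP zu zw.
have zu20 : cbox z (20 * r) u by apply: sub_cbox zu; have := r0; lra.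
have s0 : unit_itv (0 : R) by rewrite /unit_itv /=; lra.
have := box_bvp_dependence (B := `|w - u|) (box_solution_sub unit_wide eb) (const_solution zu20).
rewrite e0 e1 subrr normr0 => /(_ (normr_ge0 _) (lexx _) 0 s0)[].
rewrite subr0 => vB _.
have [_ h] := box_elliptic ((edge u w).2 0) zu20.
rewrite /edge_energy (le_trans h) // [100 * _]mulrC -mulrA ler_wpM2l //; first exact: Lam_ge0.
have -> : 100 * `|w - u| ^+ 2 = (10 * `|w - u|) ^+ 2 by ring.
by rewrite lerXn2r // nnegrE // mulr_ge0.
Qed.

Lemma edge_variation : exists2 C, 0 <= C & forall u w u' w',
  cbox z (2 * r) u -> cbox z (2 * r) w -> cbox z (2 * r) u' -> cbox z (2 * r) w' ->
  `|edge_energy u' w' - edge_energy u w - 2 * (form (G w) ((edge u w).2 1) (w' - w)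
     - form (G u) ((edge u w).2 0) (u' - u))| <= C * (`|u' - u| + `|w' - w|) ^+ 2.
Proof.
have e0 : 0 <= 6 * r by have := r0; lra.
have [C C0 CP] := first_variation (@chart_image_open _ _ M i) (@gram_is_smooth _ _ M g i)
  (@gram_positive _ _ M g i) (@box_image _ _ _ _ b) e0.
exists (100 * C); first by rewrite mulr_ge0.
move=> u w u' w' zu zw zu' zw'; have [c0 c1 cb] := edgeP zu zw; have [d0 d1 db] := edgeP zu' zw'.
have cbu := box_solution_sub unit_wide cb; have dbu := box_solution_sub unit_wide db.
pose B := `|u' - u| + `|w' - w|.
have h0 : `|(edge u' w').1 0 - (edge u w).1 0| <= B by rewrite c0 d0 lerDl.
have h1 : `|(edge u' w').1 1 - (edge u w).1 1| <= B by rewrite c1 d1 lerDr.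
have dep := box_bvp_dependence dbu cbu h0 h1.
have B0 : 0 <= 10 * B by rewrite mulr_ge0 // addr_ge0.
have := CP _ _ _ _ (10 * B) cbu.1 dbu.1 cbu.2 dbu.2 B0 dep.
rewrite c0 c1 d0 d1 => /le_trans; apply.
by rewrite le_eqVlt; apply/orP; left; apply/eqP; rewrite /B; ring.
Qed.

Lemma edge_energy_lipschitz : exists2 K, 0 <= K & forall u w u' w',
  cbox z (2 * r) u -> cbox z (2 * r) w -> cbox z (2 * r) u' -> cbox z (2 * r) w' ->
  `|edge_energy u' w' - edge_energy u w| <= K * (`|u' - u| + `|w' - w|).
Proof.
have [C C0 CP] := edge_variation.
have [B B0 BP] := bl_uniform (fun x : 'I_n * 'I_n =>
  bl_gram (@gram_is_smooth _ _ M g i) (@box_image _ _ _ _ b) x.1 x.2).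
pose D := n%:R * (n%:R * B) * (6 * r).
have D0 : 0 <= D by rewrite !mulr_ge0 //; have := r0; lra.
exists (2 * D + 8 * r * C).
  by rewrite addr_ge0 ?mulr_ge0 //; have := r0; lra.
move=> u w u' w' zu zw zu' zw'.
have sub : cbox z (2 * r) `<=` cbox z (20 * r) by apply: sub_cbox; have := r0; lra.
have [c0 c1 [_ cb]] := edgeP zu zw.
have fB x s h : cbox z (2 * r) x -> wide s -> `|form (G x) ((edge u w).2 s) h| <= D * `|h|.
  move=> zx s12; have [_] := cb s s12; rewrite /cbox /= subr0 => vB.
  have GB k l : `|G x k l| <= B by exact: (BP (k, l)).1 _ (sub _ zx).
  by rewrite (le_trans (form_bound _ _ B0 GB)) // /D -[leRHS]mulrA ler_wpM2l ?mulr_ge0 // ler_wpM2r.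
have w1 : wide (1 : R) by rewrite /wide /=; lra.
have w0 : wide (0 : R) by rewrite /wide /=; lra.
set S := `|u' - u| + `|w' - w|.
have S8 : S <= 8 * r.
  have := ler_dist_via z u' u; have := ler_dist_via z w' w.
  by move: zu zw zu' zw'; rewrite /cbox /= /S; lra.
have S0 : 0 <= S by rewrite addr_ge0.
have CS : C * S ^+ 2 <= 8 * r * C * S.
  have := ler_wpM2l (mulr_ge0 C0 S0) S8; lra.
have := CP _ _ _ _ zu zw zu' zw'; rewrite -/S.
set X := edge_energy u' w' - _; set Y := 2 * _ => XY.
have YB : `|Y| <= 2 * D * S.
  rewrite normrM ger0_norm // -mulrA ler_wpM2l // (le_trans (ler_normB _ _)) //.
  by rewrite /S mulrDr addrC; apply: lerD; exact: fB.
have -> : X = (X - Y) + Y by rewrite subrK.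
rewrite (le_trans (ler_normD _ _)) // mulrDl; lra.
Qed.

Lemma box_solution_geodesic X c v s gamma : open X -> X s -> box_solution X c v ->
  (forall t, X t -> gamma t = param i (c t)) ->
  (forall t, X t -> form (G (c t)) (v t) (v t) = form (G (c s)) (v s) (v s)) ->
  geodesic_at g (form (G (c s)) (v s) (v s)) gamma s.
Proof.
move=> oX Xs [ho h] gE eE; exists i, c, v.
have : \forall t \near s, X t by exact: open_nbhs_nbhs.
apply: (@filterS _ (nbhs s)) => t Xt; have [cd vd] := ho t Xt; split=> //.
- by apply: (@box_image _ _ _ _ b); exact: (h t Xt).1.
- exact: gE.
- exact: eE.
Qed.

Lemma edge_geodesic u w : cbox z (2 * r) u -> cbox z (2 * r) w -> forall s, -1 < s < 2 ->
  geodesic_at g (edge_energy u w) (fun t => param i ((edge u w).1 t)) s.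
Proof.
move=> zu zw s s12; have [c0 c1 cb] := edgeP zu zw.
have sub : `](-1 : R), 2[%classic `<=` wide.
  by move=> t; rewrite /wide /= in_itv /= => /andP[a c]; rewrite !ltW.
have s12' : `](-1 : R), 2[%classic s by rewrite /= in_itv.
rewrite -(edge_energyE zu zw (sub _ s12')).
apply: (box_solution_geodesic (interval_open _ _ : open `](-1 : R), 2[%classic) s12' (box_solution_sub sub cb)) => // t t12.
by rewrite !edge_energyE //; exact: sub.
Qed.

(* Geodesics of squared speed at most [edge_bound] over unit time cannot leave the box. *)
Definition edge_bound : R := lam b * (r / 4) ^+ 2.

Lemma edge_bound_gt0 : 0 < edge_bound.
Proof. by rewrite mulr_gt0 ?lam_gt0 // exprn_gt0 // divr_gt0. Qed.

Lemma slow_velocity e u v : cbox z (20 * r) u -> form (G u) v v = e -> e <= edge_bound -> `|v| <= r / 4.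
Proof.
move=> zu <- eb; have [h _] := box_elliptic v zu.
have := le_trans h eb; rewrite /edge_bound ler_pM2l ?lam_gt0 //.
by rewrite ler_pXn2r // ?nnegrE // divr_ge0 // ltW.
Qed.

Lemma geodesic_stays e gamma : (forall s, unit_itv s -> geodesic_at g e gamma s) ->
  e <= edge_bound -> in_box b r (gamma 0) ->
  (forall s, unit_itv s -> in_box b (2 * r) (gamma s)) /\
  box_solution unit_itv (coord i \o gamma) (derive1 (coord i \o gamma)).
Proof.
move=> gg eb g0; set c := coord i \o gamma; set v := derive1 c.
have sub : cbox z (2 * r) `<=` cbox z (20 * r) by apply: sub_cbox; have := r0; lra.
have loc s : unit_itv s -> in_box b (2 * r) (gamma s) ->
    [/\ vderive c s (v s), vderive v s (F (c s) (v s)) & `|v s| <= r / 4].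
  move=> s01 [di /ltW/sub zc]; have [_ _ cd vd E] := nbhs_singleton (geodesic_at_chart (gg s s01) di).
  by split=> //; exact: slow_velocity E eb.
have stay : forall s : R, 0 <= s <= 1 -> in_box b (2 * r) (gamma s).
  apply: (@real_induction R (fun s => in_box b (2 * r) (gamma s))) => //.
  - by apply: in_cbox_box (in_box_cbox g0); have := r0; lra.
  - move=> t /andP[t0 t1] H; have t01 : unit_itv t by rewrite /unit_itv /= t0 ltW.
    have : nbhs t (gamma @^-1` in_box b (2 * r)).
      apply: (geodesic_at_continuous (gg t t01)); apply: open_nbhs_nbhs; split; first exact: in_box_open.
      by apply: H; rewrite t0 lexx.
    move=> /nbhs_ballP[d /= d0 dP]; exists d => // s /andP[ts sd]; apply: dP.
    by rewrite /ball /= ltr0_norm ?subr_lt0 //; lra.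
  move=> t /andP[t0 t1] H; have t01 : unit_itv t by rewrite /unit_itv /= t1 ltW.
  suff : in_cbox b (5 / 4 * r) (gamma t) by apply: in_cbox_box; have := r0; lra.
  apply: (@closed_left_limit R M gamma (in_cbox b (5 / 4 * r)) 0) => //.
  - by apply: in_cbox_closed; have := r0; lra.
  - exact: geodesic_at_continuous (gg t t01).
  move=> s /andP[s0 st]; have [di _] := H s (introT andP (conj s0 st)); split=> //.
  have [_ zc0] := g0.
  have -> : 5 / 4 * r = r + r / 4 by field.
  apply: cbox_trans (ltW zc0) _; rewrite /cbox /=.
  have sub2 x : 0 <= x <= s -> unit_itv x /\ in_box b (2 * r) (gamma x).
    move=> /andP[x0 xs]; have xt : x < t by exact: le_lt_trans st.
    by split; [rewrite /unit_itv /= x0 (le_trans (ltW xt))|apply: H; rewrite x0].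
  have r40 : 0 <= r / 4 by rewrite divr_ge0 // ltW.
  have := @vderive_bound _ _ c v 0 s (r / 4) 0 s.
  rewrite lexx s0 subr0 => H2; apply: le_trans (H2 _ r40 _ isT _) _ => [x /sub2[? ?]|x /sub2[? ?]| |].
  - by have [] := loc x _ _.
  - by have [] := loc x _ _.
  - by rewrite lexx.
  - by rewrite ger0_norm // ler_piMr // (le_trans (ltW st)).
split=> //; split=> s s01; first by have [] := loc s s01 (stay s s01).
have [_ _ vB] := loc s s01 (stay s s01).
have [_ /ltW/sub zc] := stay s s01; split=> //; rewrite /cbox /= subr0 (le_trans vB) //.
by have := r0; lra.
Qed.

Lemma geodesic_at_rev e gamma s : geodesic_at g e gamma (1 - s) ->
  geodesic_at g e (fun t => gamma (1 - t)) s.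
Proof.
have E t : 1 - t = -1 * t + 1 :> R by ring.
have -> : (fun t => gamma (1 - t)) = (fun t => gamma (-1 * t + 1)).
  by apply/funext => t; rewrite E.
by rewrite E => /geodesic_at_affine; rewrite expr2 mulrNN !mul1r.
Qed.

Lemma geodesic_stays_rev e gamma : (forall s, unit_itv s -> geodesic_at g e gamma s) ->
  e <= edge_bound -> in_box b r (gamma 1) ->
  forall s, unit_itv s -> in_box b (2 * r) (gamma s).
Proof.
move=> gg eb g1 s s01; pose gamma' t := gamma (1 - t).
have [||H _] := @geodesic_stays e gamma' _ eb.
- by move=> t t01; apply: geodesic_at_rev; apply: gg; move: t01; rewrite /unit_itv /=; lra.
- by rewrite /gamma' subr0.
have := H (1 - s); rewrite /gamma' subKr; apply.
by move: s01; rewrite /unit_itv /=; lra.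
Qed.

(** A short geodesic with an end in the core solves the same boundary value problem as the edge,
    whose solution is unique. This transfers edges between boxes and makes short geodesics depend on
    their endpoints alone. *)
Lemma geodesic_edge e gamma : (forall s, unit_itv s -> geodesic_at g e gamma s) ->
  e <= edge_bound -> in_box b r (gamma 0) \/ in_box b r (gamma 1) ->
  (forall s, unit_itv s -> in_box b (2 * r) (gamma s)) /\
  let u := coord i (gamma 0) in let w := coord i (gamma 1) in
  (forall s, unit_itv s -> gamma s = param i ((edge u w).1 s)) /\ e = edge_energy u w.
Proof.
move=> gg eb g01.
have stay : forall s, unit_itv s -> in_box b (2 * r) (gamma s).
  by case: g01 => h; [have [] := geodesic_stays gg eb h|exact: geodesic_stays_rev gg eb h].
have s0 : unit_itv (0 : R) by rewrite /unit_itv /=; lra.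
have s1 : unit_itv (1 : R) by rewrite /unit_itv /=; lra.
split=> // u w; have [_ /ltW zu] := stay 0 s0; have [_ /ltW zw] := stay 1 s1.
have [c0 c1 cb] := edgeP zu zw.
pose c := coord i \o gamma; pose v := derive1 c.
have loc s : unit_itv s -> [/\ vderive c s (v s), vderive v s (F (c s) (v s)) & form (G (c s)) (v s) (v s) = e].
  by move=> s01; have [di _] := stay s s01; have [] := nbhs_singleton (geodesic_at_chart (gg s s01) di).
have sub : cbox z (2 * r) `<=` cbox z (20 * r) by apply: sub_cbox; have := r0; lra.
have cs : box_solution unit_itv c v.
  split=> s s01; first by have [] := loc s s01.
  have [_ _ E] := loc s s01; have [_ /ltW/sub zc] := stay s s01; split=> //.
  by rewrite /cbox /= subr0 (le_trans (slow_velocity zc E eb)) //; have := r0; lra.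
have uni := box_solution_unique cs (box_solution_sub unit_wide cb) (esym c0) (esym c1).
split=> [s s01|].
  by have [_ <-] := uni s s01; rewrite /c /= coordK //; have [] := stay s s01.
by have [_ _ <-] := loc 0 s0; have [-> _] := uni 0 s0.
Qed.

End Edges.

(** * Loops and their classes *)

Section LoopClasses.
Context {R : realType} {n : nat}.
Local Notation V := 'rV[R]_n.
Variables (M : closed_connected_manifold R n) (g : riemannian_metric M).
Local Notation A := (manifold_atlas M).
Local Notation dom := (@Defs.dom _ _ _ A).
Local Notation coord := (@Defs.coord _ _ _ A).
Local Notation param := (@Defs.param _ _ _ A).
Local Notation box := (good_box g).
Local Notation I := (unit_interval R).
Implicit Types (b : box) (p q : M) (f h : R -> M) (s t k : R).

Definition zone b : set M := in_box b (20 * rho b).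

Lemma zone_open b : open (zone b).
Proof. exact: in_box_open. Qed.

Lemma in_box_zone b s : s <= 20 * rho b -> in_box b s `<=` zone b.
Proof. by move=> s20 x [ix zx]; split=> //; exact: lt_le_trans s20. Qed.

(** A straight coordinate segment rather than a geodesic: it serves for homotopies and comparison
    paths. Clamping the time keeps the point between [p] and [q] for every real [t]. *)
Definition segment b p q t : M :=
  param (box_chart b) ((1 - clamp t) *: coord (box_chart b) p + clamp t *: coord (box_chart b) q).

Lemma clamp01 t : 0 <= clamp t <= 1.
Proof. by have := clamp_itv t; rewrite inE /= in_itv. Qed.

Lemma segment_in b r p q t : r <= 20 * rho b -> in_box b r p -> in_box b r q ->
  in_box b r (segment b p q t) /\
  coord (box_chart b) (segment b p q t) =
    (1 - clamp t) *: coord (box_chart b) p + clamp t *: coord (box_chart b) q.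
Proof.
move=> r20 [_ zp] [_ zq]; have zo := obox_conv (clamp01 t) zp zq.
have [[di _] cE] := param_in_cbox r20 (sub_ocbox zo).
by split=> //; split=> //; rewrite cE.
Qed.

Lemma segment_0 b p q t : dom (box_chart b) p -> t <= 0 -> segment b p q t = p.
Proof. by move=> dp t0; rewrite /segment clamp_le0 // subr0 scale1r scale0r addr0 coordK. Qed.

Lemma segment_1 b p q t : dom (box_chart b) q -> 1 <= t -> segment b p q t = q.
Proof. by move=> dp t0; rewrite /segment clamp_ge1 // subrr scale1r scale0r add0r coordK. Qed.

Lemma segment_continuous b (X : topologicalType) (p q : X -> M) (t : X -> R) :
  continuous p -> continuous q -> continuous t ->
  (forall x : X, zone b (p x)) -> (forall x : X, zone b (q x)) ->
  continuous (fun x => segment b (p x) (q x) (t x)).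
Proof.
move=> pc qc tc zp zq x; have [dp _] := zp x; have [dq _] := zq x.
have c1 : {for x, continuous (fun x => coord (box_chart b) (p x))}.
  by apply: continuous_comp; [exact: pc|exact: Defs.coord_continuous].
have c2 : {for x, continuous (fun x => coord (box_chart b) (q x))}.
  by apply: continuous_comp; [exact: qc|exact: Defs.coord_continuous].
have ct : {for x, continuous (fun x => clamp (t x))}.
  by apply: continuous_comp; [exact: tc|exact: clamp_continuous].
apply: (@continuous_comp X V M (fun x => (1 - clamp (t x)) *: coord (box_chart b) (p x) +
    clamp (t x) *: coord (box_chart b) (q x)) (param (box_chart b))).
  apply: cvgD; apply: cvgZ; [|exact: c1|exact: ct|exact: c2].
  by apply: cvgB; [exact: cvg_cst|exact: ct].
apply: param_continuous; apply: (@box_image _ _ _ _ b); apply: sub_ocbox.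
by apply: obox_conv; [exact: clamp01|have [] := zp x|have [] := zq x].
Qed.

Section Glue.
Context {X : topologicalType}.
Variables (e : nat -> X -> M) (tau : X -> R).

(** The piece [e i] is used for [tau x] between [i] and [i + 1]. There are [j + 1] pieces, and the
    first and the last one extend to all smaller and all larger values of [tau x]. *)
Fixpoint glue j x := if j is i.+1 then
  (if tau x <= i.+1%:R then glue i x else e i.+1 x) else e 0%N x.

Lemma glueE j i x : (i <= j)%N -> (i = 0)%N \/ i%:R < tau x ->
  (i = j)%N \/ tau x <= i.+1%:R -> glue j x = e i x.
Proof.
elim: j => [|j IH]; first by rewrite leqn0 => /eqP ->.
rewrite leq_eqVlt => /orP[/eqP ->|ij] h0 h1 /=.
  by case: h0 => // h0; rewrite leNgt h0.
have {}h1 : tau x <= i.+1%:R by case: h1 => // h1; rewrite h1 ltnn in ij.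
rewrite ifT; first by apply: IH => //; right.
by rewrite (le_trans h1) // ler_nat.
Qed.

Hypothesis tauc : continuous tau.

Lemma glue_continuous j : (forall i, (i <= j)%N -> continuous (e i)) ->
  (forall i x, (i < j)%N -> tau x = i.+1%:R -> e i x = e i.+1 x) -> continuous (glue j).
Proof.
elim: j => [|j IH] ec ej; first exact: ec.
apply: cont_glue => //.
- by apply: IH => [i ij|i x ij]; [apply: ec; exact: leqW|apply: ej; exact: leqW].
- exact: ec.
- move=> x xj; rewrite -ej // -/(glue j x) (@glueE _ j) //; last by left.
  by case: (j) xj => [|i] ->; [left|right; rewrite ltr_nat].
Qed.

Lemma glue_closedE j i x : (forall i x, (i < j)%N -> tau x = i.+1%:R -> e i x = e i.+1 x) ->
  (i <= j)%N -> i%:R <= tau x <= i.+1%:R -> glue j x = e i x.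
Proof.
move=> ej ij /andP[]; rewrite le_eqVlt => /orP[/eqP tx _|h1 h2]; last by apply: glueE => //; right.
case: i ij tx => [|i] ij tx; first by apply: glueE => //; [left|right; rewrite -tx; exact: ler01].
rewrite -ej // ?tx //; apply: glueE; [exact: ltnW| |by right; rewrite tx].
by right; rewrite -tx ltr_nat.
Qed.

End Glue.

Lemma convex_nbhd b p (O : set M) : zone b p -> nbhs p O ->
  exists W, [/\ nbhs p W, W `<=` zone b & forall q q' s, W q -> W q' -> O (segment b q q' s)].
Proof.
move=> [dp zp] nO; set c := coord (box_chart b) p.
have ic : chart_image (box_chart b) c by exists p.
have : nbhs c (param (box_chart b) @^-1` O).
  by apply: (param_continuous ic); rewrite /c coordK.
move=> /nbhs_oboxP[d d0 dO]; exists (zone b `&` [set q | obox c d (coord (box_chart b) q)]).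
split=> [|q []//|q q' s [_ zq] [_ zq']]; last first.
  by apply: dO; apply: obox_conv => //; exact: clamp01.
apply: filterI; first by apply: open_nbhs_nbhs; split; [exact: zone_open|].
apply: (Defs.coord_continuous dp); exact: nbhs_obox.
Qed.

Definition broken (al : nat -> box) (P : nat -> M) j : R -> M :=
  glue (fun i t => segment (al i) (P i) (P i.+1) (t - i%:R)) id j.

Definition in_zones (al : nat -> box) (P : nat -> M) j :=
  forall i, (i <= j)%N -> zone (al i) (P i) /\ zone (al i) (P i.+1).

Lemma broken_match al P j i t : in_zones al P j -> (i < j)%N -> t = i.+1%:R ->
  segment (al i) (P i) (P i.+1) (t - i%:R) = segment (al i.+1) (P i.+1) (P i.+2) (t - i.+1%:R).
Proof.
move=> zP ij ->; have [_ [d1 _]] := zP i (ltnW ij); have [[d2 _] _] := zP i.+1 ij.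
by rewrite segment_1 ?segment_0 ?subrr // -natrB // subSnn.
Qed.

Lemma brokenE al P j i t : in_zones al P j -> (i <= j)%N -> i%:R <= t <= i.+1%:R ->
  broken al P j t = segment (al i) (P i) (P i.+1) (t - i%:R).
Proof.
move=> zP ij it; apply: glue_closedE => // i' t' ij' tE.
exact: broken_match zP ij' tE.
Qed.

Lemma broken_vertex al P j i : in_zones al P j -> (i <= j.+1)%N -> broken al P j i%:R = P i.
Proof.
move=> zP; rewrite leq_eqVlt => /orP[/eqP ->|]; last rewrite ltnS => ij.
  rewrite (brokenE (i := j)) // ?lexx ?ler_nat ?leqnSn // segment_1 //; first by have [_ []] := zP j (leqnn j).
  by rewrite -natrB // subSnn.
rewrite (brokenE (i := i)) // ?lexx ?ler_nat ?leqnSn // segment_0 ?subrr //.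
by have [[]] := zP i ij.
Qed.

Lemma broken_ext al al' P P' j : (forall i, (i <= j)%N -> al i = al' i) ->
  (forall i, (i <= j.+1)%N -> P i = P' i) -> broken al P j = broken al' P' j.
Proof.
move=> alE PE; apply/funext => t; rewrite /broken.
have : forall i, (i <= j)%N -> segment (al i) (P i) (P i.+1) (t - i%:R) =
   segment (al' i) (P' i) (P' i.+1) (t - i%:R).
  by move=> i ij; rewrite alE // !PE // leqW.
elim: (j) => [|i IH] H /=; first exact: H.
by rewrite H // IH // => i' ?; apply: H; exact: leqW.
Qed.

Lemma broken_family_continuous (X : topologicalType) al (P : X -> nat -> M) (tau : X -> R) j :
  continuous tau -> (forall i, (i <= j.+1)%N -> continuous (fun u => P u i)) ->
  (forall u, in_zones al (P u) j) -> continuous (fun u => broken al (P u) j (tau u)).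
Proof.
move=> tc Pc zP.
have -> : (fun u => broken al (P u) j (tau u)) =
    glue (fun i u => segment (al i) (P u i) (P u i.+1) (tau u - i%:R)) tau j.
  apply/funext => u; rewrite /broken; elim: (j) => //= i IH.
  by case: ifP => // _; exact: IH.
apply: glue_continuous => // [i ij|i u ij tE]; last exact: broken_match (zP u) ij tE.
apply: segment_continuous => [||u|u|u]; [exact: (Pc i (leqW ij))|exact: (Pc i.+1 ij)| | |].
- by apply: cvgB; [exact: tc|exact: cvg_cst].
- exact: (zP u i ij).1.
- exact: (zP u i ij).2.
Qed.

Lemma broken_continuous al P j : in_zones al P j -> continuous (broken al P j).
Proof.
move=> zP; apply: (@broken_family_continuous R al (fun=> P) id j) => // [t|i _ t].
  exact: cvg_id.
exact: cvg_cst.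
Qed.

Lemma unit_cell j t : 0 <= t <= j.+1%:R -> exists2 i, (i <= j)%N & i%:R <= t <= i.+1%:R.
Proof.
elim: j => [|j IH] /andP[t0 tj]; first by exists 0%N => //; rewrite t0.
have [tj'|tj'] := leP t j.+1%:R; last by exists j.+1; rewrite // ltW.
by have [|i ij ti] := IH; [rewrite t0|exists i => //; exact: leqW].
Qed.

(** * Homotopy classes of loops and of broken paths *)

Section BasePoint.
Variable x0 : M.
Local Notation loop := {path I from x0 to x0 in M}.
Local Notation pi1 := (fundamental_group R x0).
Local Notation cls := (\pi_pi1)%qT.

(* Loops are parametrized by [[0, k]], outside of which the values of [f] are irrelevant. *)
Definition represents f k (a : pi1) :=
  exists2 p : loop, cls p = a & forall t, 0 <= t <= 1 -> p (to_I t) = f (k * t).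

Lemma loop_exists f k : continuous f -> f 0 = x0 -> f k = x0 ->
  exists p : loop, forall t, 0 <= t <= 1 -> p (to_I t) = f (k * t).
Proof.
move=> fc f0 fk; pose u (t : I) := f (k * of_I t).
have uc : continuous u by apply: cont_comp; cont.
have u0 : u zero = x0 by rewrite /u zeroI to_IK clamp_le0 // mulr0.
have u1 : u one = x0 by rewrite /u oneI to_IK clamp_ge1 // mulr1.
exists (mk_path uc u0 u1) => t t01.
by rewrite -[LHS]/(u (to_I t)) /u to_IK clamp_id.
Qed.

Lemma represents_endpoints f k a : represents f k a -> f 0 = x0 /\ f k = x0.
Proof.
move=> [p _ pf]; split.
  by rewrite -(mulr0 k) -pf ?lexx ?ler01 // path_le0.
by rewrite -{1}(mulr1 k) -pf ?lexx ?ler01 // path_ge1.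
Qed.

Lemma represents_ext f h k a : 0 <= k -> (forall t, 0 <= t <= k -> f t = h t) ->
  represents f k a -> represents h k a.
Proof.
move=> k0 fh [p pa pf]; exists p => // t t01; rewrite pf // fh //.
by case/andP: t01 => t0 t1; rewrite mulr_ge0 // ler_piMr.
Qed.

Lemma represents_homotopy f h k a (K : R * R -> M) : 0 <= k -> continuous h -> represents f k a ->
  continuous K -> (forall t, 0 <= t <= k -> K (0, t) = f t) -> (forall t, 0 <= t <= k -> K (1, t) = h t) ->
  (forall s, K (s, 0) = x0) -> (forall s, K (s, k) = x0) -> represents h k a.
Proof.
move=> k0 hc [p pa pf] Kc K0 K1 Kx Ky.
have [||q qh] := @loop_exists h k hc.
- by rewrite -(K1 0) ?Kx // lexx.
- by rewrite -(K1 k) ?Ky // k0 lexx.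
exists q => //; rewrite -pa; apply/pi1_eq/homotopic_sym.
have kt t : 0 <= t <= 1 -> 0 <= k * t <= k.
  by case/andP=> t0 t1; rewrite mulr_ge0 // ler_piMr.
apply: (@homotopicI _ _ _ _ _ _ (fun u => K (u.1, k * u.2))) => [|t t01|t t01|s _|s _] /=.
- apply: cont_comp => //; apply: cont_pair; first by move=> ?; exact: cvg_fst.
  by apply: cont_mul; [exact: cst_continuous|move=> ?; exact: cvg_snd].
- by rewrite K0 ?kt // pf.
- by rewrite K1 ?kt // qh.
- by rewrite mulr0.
- by rewrite mulr1.
Qed.

Lemma represents_unique f k a c : represents f k a -> represents f k c -> a = c.
Proof.
move=> [p <- pf] [q <- qf]; apply/pi1_eq.
apply: (@homotopic_reparam _ _ _ _ _ _ (fun t => p (to_I t)) id id) => //.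
- exact: path_ext_continuous.
- by cont.
- by cont.
- by move=> t t01; rewrite qf // pf.
Qed.

Lemma represents_scale f k m a : m != 0 -> represents f k a ->
  represents (fun t => f (t / m)) (k * m) a.
Proof.
move=> m0 [p pa pf]; exists p => // t t01.
by rewrite pf // mulrAC mulfK.
Qed.

Lemma represents_cst k a : represents (fun=> x0) k a -> a = 1%g.
Proof.
have : represents (fun=> x0) k 1%g by exists (path_cst x0).
by move=> h1 h2; exact: represents_unique h2 h1.
Qed.

Lemma represents_mul f h k k' a c : 0 < k -> 0 < k' -> continuous f -> continuous h ->
  represents f k a -> represents h k' c ->
  represents (fun t => if t <= k then f t else h (t - k)) (k + k') (pi1_mul a c).
Proof.
move=> k0 k0' fc hc fa hc'; have [f0 fk] := represents_endpoints fa; have [h0 hk] := represents_endpoints hc'.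
move: fa hc' => [p <- pf] [q <- qh].
pose F (t : R) := if t <= k then f t else h (t - k).
have Fc : continuous F.
  apply: cont_glue; [by cont|by []|by apply: cont_comp; cont|].
  by move=> t ->; rewrite subrr h0.
have [||w wF] := @loop_exists F (k + k') Fc; rewrite /F.
- by rewrite ifT // ltW.
- by rewrite ifF; [rewrite addrAC subrr add0r|lra].
exists w => //; rewrite pi1_mulE; apply/pi1_eq/homotopic_sym.
(* [path_cat] spends half of its time on each loop, whereas [F] run over [[0, k + k']] changes over
   at the fraction [k / (k + k')]; the homotopy interpolates the two time changes. *)
apply: (@homotopic_reparam _ _ _ _ _ _ F (fun t => Num.min (2 * k * t) k + Num.max 0 (2 * k' * t - k'))
   (fun t => (k + k') * t)) => //.
- by apply: cont_add; [apply: cont_min|apply: cont_max]; cont.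
- by cont.
- by rewrite !mulr0 min_l ?max_l //; lra.
- by rewrite !mulr1 min_r ?max_r; lra.
move=> t /andP[t0 t1]; rewrite path_catE; have [th|th] := leP t 2^-1.
  have h1 : 2 * k * t <= k by have := ler_wpM2l (ltW k0) th; lra.
  have h2 : 2 * k' * t - k' <= 0 by have := ler_wpM2l (ltW k0') th; lra.
  rewrite min_l // max_l // addr0 /F h1 pf; last by lra.
  by congr f; ring.
have h1 : k <= 2 * k * t by have : k * 2^-1 <= k * t; [rewrite ler_pM2l // ltW|lra].
have h2 : 0 < 2 * k' * t - k' by have : k' * 2^-1 < k' * t; [rewrite ltr_pM2l|lra].
rewrite min_r // max_r; last exact: ltW.
rewrite /F ifF ?qh; [|lra|lra].
by congr h; ring.
Qed.

(** In each cell the two loops are joined by coordinate segments of the common zone. Agreement at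
    the integers makes these homotopies fit together although neighbouring cells use different
    coordinates. *)
Lemma represents_cells f h a (al : nat -> box) j : continuous f -> continuous h ->
  (forall i t, (i <= j)%N -> i%:R <= t <= i.+1%:R -> zone (al i) (f t) /\ zone (al i) (h t)) ->
  (forall i, (i <= j.+1)%N -> f i%:R = h i%:R) ->
  represents f j.+1%:R a -> represents h j.+1%:R a.
Proof.
move=> fc hc zfh fh fa; have [f0 fk] := represents_endpoints fa.
pose m (i : nat) (t : R) : R := Num.max i%:R (Num.min i.+1%:R t).
have i1 (i : nat) : (i%:R : R) <= i.+1%:R by rewrite ler_nat leqnSn.
have mc i : continuous (m i) by apply: cont_max; [exact: cst_continuous|apply: cont_min; cont].
have mr i t : i%:R <= m i t <= i.+1%:R by rewrite /m le_max lexx /= ge_max i1 ge_min lexx.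
have mE i t : i%:R <= t <= i.+1%:R -> m i t = t by move=> /andP[a1 a2]; rewrite /m min_r // max_r.
pose e i (u : R * R) := segment (al i) (f (m i u.2)) (h (m i u.2)) u.1.
have fix_ i s : (i <= j)%N -> f (m i s) = h (m i s) -> forall t, e i (t, s) = f (m i s).
  move=> ij E t; rewrite /e /= -E; have [[df _] _] := zfh _ _ ij (mr i s).
  by rewrite /segment -scalerDl subrK scale1r coordK.
have em i (u : R * R) : (i < j)%N -> u.2 = i.+1%:R -> e i u = e i.+1 u.
  case: u => t s ij /= ->; have a1 : m i i.+1%:R = i.+1%:R by rewrite mE // lexx i1.
  have a2 : m i.+1 i.+1%:R = i.+1%:R by rewrite mE // lexx i1.
  by rewrite !fix_ ?a1 ?a2 ?fh // ltnW.
have KE i (u : R * R) : (i <= j)%N -> i%:R <= u.2 <= i.+1%:R -> glue e snd j u = e i u.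
  move=> ij ui; exact: glue_closedE.
have Kc : continuous (glue e snd j).
  apply: glue_continuous => // [u|i ij]; first exact: cvg_snd.
  apply: segment_continuous => [||u|u|u].
  - by apply: cont_comp => //; apply: cont_comp => //; move=> ?; exact: cvg_snd.
  - by apply: cont_comp => //; apply: cont_comp => //; move=> ?; exact: cvg_snd.
  - exact: cvg_fst.
  - exact: (zfh _ _ ij (mr i u.2)).1.
  - exact: (zfh _ _ ij (mr i u.2)).2.
apply: (represents_homotopy _ hc fa Kc) => [|t tj|t tj|s|s]; first exact: ler0n.
- have [i ij ti] := unit_cell tj; rewrite (KE i) // /e /= mE // segment_0 //.
  by have [[]] := zfh _ _ ij ti.
- have [i ij ti] := unit_cell tj; rewrite (KE i) // /e /= mE // segment_1 //.
  by have [_ []] := zfh _ _ ij ti.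
- have m0 : m 0%N 0 = 0 by rewrite mE // lexx ler01.
  by rewrite (KE 0%N) ?lexx ?ler01 // fix_ ?m0 // (fh 0%N).
- have mj : m j j.+1%:R = j.+1%:R by rewrite mE // lexx i1.
  by rewrite (KE j) ?lexx ?i1 // fix_ ?mj // fh.
Qed.

Lemma represents_broken f a (al : nat -> box) (P : nat -> M) j : continuous f ->
  (forall i t, (i <= j)%N -> i%:R <= t <= i.+1%:R -> zone (al i) (f t)) ->
  (forall i, (i <= j.+1)%N -> f i%:R = P i) ->
  represents f j.+1%:R a <-> represents (broken al P j) j.+1%:R a.
Proof.
move=> fc zf fP.
have i1 (i : nat) : (i%:R : R) <= i.+1%:R by rewrite ler_nat leqnSn.
have zP : in_zones al P j.
  by move=> i ij; rewrite -!fP // ?leqW //; split; apply: zf; rewrite // ?lexx ?i1.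
have zb i t : (i <= j)%N -> i%:R <= t <= i.+1%:R -> zone (al i) (broken al P j t).
  move=> ij ti; rewrite (brokenE zP ij ti); have [z1 z2] := zP i ij.
  by have [] := segment_in (t - i%:R) (lexx _) z1 z2.
have bc := broken_continuous zP.
have E i : (i <= j.+1)%N -> f i%:R = broken al P j i%:R by move=> ij; rewrite broken_vertex // fP.
split; apply: (@represents_cells _ _ _ al) => // i.
- by move=> t ij ti; split; [exact: zf|exact: zb].
- by move=> t ij ti; split; [exact: zb|exact: zf].
- by move=> ij; rewrite E.
Qed.

(** The vertex [i] moves along a segment of its own box [be i]; during the motion both ends of each
    edge must stay in the zone of that edge, so that the moving paths form a homotopy. *)
Lemma broken_move (al be : nat -> box) (P Q : nat -> M) j a : in_zones al P j ->
  (forall i, (i <= j.+1)%N -> zone (be i) (P i) /\ zone (be i) (Q i)) ->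
  (forall i s, (i <= j)%N -> zone (al i) (segment (be i) (P i) (Q i) s) /\
     zone (al i) (segment (be i.+1) (P i.+1) (Q i.+1) s)) ->
  P 0%N = Q 0%N -> P j.+1 = Q j.+1 ->
  represents (broken al P j) j.+1%:R a -> represents (broken al Q j) j.+1%:R a.
Proof.
move=> zP zbe zs PQ0 PQj fa.
pose S s i := if (i <= j.+1)%N then segment (be i) (P i) (Q i) s else P i.
have zS s : in_zones al (S s) j.
  by move=> i ij; rewrite /S !ifT // ?leqW //; exact: zs.
have S0 i : (i <= j.+1)%N -> S 0 i = P i.
  by move=> ij; rewrite /S ij segment_0 //; have [[]] := zbe i ij.
have S1 i : (i <= j.+1)%N -> S 1 i = Q i.
  by move=> ij; rewrite /S ij segment_1 //; have [_ []] := zbe i ij.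
have zQ : in_zones al Q j.
  by move=> i ij; rewrite -!S1 // ?leqW //; exact: zS.
have [b0 bk] := represents_endpoints fa.
have Kc : continuous (fun u : R * R => broken al (S u.1) j u.2).
  apply: (@broken_family_continuous (R * R)%type al (fun u => S u.1) snd j) => [u|i ij|u //]; first exact: cvg_snd.
  rewrite /S ij; have [zp zq] := zbe i ij; apply: segment_continuous => // u; first exact: cvg_cst.
    exact: cvg_cst.
  exact: cvg_fst.
have Sfix s i : (i <= j.+1)%N -> P i = Q i -> S s i = P i.
  move=> ij E; have [[dp _] _] := zbe i ij.
  by rewrite /S ij -E /segment -scalerDl subrK scale1r coordK.
apply: (represents_homotopy _ (broken_continuous zQ) fa Kc) => [|t _|t _|s|s] /=; first exact: ler0n.
- by rewrite (@broken_ext al al _ P).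
- by rewrite (@broken_ext al al _ Q).
- by rewrite -[0]/(0%:R : R) broken_vertex // Sfix // -(broken_vertex (i := 0) zP).
- by rewrite broken_vertex // Sfix // -(broken_vertex (i := j.+1) zP).
Qed.

(** With fixed ends, the class of a broken path is locally constant in its vertices. This preserves
    the homotopy class both when limits of chains are taken and when one vertex is varied. *)
Lemma broken_locally_constant (al : nat -> box) (P : nat -> M) j : in_zones al P j ->
  exists W : nat -> set M, (forall i, (i <= j.+1)%N -> nbhs (P i) (W i)) /\
    forall Q Q' a, (forall i, (i <= j.+1)%N -> W i (Q i)) -> (forall i, (i <= j.+1)%N -> W i (Q' i)) ->
    Q 0%N = Q' 0%N -> Q j.+1 = Q' j.+1 ->
    represents (broken al Q j) j.+1%:R a -> represents (broken al Q' j) j.+1%:R a.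
Proof.
(* The vertex [i] lies on the edges [i - 1] and [i], with boxes [al i.-1] and [be i]; truncation at
   both ends makes the first and the last vertex use their only edge. *)
move=> zP; pose be i := al (minn i j).
have zbe i : (i <= j.+1)%N -> zone (be i) (P i).
  rewrite /be; case: (leqP i j) => [ij _|ji ij]; first exact: (zP i ij).1.
  have -> : i = j.+1 by apply/eqP; rewrite eqn_leq ij ji.
  exact: (zP j (leqnn j)).2.
have zbe' i : (i <= j.+1)%N -> zone (al i.-1) (P i).
  case: i => [|i] ij; [exact: (zP 0%N (leq0n j)).1|exact: (zP i ij).2].
pose O i := zone (be i) `&` zone (al i.-1).
have H i : exists W, (i <= j.+1)%N -> [/\ nbhs (P i) W, W `<=` zone (be i) &
    forall q q' s, W q -> W q' -> O i (segment (be i) q q' s)].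
  have [ij|ij] := boolP (i <= j.+1)%N; last by exists setT.
  have nO : nbhs (P i) (O i).
    by apply: filterI; apply: open_nbhs_nbhs; split; [exact: zone_open|exact: zbe|exact: zone_open|exact: zbe'].
  by have [W WP] := convex_nbhd (zbe i ij) nO; exists W.
have {H}[W WP] := fun_choice H; exists W; split=> [i ij|Q Q' a WQ WQ' QQ0 QQj]; first by have [] := WP i ij.
have seg i s : (i <= j)%N -> zone (al i) (segment (be i) (Q i) (Q' i) s) /\
     zone (al i) (segment (be i.+1) (Q i.+1) (Q' i.+1) s).
  move=> ij; have [_ _ /(_ _ _ s (WQ i (leqW ij)) (WQ' i (leqW ij)))[z1 _]] := WP i (leqW ij).
  have [_ _ /(_ _ _ s (WQ i.+1 ij) (WQ' i.+1 ij))[_ z2]] := WP i.+1 ij.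
  by split=> //; move: z1; rewrite /be (minn_idPl ij).
apply: (@broken_move al be) => //.
  move=> i ij; have [z1 z2] := seg i 0 ij; have W1 := WQ i (leqW ij); have W2 := WQ i.+1 ij.
  have [_ s1 _] := WP i (leqW ij); have [_ s2 _] := WP i.+1 ij.
  move: z1 z2; rewrite !segment_0 //; first by have [] := s2 _ W2.
  by have [] := s1 _ W1.
by move=> i ij; have [_ s1 _] := WP i ij; split; apply: s1; [exact: WQ|exact: WQ'].
Qed.

End BasePoint.
End LoopClasses.

(** * Chains of boxes *)

Section FiniteBounds.
Context {R : realType} {m : nat}.

Lemma finite_upper_bound (F : 'I_m -> R) : exists2 C, 0 <= C & forall i, F i <= C.
Proof.
exists (\sum_i `|F i|); first exact: sumr_ge0.
move=> i; rewrite (bigD1 i) //= (le_trans (ler_norm _)) // lerDl; exact: sumr_ge0.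
Qed.

Lemma finite_lower_bound (F : 'I_m -> R) : (forall i, 0 < F i) -> exists2 C, 0 < C & forall i, C <= F i.
Proof.
move=> F0; have [C C0 CF] := finite_upper_bound (fun i => (F i)^-1).
exists (C + 1)^-1 => [|i]; first by rewrite invr_gt0; lra.
rewrite -[F i]invrK lef_pV2 ?posrE ?invr_gt0 //; first by have := CF i; lra.
by lra.
Qed.

End FiniteBounds.

Section Chains.
Context {R : realType} {n : nat}.
Local Notation V := 'rV[R]_n.
Variables (M : closed_connected_manifold R n) (g : riemannian_metric M).
Local Notation A := (manifold_atlas M).
Local Notation dom := (@Defs.dom _ _ _ A).
Local Notation coord := (@Defs.coord _ _ _ A).
Local Notation param := (@Defs.param _ _ _ A).
Local Notation box := (good_box g).

Lemma finite_box_cover (x0 : M) : exists m (bx : 'I_m.+1 -> box),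
  forall x, exists i, in_box (bx i) (rho (bx i)) x.
Proof.
have [B BP] := fun_choice (@good_box_exists R n M g).
(* The filter of finite lists under inclusion turns compactness, in its near-covering form, into a
   finite subcover. The family below has one index more than the list, the default of [nth], so it
   is nonempty even for an empty list. *)
pose F : set_system (seq M) := filter_from setT (fun D0 : seq M => [set D : seq M | {subset D0 <= D}]).
have FF : Filter F.
  apply: filter_from_filter; first by exists [::].
  move=> D1 D2 _ _; exists (D1 ++ D2) => // D DP; split=> x xD; apply: DP; rewrite mem_cat xD ?orbT //.
pose Q (D : seq M) x := exists2 y, y \in D & in_box (B y) (rho (B y)) x.
have /compact_near_coveringP cM := @manifold_compact R n M.
have [|D _ DP] := cM _ F Q FF.
  move=> x _; have [dx cx] := BP x.
  exists (in_box (B x) (rho (B x)), [set D : seq M | {subset [:: x] <= D}]) => /=.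
    split; last by exists [:: x].
    apply: open_nbhs_nbhs; split; first exact: in_box_open.
    by split=> //; rewrite /obox /= cx subrr normr0 box_rho_gt0.
  by case=> y D [/= yx xD]; exists x => //; apply: xD; rewrite inE.
exists (size D), (fun i => B (nth x0 D i)) => x.
have [|y yD xy] := DP D _ x I; first by [].
have iD : (index y D < (size D).+1)%N by rewrite ltnS index_size.
by exists (Ordinal iD) => /=; rewrite nth_index.
Qed.

Section FixedCover.
Variables (m : nat) (bx : 'I_m.+1 -> box).
Hypothesis bx_cover : forall x, exists i, in_box (bx i) (rho (bx i)) x.
Variable x0 : M.
Local Notation pi1 := (fundamental_group R x0).
Implicit Types (a c : pi1) (al : nat -> 'I_m.+1) (P : nat -> M) (t : R).

(* Every cell of a loop [f] with [K] unit cells lies in the core of some box; the least such [K] is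
   subadditive in [a], hence at most linear in the word length. *)
Definition coarse a (K : nat) := exists f, [/\ continuous f, represents f K%:R a &
  forall j, (j < K)%N -> exists i, forall t : R, j%:R <= t <= j.+1%:R -> in_box (bx i) (rho (bx i)) (f t)].

Lemma coarse_mul a c K K' : (0 < K)%N -> (0 < K')%N -> coarse a K -> coarse c K' -> coarse (a * c)%g (K + K').
Proof.
move=> K0 K0' [f [fc fa fb]] [h [hc ha hb]].
have [f0 fK] := represents_endpoints fa; have [h0 hK] := represents_endpoints ha.
exists (fun t : R => if t <= K%:R then f t else h (t - K%:R)); split.
- apply: cont_glue; [by cont|by []|by apply: cont_comp; cont|].
  by move=> t ->; rewrite subrr h0.
- by rewrite natrD; apply: represents_mul => //; rewrite ltr0n.
move=> j jK; have [jK'|Kj] := ltnP j K.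
  have [i iP] := fb j jK'; exists i => t /andP[t0 t1].
  have tK : t <= K%:R by apply: (le_trans t1); rewrite ler_nat.
  by rewrite tK; apply: iP; rewrite t0 t1.
have [|i iP] := hb (j - K)%N; first by rewrite ltn_subLR.
exists i => t /andP[t0 t1].
have E : (if t <= K%:R then f t else h (t - K%:R)) = h (t - K%:R).
  case: ifP => // tK; have -> : t = K%:R.
    by apply/eqP; rewrite eq_le tK /= (le_trans _ t0) // ler_nat.
  by rewrite subrr h0.
rewrite E; apply: iP; rewrite -subSn // !natrB ?(leq_trans Kj) //.
by rewrite !lerD2r t0.
Qed.

(** A Lebesgue number argument. All large numbers of cells are allowed, so that finitely many
    generators can share one. *)
Lemma coarse_exists a : exists K0, forall K, (K0 <= K)%N -> coarse a K.+1.
Proof.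
pose p := repr a; pose f (t : R) := p (to_I t).
have fc : continuous f by exact: path_ext_continuous.
have fa : represents f 1 a.
  by exists p; [exact: reprK|move=> t _; rewrite mul1r].
pose Q (N : nat) (x : R) := exists i, forall t : R, `|t - x| <= N.+1%:R^-1 -> in_box (bx i) (rho (bx i)) (f t).
have /compact_near_coveringP cK : compact `[0 : R, 1]%classic by exact: segment_compact.
have [|N _ NP] := cK nat \oo Q _.
  move=> x _; have [i ix] := bx_cover (f x).
  have : nbhs x (f @^-1` in_box (bx i) (rho (bx i))).
    by apply: fc; apply: open_nbhs_nbhs; split=> //; exact: in_box_open.
  move=> /nbhs_ballP[e /= e0 eP]; exists (ball x (e / 2), [set N | N.+1%:R^-1 < e / 2]) => /=.
    split; first by apply: nbhsx_ballx; rewrite divr_gt0.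
    by apply: near_infty_natSinv_lt (PosNum (divr_gt0 e0 (ltr0n _ 2))).
  case=> y N [/= xy Ne]; exists i => t ty; apply: eP.
  rewrite -ball_normE /= in xy *; rewrite distrC -(subrKA y) (le_lt_trans (ler_normD _ _)) //.
  by rewrite [e]splitr ler_ltD ?(le_trans ty) ?(ltW Ne) // distrC.
exists N => K NK; exists (fun t : R => f (t / K.+1%:R)); have K0 : K.+1%:R != 0 :> R by rewrite pnatr_eq0.
split.
- by apply: cont_comp => // t; apply: cvgM; [exact: cvg_id|exact: cvg_cst].
- by have := represents_scale K0 fa; rewrite mul1r.
move=> j jK; have [|i iP] := NP K NK (j%:R / K.+1%:R).
  by rewrite /= in_itv /= divr_ge0 // ler_pdivrMr ?ltr0n // mul1r ler_nat ltnW.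
exists i => t /andP[t0 t1]; apply: iP.
rewrite -mulrBl ger0_norm ?mulr_ge0 ?invr_ge0 ?subr_ge0 //.
by rewrite ler_piMl ?invr_ge0 // lerBlDl natr1.
Qed.

Definition vertex_coord al P i k := coord (box_chart (bx (al i))) (P k).

(** Here [j] is the last edge, so there are [j + 1] edges. The boxes are closed for compactness, and
    of twice the size of the core to leave room for moving a vertex that lies in a core. *)
Definition chain a al P j := [/\ P 0%N = x0, P j.+1 = x0,
  forall i, (i <= j)%N -> in_cbox (bx (al i)) (2 * rho (bx (al i))) (P i) /\
    in_cbox (bx (al i)) (2 * rho (bx (al i))) (P i.+1) &
  represents (broken (fun i => bx (al i)) P j) j.+1%:R a].

Definition step_energy al P i :=
  edge_energy (bx (al i)) (vertex_coord al P i i) (vertex_coord al P i i.+1).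

Definition chain_energy al P j := \sum_(i < j.+1) step_energy al P i.

Lemma in_cbox_zone (b : box) : in_cbox b (2 * rho b) `<=` zone b.
Proof. by apply: in_cbox_box; have := box_rho_gt0 b; lra. Qed.

Lemma chain_exists : exists2 C, 0 <= C & forall a K N, coarse a K.+1 ->
  exists al P, chain a al P (K.+1 * N.+1).-1 /\
    forall i, (i < K.+1 * N.+1)%N -> step_energy al P i <= C / N.+1%:R ^+ 2.
Proof.
(* [edge_energy_bound] contributes [100 * Lam], and two points of a core are at distance at most
   [2 * rho], whose square gives the factor [4]. *)
have [C C0 CP] := finite_upper_bound (fun i => 400 * (Lam (bx i) * rho (bx i) ^+ 2)).
exists C => // a K N [f [fc fa fb]].
have H (j : nat) : exists i, (j < K.+1)%N -> forall t : R, j%:R <= t <= j.+1%:R -> in_box (bx i) (rho (bx i)) (f t).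
  by have [/fb[i iP]|_] := boolP (j < K.+1)%N; [exists i|exists ord0].
have {H}[be beP] := fun_choice H.
pose al0 j := bx (be j); pose P0 (j : nat) := f j%:R.
have rz (b : box) : in_box b (rho b) `<=` zone b by apply: in_box_zone; have := box_rho_gt0 b; lra.
have zP0 : in_zones al0 P0 K.
  by move=> j jK; split; apply: rz; apply: beP; rewrite // lexx ler_nat leqnSn.
pose h := broken al0 P0 K.
have ha : represents h K.+1%:R a.
  by apply/(@represents_broken _ _ _ _ _ f) => // j t jK tj; apply: rz; exact: beP tj.
have hc : continuous h by exact: broken_continuous.
pose Nr : R := N.+1%:R; have N0 : 0 < Nr by rewrite ltr0n.
(* Each coordinate segment of the coarse broken path [h] is cut into [N + 1] equal parts, so the
   coordinate steps carry a factor [1 / Nr] and the energies its square. *)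
pose f' (t : R) := h (t / Nr); pose al i := be (i %/ N.+1)%N; pose P i := f' i%:R.
have f'c : continuous f' by apply: cont_comp => // t; apply: cvgM; [exact: cvg_id|exact: cvg_cst].
have cell (i : nat) (t : R) : (i < K.+1 * N.+1)%N -> i%:R <= t <= i.+1%:R ->
    [/\ (i %/ N.+1 <= K)%N, (i %/ N.+1)%:R <= t / Nr <= (i %/ N.+1).+1%:R &
      f' t = segment (bx (al i)) (P0 (i %/ N.+1)%N) (P0 (i %/ N.+1).+1) (t / Nr - (i %/ N.+1)%:R)].
  move=> iK /andP[t0 t1]; have iK' : (i %/ N.+1 <= K)%N by rewrite -ltnS ltn_divLR.
  have tq : (i %/ N.+1)%:R <= t / Nr <= (i %/ N.+1).+1%:R.
    rewrite ler_pdivlMr // ler_pdivrMr // -!natrM; apply/andP; split.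
      by rewrite (le_trans _ t0) // ler_nat leq_trunc_div.
    by rewrite (le_trans t1) // ler_nat ltn_ceil.
  by split=> //; rewrite /f' /h (brokenE zP0 iK' tq).
have fin (i : nat) (t : R) : (i < K.+1 * N.+1)%N -> i%:R <= t <= i.+1%:R ->
    in_box (bx (al i)) (rho (bx (al i))) (f' t) /\
    coord (box_chart (bx (al i))) (f' t) = let s := t / Nr - (i %/ N.+1)%:R in
      (1 - s) *: coord (box_chart (bx (al i))) (P0 (i %/ N.+1)%N) +
      s *: coord (box_chart (bx (al i))) (P0 (i %/ N.+1).+1).
  move=> iK ti; have [qK tq ->] := cell i t iK ti.
  have cl : clamp (t / Nr - (i %/ N.+1)%:R) = t / Nr - (i %/ N.+1)%:R.
    by apply: clamp_id; move: tq; rewrite -natr1 => /andP[]; move: (t / Nr) (_%:R : R) => u1 u2; lra.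
  have := @segment_in _ _ _ _ (bx (al i)) (rho (bx (al i))) (P0 (i %/ N.+1)%N) (P0 (i %/ N.+1).+1) (t / Nr - (i %/ N.+1)%:R).
  rewrite cl; apply; first by have := box_rho_gt0 (bx (al i)); lra.
    by apply: beP; rewrite // lexx ler_nat leqnSn.
  by apply: beP; rewrite // lexx ler_nat leqnSn.
have jE : (K.+1 * N.+1).-1.+1 = (K.+1 * N.+1)%N by rewrite prednK // muln_gt0.
have le1 (i : nat) : (i%:R : R) <= i.+1%:R by rewrite ler_nat leqnSn.
have Pin i : (i < K.+1 * N.+1)%N -> in_box (bx (al i)) (rho (bx (al i))) (P i) /\
    in_box (bx (al i)) (rho (bx (al i))) (P i.+1).
  by move=> iK; split; [have [] := fin i i%:R iK|have [] := fin i i.+1%:R iK]; rewrite ?lexx ?le1.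
have r2 (b : box) : in_box b (rho b) `<=` in_cbox b (2 * rho b).
  by move=> x /in_box_cbox; apply: sub_in_cbox; have := box_rho_gt0 b; lra.
have f'a : represents f' (K.+1 * N.+1)%:R a.
  by rewrite natrM; apply: represents_scale => //; rewrite gt_eqF.
exists al, P; split.
  have [e0 e1] := represents_endpoints f'a; split; rewrite ?jE //.
  - by move=> i; rewrite -ltnS jE => /Pin[p1 p2]; split; exact: r2.
  - rewrite -jE; apply/(@represents_broken _ _ _ _ _ f') => //.
      by move=> i t; rewrite -ltnS jE => iK ti; apply: rz; have [] := fin i t iK ti.
move=> i iK; have [p1 p2] := Pin i iK; have [_ q1] := r2 _ _ p1; have [_ q2] := r2 _ _ p2.
rewrite (le_trans (edge_energy_bound q1 q2)) //.
have [_ c1] := fin i i%:R iK (introT andP (conj (lexx _) (le1 i))).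
have [_ c2] := fin i i.+1%:R iK (introT andP (conj (le1 i) (lexx _))).
set b := bx (al i) in c1 c2 *; set q := (i %/ N.+1)%N in c1 c2 *.
set u := coord _ (P0 q) in c1 c2; set w := coord _ (P0 q.+1) in c1 c2.
have -> : vertex_coord al P i i.+1 - vertex_coord al P i i = Nr^-1 *: (w - u).
  rewrite /vertex_coord c1 c2 /= -natr1; apply/rowP => k; rewrite !mxE; by ring.
rewrite normrZ gtr0_norm ?invr_gt0 // exprMn exprVn.
have qK : (q < K.+1)%N by rewrite /q ltn_divLR.
have [_ zu] : in_box b (rho b) (P0 q) by apply: beP; rewrite // lexx le1.
have [_ zw] : in_box b (rho b) (P0 q.+1) by apply: beP; rewrite // lexx le1.
have uw : `|w - u| <= 2 * rho b.
  by have := ler_dist_via (center b) w u; move: zu zw; rewrite /obox /= -/u -/w; lra.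
have uw2 : `|w - u| ^+ 2 <= 4 * rho b ^+ 2.
  have -> : 4 * rho b ^+ 2 = (2 * rho b) ^+ 2 by ring.
  by apply: lerXn2r; rewrite ?nnegrE ?mulr_ge0 // ltW // box_rho_gt0.
rewrite mulrC -mulrA mulrC ler_wpM2r ?invr_ge0 ?exprn_ge0 ?(ltW N0) //.
have := ler_wpM2l (Lam_ge0 b) uw2; have := CP (al i); rewrite -/b; lra.
Qed.

End FixedCover.
End Chains.

(** * Cutting corners *)

Section Corners.
Context {R : realType} {n : nat}.
Local Notation V := 'rV[R]_n.
Variables (M : closed_connected_manifold R n) (g : riemannian_metric M).
Variable b : good_box g.
Local Notation i := (box_chart b).
Local Notation z := (center b).
Local Notation r := (rho b).
Local Notation G := (gram g i).
Implicit Types (u w x : V).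

Let r0 : 0 < r := box_rho_gt0 b.

Lemma edge_zone u w s : cbox z (2 * r) u -> cbox z (2 * r) w -> unit_itv s ->
  obox z (20 * r) ((edge b u w).1 s).
Proof.
move=> zu zw s01; have [c0 _ [ho h]] := edgeP zu zw.
have w01 (t : R) : 0 <= t <= 1 -> wide t by rewrite /wide /=; lra.
have := @vderive_bound _ _ (edge b u w).1 (edge b u w).2 0 1 (6 * r) 0 s.
rewrite c0 subr0 => H.
have {}H : `|(edge b u w).1 s - u| <= 6 * r * `|s|.
  apply: H => [t /w01 tw||t /w01 tw||//].
  - by have [] := ho t tw.
  - by have := r0; lra.
  - by have [_] := h t tw; rewrite /cbox /= subr0.
  - by rewrite lexx ler01.
have s1 : 6 * r * `|s| <= 6 * r.
  by rewrite ler_piMr ?ger0_norm //; move: s01; rewrite /unit_itv /=; have := r0; lra.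
have := ler_distD u ((edge b u w).1 s) z; move: zu H s1; rewrite /cbox /obox /=; have := r0; lra.
Qed.

Lemma edge_energy_eq0 u w : cbox z (2 * r) u -> cbox z (2 * r) w -> edge_energy b u w = 0 ->
  forall s, unit_itv s -> (edge b u w).1 s = u.
Proof.
move=> zu zw E0 s s01; have [c0 _ [ho h]] := edgeP zu zw.
have w01 (t : R) : 0 <= t <= 1 -> wide t by rewrite /wide /=; lra.
have v0 (t : R) : 0 <= t <= 1 -> (edge b u w).2 t = 0.
  move=> /w01 tw; have := edge_energyE zu zw tw; rewrite E0 => e0.
  have [_ pos] : positive (G ((edge b u w).1 t)).
    by apply: gram_positive; apply: (@box_image _ _ _ _ b); have [] := h t tw.
  by apply/eqP; apply: contraT => /pos; rewrite e0 ltxx.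
have := @vderive_bound _ _ (edge b u w).1 (edge b u w).2 0 1 0 0 s.
rewrite c0 mul0r normr_le0 subr_eq0 => H; apply/eqP; apply: H => [t /w01 tw|//|t /v0 ->||//].
- by have [] := ho t tw.
- by rewrite normr0.
- by rewrite lexx ler01.
Qed.

(* A corner strictly decreases the energy when it is cut, hence a minimiser has none. *)
Lemma corner_velocity u w x : cbox z (2 * r) u -> obox z (2 * r) w -> cbox z (2 * r) x ->
  (\forall w' \near w, edge_energy b u w + edge_energy b w x <= edge_energy b u w' + edge_energy b w' x) ->
  (edge b u w).2 1 = (edge b w x).2 0.
Proof.
move=> zu ow zx nE; have zw := sub_ocbox ow.
have [C C0 CP] := edge_variation b.
set v1 := (edge b u w).2 1; set v2 := (edge b w x).2 0.
pose d := v1 - v2; pose D := `|d|; have D0 : 0 <= D by rewrite normr_ge0.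
suff d0 : d = 0 by apply/eqP; rewrite -subr_eq0 -/d d0.
have [_ pos] : positive (G w).
  by apply: gram_positive; apply: (@box_image _ _ _ _ b); apply: sub_cbox zw; have := r0; lra.
apply/eqP; apply: contraT => /pos; set q := form _ _ _ => q0.
have : nbhs w (obox z (2 * r) `&` [set w' | edge_energy b u w + edge_energy b w x <=
    edge_energy b u w' + edge_energy b w' x]).
  by apply: filterI => //; apply: open_nbhs_nbhs; split; [exact: obox_open|].
move=> /nbhs_oboxP[e e0 eP].
have K1 : 0 < 2 * (D + 1) by lra.
have K2 : 0 < 2 * (C * D ^+ 2 + 1) by have : 0 <= C * D ^+ 2; [rewrite mulr_ge0 ?exprn_ge0|lra].
(* The vertex is moved by [- (t *: d)]. The first bound on [t] keeps it in the neighbourhood where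
   [w] is minimal; the second makes the gain [2 * t * q] of the first variation exceed the quadratic
   errors, at most [2 * (C * (t * D) ^+ 2)] in all. *)
pose t := Num.min (e / (2 * (D + 1))) (q / (2 * (C * D ^+ 2 + 1))).
have t0 : 0 < t by rewrite /t lt_min !divr_gt0.
have t1 : t * D < e.
  have : t <= e / (2 * (D + 1)) by rewrite /t ge_min lexx.
  rewrite ler_pdivlMr //; have : 0 < t * 1 by rewrite mulr1.
  by have : 0 <= t * D; [rewrite mulr_ge0 // ltW|lra].
have t2 : t * (C * D ^+ 2) < q.
  have : t <= q / (2 * (C * D ^+ 2 + 1)) by rewrite /t ge_min lexx orbT.
  rewrite ler_pdivlMr //; have : 0 <= t * (C * D ^+ 2) by rewrite !mulr_ge0 ?exprn_ge0 // ltW.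
  by move: t0; lra.
have nh : `|- (t *: d)| = t * D by rewrite normrN normrZ gtr0_norm.
have [|ow' Ew'] := eP (w - t *: d).
  by rewrite /obox /= addrC addKr nh.
have zw' := sub_ocbox ow'.
have := CP _ _ _ _ zu zw zu zw'; have := CP _ _ _ _ zw zx zw' zx.
have form0 A (y : V) : form A y 0 = 0 by rewrite /form trmx0 mulmx0 mxE.
have -> : w - t *: d - w = - (t *: d) by rewrite addrAC subrr sub0r.
rewrite !subrr !normr0 !form0 nh addr0 !add0r subr0 -/v1 -/v2.
have fN A (y : V) : form A y (- (t *: d)) = - (t * form A y d).
  by rewrite -scaleN1r !formZr mulN1r.
rewrite !fN => A2 A1; move: A1 A2; rewrite !ler_norml.
have qE : form (G w) v1 d - form (G w) v2 d = q by rewrite -formBl.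
set a1 := form _ v1 _ in qE *; set a2 := form _ v2 _ in qE *.
move: Ew'; rewrite /= => Ew' /andP[_ A1] /andP[_ A2].
have : 2 * t * q <= 2 * (C * (t * D) ^+ 2).
  have -> : 2 * t * q = 2 * (t * a1) - 2 * (t * a2) by rewrite -qE; ring.
  lra.
have -> : 2 * (C * (t * D) ^+ 2) = 2 * t * (t * (C * D ^+ 2)) by ring.
by rewrite ler_pM2l ?mulr_gt0 // leNgt t2.
Qed.

(** Both edges are solutions on both sides of [w], where they have the same position and velocity,
    so they coincide nearby by uniqueness in the initial value problem. *)
Lemma corner_match u w x : cbox z (2 * r) u -> cbox z (2 * r) w -> cbox z (2 * r) x ->
  (edge b u w).2 1 = (edge b w x).2 0 ->
  edge_energy b u w = edge_energy b w x /\
  exists2 e : R, 0 < e & forall s, `|s| < e -> (edge b u w).1 (s + 1) = (edge b w x).1 s.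
Proof.
move=> zu zw zx vv; have [_ c1 [ho h]] := edgeP zu zw; have [d0 _ [ho' h']] := edgeP zw zx.
have w1 : wide (1 : R) by rewrite /wide /=; lra.
split; first by rewrite -(edge_energyE zu zw w1) c1 vv.
have L0 : 0 <= (1 / 100 : R) by lra.
have ws (s : R) : `|s - 0| < 1 -> wide s /\ wide (s + 1).
  by rewrite subr0 ltr_norml /wide /=; lra.
have E1 (s : R) : 1 * s + 1 = s + 1 by rewrite mul1r.
have [||||||e e0 eP] := @ivp_local_unique _ _ _ _ _ _ _ (@box_rhs_lipschitz _ _ _ _ b)
   (fun s => (edge b u w).1 (1 * s + 1)) (fun s => (edge b u w).2 (1 * s + 1))
   (edge b w x).1 (edge b w x).2 0 1 ltr01 L0.
- move=> s /ws[_]; rewrite -E1 => sw; have [hc hv] := ho _ sw.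
  by split; rewrite -[X in vderive _ _ X]scale1r; exact: vderive_affine.
- by move=> s /ws[sw _]; exact: ho'.
- by move=> s /ws[_ sw]; rewrite E1; exact: h.
- by move=> s /ws[sw _]; exact: h'.
- by rewrite mulr0 add0r c1 d0.
- by rewrite mulr0 add0r.
by exists e => // s se; have [] := eP s; rewrite ?subr0 // mul1r.
Qed.

End Corners.

(** * Minimising chains *)

Section Minimisation.
Context {R : realType} {n : nat}.
Local Notation V := 'rV[R]_n.
Variables (M : closed_connected_manifold R n) (g : riemannian_metric M).
Local Notation A := (manifold_atlas M).
Local Notation dom := (@Defs.dom _ _ _ A).
Local Notation coord := (@Defs.coord _ _ _ A).
Local Notation param := (@Defs.param _ _ _ A).
Local Notation box := (good_box g).
Variables (m : nat) (bx : 'I_m.+1 -> box).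
Hypothesis bx_cover : forall x, exists i, in_box (bx i) (rho (bx i)) x.
Variable x0 : M.
Local Notation pi1 := (fundamental_group R x0).
Implicit Types (a c : pi1) (al : nat -> 'I_m.+1) (P : nat -> M) (t s : R).

Lemma near_forall_lt {T : Type} {F : set_system T} {FF : Filter F} (B : nat -> set T) k :
  (forall i, (i < k)%N -> F (B i)) -> F [set x | forall i, (i < k)%N -> B i x].
Proof.
elim: k => [|k IH] H; first by apply: filterE => x.
apply: (@filterS2 _ F _ _ _ _ _ (H k (ltnSn k)) (IH (fun i ik => H i (leqW ik)))) => x Bk Bx i.
by rewrite ltnS leq_eqVlt => /orP[/eqP ->//|]; exact: Bx.
Qed.

Definition link al P i := in_cbox (bx (al i)) (2 * rho (bx (al i))) (P i) /\
    in_cbox (bx (al i)) (2 * rho (bx (al i))) (P i.+1).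

Lemma chain_ext a al al' P P' j : (forall i, (i <= j)%N -> al i = al' i) ->
  (forall i, (i <= j.+1)%N -> P i = P' i) -> chain bx a al P j ->
  chain bx a al' P' j /\ chain_energy bx al' P' j = chain_energy bx al P j.
Proof.
move=> alE PE [p0 pj lk rep]; split; last first.
  apply: eq_bigr => i _; have ij : (i <= j)%N by rewrite -ltnS.
  by rewrite /step_energy /vertex_coord alE // !PE // leqW.
split; rewrite -?PE //.
  by move=> i ij; have := lk i ij; rewrite alE // !PE // leqW.
rewrite -(@broken_ext R n M g (fun i => bx (al i)) (fun i => bx (al' i)) P P') // => i ij.
by rewrite alE.
Qed.

Section FixedAssignment.
Variables (a : pi1) (al : nat -> 'I_m.+1) (j : nat).
Local Notation T := (prod_topology (fun _ : nat => M)).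

Definition chains : set T := [set P : T | chain bx a al P j /\ forall i, (j < i)%N -> P i = x0].

Lemma link_zones P : (forall i, (i <= j)%N -> link al P i) -> in_zones (fun i => bx (al i)) P j.
Proof. by move=> lk i /lk[l1 l2]; split; exact: in_cbox_zone. Qed.

(** The conditions on the vertices are closed because the boxes are; the homotopy class passes to
    the limit because it is locally constant. *)
Lemma chains_closed : closed chains.
Proof.
move=> P clP.
have cc i (S : set M) : closed S -> (forall Q, chains Q -> S (Q i)) -> S (P i).
  move=> cS QS; apply: cS => B nB.
  have [Q [CQ BQ]] := clP _ (@proj_continuous nat (fun=> M) i P B nB).
  by exists (Q i); split => //; exact: QS.
have c0 : closed [set x0] by apply: compact_closed; [exact: manifold_hausdorff|exact: compact_set1].
have lk i : (i <= j)%N -> link al P i.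
  move=> ij; have r20 : 2 * rho (bx (al i)) <= 20 * rho (bx (al i)) by have := box_rho_gt0 (bx (al i)); lra.
  split; apply: cc; try exact: in_cbox_closed r20; move=> Q [[_ _ /(_ i ij)[? ?] _] _] //.
have P0 : P 0%N = x0 by apply: (cc 0%N [set x0]) => // Q [[]].
have Pj i : (j < i)%N -> P i = x0 by move=> ji; apply: (cc i [set x0]) => // Q [_ /(_ i ji)].
split=> //; split=> //; first exact: Pj.
have [W [nW WP]] := @broken_locally_constant R n M g x0 _ _ _ (link_zones lk).
have nU : nbhs (P : T) [set Q : T | forall i, (i < j.+2)%N -> W i (Q i)].
  apply: near_forall_lt => i ij; exact: (@proj_continuous nat (fun=> M) i P _ (nW i ij)).
have [Q [[[q0 qj _ rQ] _] WQ]] := clP _ nU.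
apply: WP rQ => //; first by move=> i ij; apply: nbhs_singleton; exact: nW.
- by rewrite q0 P0.
- by rewrite qj Pj.
Qed.

Lemma chains_compact : compact chains.
Proof.
apply: (@subclosed_compact _ chains [set P : T | forall i, setT (P i)]) => //.
  exact: chains_closed.
by apply: (@tychonoff nat (fun=> M) (fun=> setT)) => _; exact: manifold_compact.
Qed.

Lemma chain_energy_continuous : {within chains, continuous (fun P : T => chain_energy bx al P j)}.
Proof.
apply/subspace_continuousP => P CP; apply/cvgrPdist_le => e e0.
have [[_ _ lkP _] _] := CP.
pose d := e / j.+1%:R; have d0 : 0 < d by rewrite divr_gt0.
suff H i : (i < j.+1)%N -> nbhs (P : T) [set Q : T | chains Q -> `|step_energy bx al P i - step_energy bx al Q i| <= d].
  apply: (@filterS _ (nbhs (P : T)) _ _ _ _ (near_forall_lt H)) => Q QP CQ.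
  rewrite /chain_energy -sumrB (le_trans (ler_norm_sum _ _ _)) //.
  have -> : e = \sum_(i < j.+1) d by rewrite sumr_const card_ord -[d *+ _]mulr_natr divfK // pnatr_eq0.
  by apply: ler_sum => i _; apply: QP.
move=> ij; have [K K0 KP] := edge_energy_lipschitz (bx (al i)).
have [l1 l2] := lkP i ij.
have near_coord k : in_cbox (bx (al i)) (2 * rho (bx (al i))) (P k) ->
    nbhs (P : T) [set Q : T | `|coord (box_chart (bx (al i))) (Q k) - coord (box_chart (bx (al i))) (P k)| < d / (2 * (K + 1))].
  move=> [dk _]; have e1 : 0 < d / (2 * (K + 1)) by rewrite divr_gt0 // mulr_gt0 //; lra.
  exact: (@proj_continuous nat (fun=> M) k P _ (Defs.coord_continuous dk (nbhs_obox _ e1))).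
have n1 := near_coord _ l1; have n2 := near_coord _ l2.
apply: (@filterS2 _ (nbhs (P : T)) _ _ _ _ _ n1 n2) => Q /= q1 q2 [[_ _ lkQ _] _].
have [k1 k2] := lkQ i ij; rewrite distrC /step_energy.
rewrite (le_trans (KP _ _ _ _ l1.2 l2.2 k1.2 k2.2)) // /vertex_coord.
have : K * (`|coord (box_chart (bx (al i))) (Q i) - coord (box_chart (bx (al i))) (P i)| +
  `|coord (box_chart (bx (al i))) (Q i.+1) - coord (box_chart (bx (al i))) (P i.+1)|) <= K * (d / (K + 1)).
  rewrite ler_wpM2l //; have -> : d / (K + 1) = d / (2 * (K + 1)) + d / (2 * (K + 1)).
    by field; apply/eqP; lra.
  by rewrite lerD // ltW.
move=> /le_trans; apply; rewrite mulrCA ler_piMr ?(ltW d0) // ler_pdivrMr; lra.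
Qed.

Lemma chain_min_fixed : (exists P, chain bx a al P j) -> exists P, chain bx a al P j /\
  forall P', chain bx a al P' j -> chain_energy bx al P j <= chain_energy bx al P' j.
Proof.
pose norm P i := if (i <= j)%N then P i else x0.
have normP P : chain bx a al P j -> chains (norm P) /\ chain_energy bx al (norm P) j = chain_energy bx al P j.
  move=> CP; have [_ pj _ _] := CP; have [||C1 C2] := chain_ext (al' := al) (P' := norm P) _ _ CP => //.
    by move=> i; rewrite leq_eqVlt /norm => /orP[/eqP ->|]; [rewrite ltnn|rewrite ltnS => ->].
  by split=> //; split=> // i; rewrite ltnNge /norm => /negbTE ->.
move=> [P0 /normP[C0 _]].
have [|P] := @compact_EVT_min T R (fun P : T => chain_energy bx al P j) chains _ chains_compact chain_energy_continuous.
  by exists (norm P0).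
rewrite inE => -[CP _] Pmin; exists P; split=> // P' /normP[C' <-]; apply: Pmin; exact: mem_set.
Qed.

End FixedAssignment.

(** The energy depends on the boxes of the edges as well as on the vertices, but only the first
    [j + 1] values of [al] count, so finitely many assignments have to be compared. *)
Lemma chain_min a j : (exists al P, chain bx a al P j) -> exists al P, chain bx a al P j /\
  forall al' P', chain bx a al' P' j -> chain_energy bx al P j <= chain_energy bx al' P' j.
Proof.
pose ext (phi : {ffun 'I_j.+1 -> 'I_m.+1}) (i : nat) := phi (inord i).
have H phi : exists P, (exists P', chain bx a (ext phi) P' j) -> chain bx a (ext phi) P j /\
    forall P', chain bx a (ext phi) P' j -> chain_energy bx (ext phi) P j <= chain_energy bx (ext phi) P' j.
  have [/chain_min_fixed[P PP]|nP] := pselect (exists P', chain bx a (ext phi) P' j); first by exists P.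
  by exists (fun=> x0).
have {H}[P PP] := fun_choice H.
pose res al : {ffun 'I_j.+1 -> 'I_m.+1} := [ffun i : 'I_j.+1 => al (nat_of_ord i)].
have resE al i : (i <= j)%N -> al i = ext (res al) i.
  by move=> ij; rewrite /ext ffunE inordK.
move=> [al0 [P0 C0]].
have [C0' _] := chain_ext (resE al0) (fun _ _ => erefl) C0.
have i0 : `[< chain bx a (ext (res al0)) (P (res al0)) j >].
  by apply/asboolP; have [] := PP (res al0) (ex_intro (fun P' => chain bx a _ P' j) _ C0').
have [phi /asboolP Cphi phimin] := @arg_minP _ R _ (res al0)
  (fun phi => `[< chain bx a (ext phi) (P phi) j >]) (fun phi => chain_energy bx (ext phi) (P phi) j) i0.
exists (ext phi), (P phi); split=> // al' P' C'.
have [C'' <-] := chain_ext (resE al') (fun _ _ => erefl) C'.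
have [CP] := PP (res al') (ex_intro (fun P' => chain bx a _ P' j) _ C''); move/(_ _ C''); apply: le_trans.
by apply: phimin; apply/asboolP.
Qed.

End Minimisation.

(** * Geodesic loops in homotopy classes *)

Section GeodesicLoops.
Context {R : realType} {n : nat}.
Local Notation V := 'rV[R]_n.
Variables (M : closed_connected_manifold R n) (g : riemannian_metric M).
Local Notation A := (manifold_atlas M).
Local Notation dom := (@Defs.dom _ _ _ A).
Local Notation coord := (@Defs.coord _ _ _ A).
Local Notation param := (@Defs.param _ _ _ A).
Local Notation box := (good_box g).
Variables (m : nat) (bx : 'I_m.+1 -> box).
Hypothesis bx_cover : forall x, exists i, in_box (bx i) (rho (bx i)) x.
Variable sigma : R.
Hypothesis sigma_gt0 : 0 < sigma.
Hypothesis sigma_le : forall i, sigma <= edge_bound (bx i).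
Variable x0 : M.
Local Notation pi1 := (fundamental_group R x0).
Implicit Types (a c : pi1) (al : nat -> 'I_m.+1) (P : nat -> M) (t s : R).

Definition edge_curve al P i : R -> M := fun s => param (box_chart (bx (al i)))
  ((edge (bx (al i)) (vertex_coord bx al P i i) (vertex_coord bx al P i i.+1)).1 s).

Lemma unit_cell_itv i t : i%:R <= t <= i.+1%:R -> unit_itv (t - i%:R).
Proof. by rewrite -natr1 /unit_itv /=; lra. Qed.

Section Link.
Variables (al : nat -> 'I_m.+1) (P : nat -> M) (i : nat).
Hypothesis lk : link bx al P i.

Lemma edge_curve0 : edge_curve al P i 0 = P i.
Proof.
have [[d1 z1] [d2 z2]] := lk; have [c0 _ _] := edgeP z1 z2.
by rewrite /edge_curve c0 /vertex_coord coordK.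
Qed.

Lemma edge_curve1 : edge_curve al P i 1 = P i.+1.
Proof.
have [[d1 z1] [d2 z2]] := lk; have [_ c1 _] := edgeP z1 z2.
by rewrite /edge_curve c1 /vertex_coord coordK.
Qed.

Lemma edge_curve_geodesic s : -1 < s < 2 -> geodesic_at g (step_energy bx al P i) (edge_curve al P i) s.
Proof. by have [[d1 z1] [d2 z2]] := lk; exact: edge_geodesic. Qed.

Lemma edge_curve_zone s : unit_itv s -> zone (bx (al i)) (edge_curve al P i s).
Proof.
move=> s01; have [[d1 z1] [d2 z2]] := lk; have zo := edge_zone z1 z2 s01.
have [[di _] cE] := param_in_cbox (lexx _) (sub_ocbox zo).
by split=> //; rewrite cE.
Qed.

Lemma step_energy_ge0 : 0 <= step_energy bx al P i.
Proof. by have [[d1 z1] _] := lk; exact: edge_energy_ge0. Qed.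

Lemma edge_curve_continuous : continuous (fun t => edge_curve al P i (clamp (t - i%:R))).
Proof.
move=> t; have c1 : continuous (fun t => clamp (t - i%:R)).
  by apply: cont_comp => [|s]; [exact: clamp_continuous|apply: cvgB; [exact: cvg_id|exact: cvg_cst]].
apply: (@continuous_comp R R M (fun t => clamp (t - i%:R)) (edge_curve al P i)); first exact: c1.
apply: geodesic_at_continuous; apply: edge_curve_geodesic.
by have := clamp01 (t - i%:R); lra.
Qed.

End Link.

(** Clamping the time of each edge makes the loop continuous on the whole line, as
    [represents_broken] requires; the unclamped curve in [minimal_geodesic] is the one that remains
    a geodesic past its ends. *)
Definition geo_loop al P j : R -> M := glue (fun i t => edge_curve al P i (clamp (t - i%:R))) id j.

Lemma edge_curve_match al P j : (forall i, (i <= j)%N -> link bx al P i) ->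
  forall i t, (i < j)%N -> t = i.+1%:R ->
  edge_curve al P i (clamp (t - i%:R)) = edge_curve al P i.+1 (clamp (t - i.+1%:R)).
Proof.
move=> lk i t ij ->; rewrite subrr -natrB // subSnn clamp_ge1 // clamp_le0 //.
by rewrite edge_curve1 ?edge_curve0 //; [exact: lk|apply: lk; exact: ltnW].
Qed.

Lemma geo_loopE al P j i t : (forall i, (i <= j)%N -> link bx al P i) -> (i <= j)%N ->
  i%:R <= t <= i.+1%:R -> geo_loop al P j t = edge_curve al P i (t - i%:R).
Proof.
move=> lk ij ti; rewrite /geo_loop (@glue_closedE R n M R _ id j i) //; last exact: edge_curve_match.
by rewrite clamp_id //; exact: unit_cell_itv.
Qed.

Lemma geo_loop_continuous al P j : (forall i, (i <= j)%N -> link bx al P i) ->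
  continuous (geo_loop al P j).
Proof.
move=> lk; apply: glue_continuous => [t|i ij|]; first exact: cvg_id.
  exact: edge_curve_continuous (lk i ij).
exact: edge_curve_match.
Qed.

Lemma geo_loop_vertex al P j i : (forall i, (i <= j)%N -> link bx al P i) -> (i <= j.+1)%N ->
  geo_loop al P j i%:R = P i.
Proof.
move=> lk; rewrite leq_eqVlt => /orP[/eqP ->|]; last rewrite ltnS => ij.
  rewrite (geo_loopE (i := j)) // ?lexx ?ler_nat ?leqnSn // -natrB // subSnn edge_curve1 //; exact: lk.
rewrite (geo_loopE (i := i)) // ?lexx ?ler_nat ?leqnSn // subrr edge_curve0 //; exact: lk.
Qed.

(** The boxes [al'] of the broken path may differ from the boxes [al] in which the edges were
    solved; applied twice, the lemma changes boxes without changing the class. *)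
Lemma represents_geo_loop a al al' P j : (forall i, (i <= j)%N -> link bx al P i) ->
  (forall i s, (i <= j)%N -> unit_itv s -> zone (bx (al' i)) (edge_curve al P i s)) ->
  represents (geo_loop al P j) j.+1%:R a <-> represents (broken (fun i => bx (al' i)) P j) j.+1%:R a.
Proof.
move=> lk zn; apply: represents_broken; first exact: geo_loop_continuous.
  by move=> i t ij ti; rewrite (geo_loopE lk ij ti); apply: zn => //; exact: unit_cell_itv.
by move=> i ij; exact: geo_loop_vertex.
Qed.

(* A vertex may sit on the boundary of the boxes of its two edges, where it cannot be varied; reading both edges
   in a box whose core contains the vertex makes it interior without changing the energy. *)
Definition rechart al k be i := if (i == k) || (i == k.+1) then be else al i.

(** An edge of energy at most [sigma] with an endpoint in the core of [bx be] is, by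
    [geodesic_edge], also the edge of that box, with the same energy. *)
Lemma rechart_chain a al P j k be : chain bx a al P j ->
  (forall i, (i <= j)%N -> step_energy bx al P i <= sigma) ->
  (k < j)%N -> in_box (bx be) (rho (bx be)) (P k.+1) ->
  let al' := rechart al k be in
  [/\ chain bx a al' P j,
   forall i, (i <= j)%N -> step_energy bx al' P i = step_energy bx al P i &
   forall i s, (i <= j)%N -> unit_itv s -> edge_curve al P i s = edge_curve al' P i s].
Proof.
move=> [P0 Pj lk rep] small kj bk al'.
have s1 : unit_itv (1 : R) by rewrite /unit_itv /=; lra.
have s0 : unit_itv (0 : R) by rewrite /unit_itv /=; lra.
have s12 s : unit_itv s -> -1 < s < 2 by rewrite /unit_itv /=; lra.
have G i : (i == k) || (i == k.+1) ->
   [/\ (i <= j)%N, forall s, unit_itv s -> in_box (bx be) (2 * rho (bx be)) (edge_curve al P i s),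
     forall s, unit_itv s -> edge_curve al P i s = param (box_chart (bx be))
        ((edge (bx be) (coord (box_chart (bx be)) (P i)) (coord (box_chart (bx be)) (P i.+1))).1 s) &
     step_energy bx al P i = edge_energy (bx be) (coord (box_chart (bx be)) (P i)) (coord (box_chart (bx be)) (P i.+1))].
  move=> ik; have ij : (i <= j)%N by case/orP: ik => /eqP -> //; exact: ltnW.
  have gg s : unit_itv s -> geodesic_at g (step_energy bx al P i) (edge_curve al P i) s.
    by move=> /s12; exact: edge_curve_geodesic (lk i ij) s.
  have [|st /=] := geodesic_edge gg (le_trans (small i ij) (sigma_le be)).
    case/orP: ik => /eqP E; [right|left]; first by rewrite (edge_curve1 (lk i ij)) E.
    by rewrite (edge_curve0 (lk i ij)) E.
  by rewrite (edge_curve0 (lk i ij)) (edge_curve1 (lk i ij)) => -[E1 E2].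
have zb (b : box) : in_box b (2 * rho b) `<=` zone b by apply: in_box_zone; have := box_rho_gt0 b; lra.
split=> [|i ij|i s ij s01]; rewrite /step_energy /edge_curve /vertex_coord /al' /rechart; last 2 first.
- by case: ifP => // /G[_ _ _ E]; rewrite -E.
- by case: ifP => // /G[_ _ E _]; rewrite -E.
split=> //.
  move=> i ij; rewrite /al' /rechart; case: ifP => [/G[_ st _ _]|_]; last exact: lk.
  rewrite -(edge_curve0 (lk i ij)) -(edge_curve1 (lk i ij)).
  by split; apply: in_box_cbox; exact: st.
apply/(represents_geo_loop (al := al) _ lk); last first.
  by apply/(represents_geo_loop (al := al) (al' := al) _ lk) => // i s ij; exact: edge_curve_zone (lk i ij) s.
move=> i s ij s01; rewrite /rechart; case: ifP => [/G[_ st _ _]|_]; last exact: edge_curve_zone (lk i ij) s s01.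
by apply: zb; exact: st.
Qed.

Section Minimal.
Variables (a : pi1) (al : nat -> 'I_m.+1) (P : nat -> M) (j : nat).
Hypothesis chain_aP : chain bx a al P j.
Hypothesis small : forall i, (i <= j)%N -> step_energy bx al P i <= sigma.
Hypothesis minimal : forall al' P', chain bx a al' P' j -> chain_energy bx al P j <= chain_energy bx al' P' j.

Let lk i : (i <= j)%N -> link bx al P i.
Proof. by have [_ _ H _] := chain_aP; exact: H. Qed.

(** After recharting, the vertex [k + 1] lies in the core of one box carrying both adjacent edges
    and may be moved, which changes only two summands of the energy. The curve [kappa] is the second
    edge, continued backwards past its starting point. *)
Lemma corner_smooth k : (k < j)%N -> step_energy bx al P k = step_energy bx al P k.+1 /\
  exists kappa : R -> M, geodesic_at g (step_energy bx al P k.+1) kappa 0 /\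
  exists2 d : R, 0 < d & forall s, `|s| < d ->
    (s <= 0 -> kappa s = edge_curve al P k (s + 1)) /\ (0 <= s -> kappa s = edge_curve al P k.+1 s).
Proof.
move=> kj; have [be bk] := bx_cover (P k.+1).
have [C' Ee Ec] := rechart_chain chain_aP small kj bk; set al' := rechart al k be in C' Ee Ec.
have [P0 Pj lk' rep'] := C'; set b := bx be in bk.
have alk : al' k = be by rewrite /al' /rechart eqxx.
have alk1 : al' k.+1 = be by rewrite /al' /rechart eqxx orbT.
pose u := coord (box_chart b) (P k); pose w := coord (box_chart b) (P k.+1); pose x := coord (box_chart b) (P k.+2).
have [[_ zu] [_ zw]] := lk' k (ltnW kj); have [_ [_ zx]] := lk' k.+1 kj.
rewrite alk -/b -/u in zu; rewrite alk -/b -/w in zw; rewrite alk1 -/b -/x in zx.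
have [dk ow] := bk; rewrite -/w in ow; have b0 := box_rho_gt0 b.
have ow2 : obox (center b) (2 * rho b) w by apply: lt_trans ow _; lra.
have [W [nW WP]] := @broken_locally_constant R n M g x0 _ _ _ (link_zones lk').
have iw : chart_image (box_chart b) w by exists (P k.+1).
have nE : \forall w' \near w, edge_energy b u w + edge_energy b w x <= edge_energy b u w' + edge_energy b w' x.
  have n1 : nbhs w (param (box_chart b) @^-1` W k.+1).
    by apply: (param_continuous iw); rewrite /w coordK //; apply: nW; exact: leqW.
  have n2 : nbhs w (obox (center b) (2 * rho b)) by apply: open_nbhs_nbhs; split; [exact: obox_open|].
  apply: (@filterS2 _ (nbhs w) _ _ _ _ _ n1 n2) => w' Ww' ow'.
  have r20 : 2 * rho b <= 20 * rho b by lra.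
  have [ip cE] := param_in_cbox r20 (sub_ocbox ow').
  pose P' i := if i == k.+1 then param (box_chart b) w' else P i.
  have P'k : P' k = P k by rewrite /P' ltn_eqF.
  have P'k1 : P' k.+1 = param (box_chart b) w' by rewrite /P' eqxx.
  have P'k2 : P' k.+2 = P k.+2 by rewrite /P' gtn_eqF.
  have C'' : chain bx a al' P' j.
    have P'j : P' j.+1 = P j.+1 by rewrite /P' gtn_eqF // ltnS.
    split; rewrite ?P'j //.
      move=> i ij; have [l1 l2] := lk' i ij; rewrite /P'; split; case: ifP => // /eqP E.
        by rewrite E alk1.
      by case: E => E; rewrite E alk.
    apply: WP rep' => //; rewrite ?P'j //; first by move=> i ij; apply: nbhs_singleton; exact: nW.
    by move=> i ij; rewrite /P'; case: ifP => [/eqP -> //|_]; apply: nbhs_singleton; exact: nW.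
  have : chain_energy bx al' P j <= chain_energy bx al' P' j.
    apply: le_trans (minimal C''); rewrite le_eqVlt; apply/orP; left; apply/eqP.
    by apply: eq_bigr => i _; apply: Ee; rewrite -ltnS.
  pose ik := Ordinal (leqW kj : (k < j.+1)%N); pose ik1 := Ordinal (kj : (k.+1 < j.+1)%N).
  have ne : ik1 != ik by rewrite -val_eqE /= gtn_eqF.
  have split2 (F : nat -> R) : \sum_(i < j.+1) F i =
      F k + F k.+1 + \sum_(i < j.+1 | (i != ik) && (i != ik1)) F i.
    by rewrite (bigD1 ik) //= (bigD1 ik1) //= addrA.
  rewrite /chain_energy !split2.
  have -> : \sum_(i < j.+1 | (i != ik) && (i != ik1)) step_energy bx al' P' i =
            \sum_(i < j.+1 | (i != ik) && (i != ik1)) step_energy bx al' P i.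
    apply: eq_bigr => i; rewrite -!val_eqE /= => /andP[/negbTE i1 /negbTE i2].
    by rewrite /step_energy /vertex_coord /P' i2 eqSS i1.
  rewrite lerD2r /step_energy /vertex_coord alk alk1 P'k P'k1 P'k2 -/b.
  by rewrite cE.
have vv := corner_velocity zu ow2 zx nE.
have [EE [d d0 dP]] := corner_match zu zw zx vv.
have Ek : step_energy bx al P k = edge_energy b u w.
  by rewrite -Ee ?(ltnW kj) // /step_energy /vertex_coord alk.
have Ek1 : step_energy bx al P k.+1 = edge_energy b w x.
  by rewrite -Ee // /step_energy /vertex_coord alk1.
split; first by rewrite Ek Ek1.
exists (fun s => param (box_chart b) ((edge b w x).1 s)); split.
  by rewrite Ek1; apply: edge_geodesic => //; lra.
exists (Num.min d 1); first by rewrite lt_min d0 ltr01.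
move=> s; rewrite lt_min => /andP[sd]; rewrite ltr_norml => /andP[s1 s2]; split=> s0.
  rewrite Ec ?(ltnW kj) //; last by rewrite /unit_itv /=; lra.
  by rewrite /edge_curve /vertex_coord alk -/b -/u -/w dP.
rewrite Ec //; last by rewrite /unit_itv /=; lra.
by rewrite /edge_curve /vertex_coord alk1.
Qed.

Lemma minimal_geodesic : exists e gamma, [/\ 0 <= e, j.+1%:R * e = chain_energy bx al P j,
  forall t, -1 < t < j.+2%:R -> geodesic_at g e gamma t,
  represents gamma j.+1%:R a &
  e = 0 -> forall t, 0 <= t <= j.+1%:R -> gamma t = x0].
Proof.
pose e := step_energy bx al P 0.
have Ee i : (i <= j)%N -> step_energy bx al P i = e.
  by elim: i => // i IH ij; have [<- _] := corner_smooth ij; apply: IH; exact: ltnW.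
(* The edges are not clamped, so the first and the last one continue the loop to [(-1, j + 2)], as
   the definition of a geodesic asks for an open interval around [[0, j + 1]]. *)
pose gamma := glue (fun i t => edge_curve al P i (t - i%:R)) id j.
have gm i t : (i < j)%N -> t = i.+1%:R ->
    edge_curve al P i (t - i%:R) = edge_curve al P i.+1 (t - i.+1%:R).
  move=> ij ->; rewrite subrr -natrB // subSnn edge_curve1 ?edge_curve0 //; [exact: lk|apply: lk; exact: ltnW].
have gE i t : (i <= j)%N -> i%:R <= t <= i.+1%:R -> gamma t = edge_curve al P i (t - i%:R).
  by move=> ij ti; rewrite /gamma (@glue_closedE R n M R _ id j i).
have shift i s (e' : R) ga : geodesic_at g e' ga (s - i%:R) -> geodesic_at g e' (fun t => ga (t - i%:R)) s.
  have E t : t - i%:R = 1 * t + - i%:R by rewrite mul1r.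
  have -> : (fun t => ga (t - i%:R)) = (fun t => ga (1 * t + - i%:R)) by apply/funext => t; rewrite E.
  by rewrite E => /geodesic_at_affine; rewrite expr1n mul1r.
have vertex k : (k < j)%N -> geodesic_at g e gamma k.+1%:R.
  move=> kj; have [_ [ka [kg [d d0 dP]]]] := corner_smooth kj.
  rewrite Ee // in kg; have kg' : geodesic_at g e (fun t => ka (t - k.+1%:R)) k.+1%:R.
    by apply: shift; rewrite subrr.
  apply: geodesic_at_ext kg'; apply/nbhs_ballP; exists (Num.min d 1) => /=; first by rewrite lt_min d0 ltr01.
  move=> t; rewrite -ball_normE /= distrC lt_min => /andP[/dP[h1 h2]].
  rewrite ltr_norml -natr1 => /andP[t1 t2]; have [tk|kt] := leP t (k%:R + 1).
    have tk' : k%:R <= t <= k.+1%:R by rewrite -natr1 tk andbT; lra.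
    rewrite (gE k t (ltnW kj) tk'); rewrite -natr1 in h1; rewrite h1 ?subr_le0 //.
    by congr (edge_curve _ _ _ _); ring.
  have tk' : k.+1%:R <= t <= k.+2%:R by rewrite -[k.+2%:R]natr1 -natr1 (ltW kt) /=; lra.
  by rewrite (gE k.+1 t kj tk'); rewrite -natr1 in h2 *; rewrite h2 // subr_ge0 ltW.
exists e, gamma; split.
- exact: step_energy_ge0 (lk (leq0n j)).
- rewrite /chain_energy (eq_bigr (fun=> e)) => [|i _]; last by apply: Ee; rewrite -ltnS.
  by rewrite sumr_const card_ord mulr_natl.
- move=> t /andP[t1 t2].
  have inner i : (i <= j)%N -> (i = 0)%N \/ i%:R < t -> (i = j)%N \/ t < i.+1%:R -> geodesic_at g e gamma t.
    move=> ij h1 h2; have n1 : \forall t' \near t, (i = 0)%N \/ i%:R < t'.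
      case: h1 => h1; first by apply: (@filterE _ (nbhs t) _) => t'; left.
      by apply: (@filterS _ (nbhs t) _ _ _ _ (lt_nbhsr h1)) => t'; right.
    have n2 : \forall t' \near t, (i = j)%N \/ t' < i.+1%:R.
      case: h2 => h2; first by apply: (@filterE _ (nbhs t) _) => t'; left.
      by apply: (@filterS _ (nbhs t) _ _ _ _ (lt_nbhsl h2)) => t'; right.
    have : \forall t' \near t, edge_curve al P i (t' - i%:R) = gamma t'.
      apply: (@filterS2 _ (nbhs t) _ _ _ _ _ n1 n2) => t' h1' h2'.
      rewrite /gamma (@glueE R n M R _ id j i) //.
      by case: h2' => ?; [left|right; exact: ltW].
    move/geodesic_at_ext; apply; apply: shift; rewrite -(Ee i ij); apply: edge_curve_geodesic; first exact: lk.
    apply/andP; split.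
      by case: h1 => [->|]; [rewrite subr0|lra].
    case: h2 => [->|]; last by rewrite -natr1; lra.
    by move: t2; rewrite -natr1 -natr1; lra.
  have [tneg|tpos] := ltP t 1.
    by apply: (inner 0%N) => //; [left|right].
  have [tlast|tin] := ltP j%:R t; first by apply: (inner j) => //; [right|left].
  have [|i ij /andP[it ti]] := @unit_cell R j t.
    by rewrite (le_trans ler01 tpos) (le_trans tin) // ler_nat.
  have [iE|ine] := eqVneq t i%:R.
    by case: i iE {it ti} ij => [E _|k -> kj]; [rewrite E ler10 in tpos|exact: vertex].
  have [iE1|ine1] := eqVneq t i.+1%:R.
    by rewrite iE1; apply: vertex; rewrite iE1 ler_nat in tin.
  by apply: (inner i ij); right; rewrite lt_neqAle ?ine1 // eq_sym ine.
- apply: (represents_ext (f := geo_loop al P j)) => [||].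
  + exact: ler0n.
  + by move=> t /unit_cell[i ij ti]; rewrite (gE i) // (geo_loopE lk ij ti).
  have [_ _ _ rep] := chain_aP.
  by apply/(represents_geo_loop (al := al) (al' := al) _ lk) => // i s ij; exact: edge_curve_zone (lk ij) s.
move=> e0; have st i s : (i <= j)%N -> unit_itv s -> edge_curve al P i s = P i.
  move=> ij s01; have [[d1 z1] [d2 z2]] := lk ij.
  rewrite /edge_curve (edge_energy_eq0 z1 z2) //; first by rewrite /vertex_coord coordK.
  by rewrite -[LHS]/(step_energy bx al P i) Ee.
have Px i : (i <= j)%N -> P i = x0.
  have [P0 _ _ _] := chain_aP; elim: i => // i IH ij.
  rewrite -(edge_curve1 (lk (ltnW ij))) st ?(ltnW ij) ?IH ?(ltnW ij) //.
  by rewrite /unit_itv /=; lra.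
by move=> t /unit_cell[i ij ti]; rewrite (gE i) // st ?Px //; exact: unit_cell_itv.
Qed.

End Minimal.
(* The number [K * N] of edges is quadratic in [K], since [N] must be large for the edges to be short; but the energy is
   at most [C * K / N], so Cauchy-Schwarz bounds the length by [sqrt (K * N * (C * K / N))], linear in [K]. *)
Theorem geodesic_loops : exists2 C : R, 0 < C & forall a K, coarse bx a K.+1 -> a <> 1%g ->
  exists L gamma, [/\ geodesic g x0 x0 L gamma, L <= C * K.+1%:R & represents gamma L a].
Proof.
have [C C0 CP] := chain_exists bx x0; exists (C + 1) => [|a K cK a1]; first by lra.
pose Kr : R := K.+1%:R; have K0 : 0 < Kr by rewrite ltr0n.
have KC : 0 < Kr * C + 1 by have : 0 <= Kr * C; [rewrite mulr_ge0 // ltW|lra].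
(* [N] is so large that the total energy, at most [Kr * C / Nr], is below [sigma]; then so is the
   energy of every edge of the minimiser. *)
have [N _ NP] := near_infty_natSinv_lt (PosNum (divr_gt0 sigma_gt0 KC)).
have /= := NP N (leqnn N); pose Nr : R := N.+1%:R; rewrite -/Nr; have N0 : 0 < Nr by rewrite ltr0n.
rewrite ltr_pdivlMr // mulrC -ltr_pdivlMr ?invr_gt0 // invrK => Nsmall.
have [al0 [P0 [c0 st0]]] := CP a K N cK.
set j := (K.+1 * N.+1).-1 in c0.
have jE : j.+1 = (K.+1 * N.+1)%N by rewrite /j prednK // muln_gt0.
have jr : j.+1%:R = Kr * Nr by rewrite jE natrM.
have E0 : chain_energy bx al0 P0 j <= Kr * C / Nr.
  have -> : Kr * C / Nr = \sum_(i < j.+1) C / Nr ^+ 2.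
    rewrite sumr_const card_ord -mulr_natl jr; field; exact: lt0r_neq0.
  by apply: ler_sum => i _; apply: st0; rewrite -jE.
have [al [P [cP minP]]] := chain_min (ex_intro (fun al => exists P, chain bx a al P j) al0
  (ex_intro (fun P => chain bx a al0 P j) P0 c0)).
have E1 := le_trans (minP _ _ c0) E0.
have [_ _ lk _] := cP.
have small i : (i <= j)%N -> step_energy bx al P i <= sigma.
  move=> ij; apply: (@le_trans _ _ (chain_energy bx al P j)).
    rewrite /chain_energy (bigD1 (Ordinal (ij : (i < j.+1)%N))) //= lerDl.
    by apply: sumr_ge0 => k _; apply: step_energy_ge0; apply: lk; rewrite -ltnS.
  rewrite (le_trans E1) // ler_pdivrMr //; lra.
have [e [gamma [e0 eE gg rep eq0]]] := minimal_geodesic cP small minP.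
have {}e0 : 0 < e.
  rewrite lt_neqAle e0 andbT eq_sym; apply/eqP => /eq0 g0; apply: a1.
  by apply: (@represents_cst R n M x0 j.+1%:R); apply: represents_ext rep; first exact: ler0n.
(* The constant speed of [gamma] is [q], so the arclength parametrization is [gamma (t / q)], of
   length [j.+1%:R * q]. The square of this length is [j.+1%:R] times the total energy, hence at
   most [Kr ^+ 2 * C]. *)
pose q := Num.sqrt e; have q0 : 0 < q by rewrite sqrtr_gt0.
have q2 : q ^+ 2 = e by rewrite sqr_sqrtr // ltW.
have [g0 gj] := represents_endpoints rep.
have L0 : 0 < j.+1%:R * q by rewrite mulr_gt0 // ltr0n.
exists (j.+1%:R * q), (fun t => gamma (t / q)); split.
- split=> //; first by rewrite mul0r.
    by rewrite mulfK ?gt_eqF.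
  exists q => //; apply/unit_speed_geodesic_at; first exact: interval_open.
  move=> s; rewrite /= in_itv /= => /andP[s1 s2].
  have -> : (fun t => gamma (t / q)) = (fun t => gamma (q^-1 * t + 0)).
    by apply/funext => t; rewrite addr0 mulrC.
  have -> : 1 = q^-1 ^+ 2 * e by rewrite -q2 -exprMn mulVf ?gt_eqF // expr1n.
  apply: geodesic_at_affine; rewrite addr0 mulrC; apply: gg.
  rewrite ltr_pdivlMr // ltr_pdivrMr // mulN1r s1 /=.
  by rewrite (lt_le_trans s2) // -[j.+2%:R]natr1 mulrDl mul1r.
- rewrite -ler_sqr ?nnegrE ?(ltW L0) //; last by rewrite mulr_ge0 ?(ltW K0) //; lra.
  rewrite exprMn q2 expr2 -mulrA eE.
  have h1 : j.+1%:R * chain_energy bx al P j <= Kr ^+ 2 * C.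
    rewrite (le_trans (ler_wpM2l (ler0n _ _) E1)) // jr le_eqVlt; apply/orP; left; apply/eqP.
    field; exact: lt0r_neq0.
  rewrite (le_trans h1) // exprMn mulrC ler_wpM2r ?exprn_ge0 ?(ltW K0) //.
  by have : 0 <= C ^+ 2; [rewrite exprn_ge0|rewrite sqrrD expr1n mulr1; lra].
exact: represents_scale (lt0r_neq0 q0) rep.
Qed.

End GeodesicLoops.

(** * Unique continuation *)

Section UniqueContinuation.
Context {R : realType} {n : nat}.
Local Notation V := 'rV[R]_n.
Variables (M : closed_connected_manifold R n) (g : riemannian_metric M).
Local Notation A := (manifold_atlas M).
Local Notation dom := (@Defs.dom _ _ _ A).
Local Notation coord := (@Defs.coord _ _ _ A).
Local Notation param := (@Defs.param _ _ _ A).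
Local Notation box := (good_box g).
Implicit Types (gamma : R -> M) (s t e : R).

Lemma near_radius2 (P Q : R -> Prop) t : (\forall s \near t, P s) -> (\forall s \near t, Q s) ->
  exists2 d : R, 0 < d & forall s, `|s - t| < d -> P s /\ Q s.
Proof.
move=> Pt Qt; have : \forall s \near t, P s /\ Q s by exact: (@filterI _ (nbhs t) _ _ _ Pt Qt).
move=> /nbhs_ballP[d /= d0 dP]; exists d => // s sd; apply: dP.
by rewrite -ball_normE /= distrC.
Qed.

Lemma geodesic_local_unique (b : box) e gamma gamma' t : geodesic_at g e gamma t -> geodesic_at g e gamma' t ->
  e <= edge_bound b -> zone b (gamma t) -> gamma t = gamma' t ->
  derive1 (coord (box_chart b) \o gamma) t = derive1 (coord (box_chart b) \o gamma') t ->
  \forall s \near t, gamma s = gamma' s.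
Proof.
move=> gt gt' eb zt tt' dd; set i := box_chart b in dd.
have key (ga : R -> M) : geodesic_at g e ga t -> zone b (ga t) -> exists2 d : R, 0 < d & forall s, `|s - t| < d ->
    [/\ dom i (ga s), vderive (coord i \o ga) s (derive1 (coord i \o ga) s),
      vderive (derive1 (coord i \o ga)) s (geod_rhs (gram g i) ((coord i \o ga) s) (derive1 (coord i \o ga) s)) &
      cbox (center b) (20 * rho b) ((coord i \o ga) s) /\ cbox 0 (6 * rho b) (derive1 (coord i \o ga) s)].
  move=> gat za; have [dt _] := za; have H := geodesic_at_chart gat dt.
  have zN : \forall s \near t, zone b (ga s).
    by apply: (geodesic_at_continuous gat); apply: open_nbhs_nbhs; split; [exact: zone_open|].
  have [d d0 dP] := near_radius2 H zN; exists d; first exact: d0.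
  move=> s sd.
  have [[_ _ cd vd E] [ds zs]] := dP s sd.
  have zs' := sub_ocbox zs; split; [exact: ds|exact: cd|exact: vd|split; first exact: zs'].
  by rewrite /cbox /= subr0 (le_trans (slow_velocity zs' E eb)) //; have := box_rho_gt0 b; lra.
have zt' : zone b (gamma' t) by rewrite -tt'.
have [d1 d10 K1] := key _ gt zt; have [d2 d20 K2] := key _ gt' zt'.
pose d : R := Num.min d1 d2; have d0 : 0 < d by rewrite lt_min d10.
have L0 : 0 <= (1 / 100 : R) by lra.
have sub s : `|s - t| < d -> `|s - t| < d1 /\ `|s - t| < d2 by rewrite lt_min => /andP[].
have [||||||r r0 rP] := @ivp_local_unique _ _ _ _ _ _ _ (@box_rhs_lipschitz _ _ _ _ b)
   (coord i \o gamma) (derive1 (coord i \o gamma)) (coord i \o gamma') (derive1 (coord i \o gamma')) t d d0 L0.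
- by move=> s /sub[/K1[]].
- by move=> s /sub[_ /K2[]].
- by move=> s /sub[/K1[]].
- by move=> s /sub[_ /K2[]].
- by rewrite /= tt'.
- exact: dd.
apply/nbhs_ballP; exists (Num.min r d); first by rewrite /= lt_min r0.
move=> s; rewrite -ball_normE /= distrC lt_min => /andP[/rP[E _] /sub[/K1[ds _ _ _] /K2[ds' _ _ _]]].
by rewrite -(coordK ds) -(coordK ds'); congr param.
Qed.

(** Agreement on the left of [t] gives equal velocities there, and at [t] by continuity; uniqueness
    in the initial value problem then carries the agreement to the right. *)
Lemma geodesic_continuation_left (b : box) e gamma gamma' a t :
  geodesic_at g e gamma t -> geodesic_at g e gamma' t ->
  e <= edge_bound b -> zone b (gamma t) -> a < t ->
  (forall s, a <= s <= t -> gamma s = gamma' s) ->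
  \forall s \near t, gamma s = gamma' s.
Proof.
move=> gt gt' eb zt at_ gg; have tt' : gamma t = gamma' t by apply: gg; rewrite lexx ltW.
have [dt _] := zt; have dt' : dom (box_chart b) (gamma' t) by rewrite -tt'.
set i := box_chart b in dt dt'.
apply: (geodesic_local_unique gt gt' eb zt tt'); rewrite -/i.
have H := geodesic_at_chart gt dt; have H' := geodesic_at_chart gt' dt'.
have [d d0 dP] := near_radius2 H H'.
pose v s := derive1 (coord i \o gamma) s - derive1 (coord i \o gamma') s.
suff : cbox 0 0 (v t) by rewrite /cbox /= subr0 normr_le0 subr_eq0 => /eqP.
pose a' := Num.max a (t - d / 2); have a't : a' < t by rewrite /a' gt_max at_ /=; lra.
have a'P s : a' < s < t -> a < s /\ `|s - t| < d.
  rewrite /a' gt_max => /andP[/andP[h1 h2] h3]; split=> //.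
  by rewrite ltr0_norm ?subr_lt0 //; lra.
apply: (@closed_left_limit R V v (cbox 0 0) ((a' + t) / 2)).
- by rewrite midf_lt.
- exact: cbox_closed.
- have [_ _ _ vd _] := nbhs_singleton H; have [_ _ _ vd' _] := nbhs_singleton H'.
  exact: vderive_continuous (vderiveB vd vd').
move=> s /andP[s1 s2]; have a's : a' < s by rewrite (lt_le_trans _ s1) // midf_lt.
have [as_ bs] := a'P s (introT andP (conj a's s2)).
have [[_ _ cd _ _] [_ _ cd' _ _]] := dP s bs.
have cc : \forall u \near s, (coord i \o gamma) u = (coord i \o gamma') u.
  apply: (@filterS2 _ (nbhs s) _ _ _ _ _ (lt_nbhsr as_) (lt_nbhsl s2)) => u u1 u2 /=.
  by rewrite gg // !ltW.
by rewrite /cbox /= subr0 normr_le0 subr_eq0; apply/eqP/(vderive_unique (vderive_near cc cd) cd').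
Qed.

Section FixedCover.
Variables (m : nat) (bx : 'I_m.+1 -> box).
Hypothesis bx_cover : forall x, exists i, in_box (bx i) (rho (bx i)) x.
Variable sigma : R.
Hypothesis sigma_gt0 : 0 < sigma.
Hypothesis sigma_le : forall i, sigma <= edge_bound (bx i).

(** Real induction: agreement extends to the right by local uniqueness, and to limits because [M] is
    Hausdorff. *)
Lemma slow_continuation e gamma gamma' a b : 0 < a -> a <= b -> e <= sigma ->
  (forall s, 0 <= s <= b -> geodesic_at g e gamma s) ->
  (forall s, 0 <= s <= b -> geodesic_at g e gamma' s) ->
  (forall s, 0 <= s <= a -> gamma s = gamma' s) -> forall s, 0 <= s <= b -> gamma s = gamma' s.
Proof.
move=> a0 ab es gg gg' ga s /andP[s0 sb].
have [sa|as_] := leP s a; first by apply: ga; rewrite s0.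
apply: (@real_induction R (fun s => gamma s = gamma' s) a b) => //; last by rewrite ltW.
- by apply: ga; rewrite lexx ltW.
- move=> t /andP[at_ tb] H; have t0 : 0 < t by exact: lt_le_trans at_.
  have gt : 0 <= t <= b by rewrite !ltW.
  have [i it] := bx_cover (gamma t).
  have zt : zone (bx i) (gamma t) by apply: in_box_zone it; have := box_rho_gt0 (bx i); lra.
  have : \forall s \near t, gamma s = gamma' s.
    apply: (geodesic_continuation_left (gg t gt) (gg' t gt) (le_trans es (sigma_le i)) zt t0).
    move=> u /andP[u0 ut]; have [ua|au] := leP u a; first by apply: ga; rewrite u0.
    by apply: H; rewrite ut ltW.
  move=> /nbhs_ballP[d /= d0 dP]; exists d => // u /andP[tu ud]; apply: dP.
  by rewrite -ball_normE /= ltr0_norm ?subr_lt0 //; lra.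
move=> t /andP[at_ tb] H; have t0 : 0 < t by exact: lt_trans at_.
have gt : 0 <= t <= b by rewrite ltW.
have := @manifold_hausdorff R n M; rewrite open_hausdorff => hM.
apply: contrapT => /eqP /hM[[B B'] /= [/set_mem Bt /set_mem Bt'] [oB oB' /eqP BB']].
have n1 : nbhs t (gamma @^-1` B).
  by apply: (geodesic_at_continuous (gg t gt)); exact: open_nbhs_nbhs.
have n2 : nbhs t (gamma' @^-1` B').
  by apply: (geodesic_at_continuous (gg' t gt)); exact: open_nbhs_nbhs.
have [d d0 dP] := near_radius2 n1 n2.
pose u := Num.max a (t - d / 2); have ut : u < t by rewrite gt_max at_ /=; lra.
have [|Bu B'u] := dP u.
  rewrite ltr0_norm ?subr_lt0 //.
  by have : t - d / 2 <= u; [rewrite /u le_max lexx orbT|lra].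
have E : gamma u = gamma' u by apply: H; rewrite ut /u le_max lexx.
by have : (B `&` B') (gamma u) by [split=> //; rewrite E]; rewrite BB'.
Qed.

Definition unit_geodesic gamma (L : R) := forall s, 0 <= s <= L -> geodesic_at g 1 gamma s.

Lemma geodesic_unit x y (L : R) gamma : geodesic g x y L gamma -> unit_geodesic gamma L.
Proof.
move=> [L0 _ _ [e e0 /unit_speed_geodesic_at H]] s /andP[s0 sL].
by apply: H; [exact: interval_open|rewrite /= in_itv /=; lra].
Qed.

(** A unit speed geodesic of length at most [r], rescaled to unit time, has squared speed at most
    [sigma] and so is an edge. *)
Let r := Num.sqrt sigma.
Let r0 : 0 < r. Proof. by rewrite sqrtr_gt0. Qed.
Let r2 : r ^+ 2 = sigma. Proof. by rewrite sqr_sqrtr // ltW. Qed.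

Lemma unit_geodesic_scale gamma (L q s : R) : unit_geodesic gamma L -> 0 <= q * s <= L ->
  geodesic_at g (q ^+ 2) (fun t => gamma (q * t)) s.
Proof.
move=> gg qs; have -> : (fun t => gamma (q * t)) = (fun t => gamma (q * t + 0)).
  by apply/funext => t; rewrite addr0.
by rewrite -[q ^+ 2]mulr1; apply: geodesic_at_affine; rewrite addr0; exact: gg.
Qed.

Lemma unit_geodesic_shift gamma (L u L' : R) : unit_geodesic gamma L -> 0 <= u -> u + L' <= L ->
  unit_geodesic (fun t => gamma (u + t)) L'.
Proof.
move=> gg u0 uL s /andP[s0 sL]; have -> : (fun t => gamma (u + t)) = (fun t => gamma (1 * t + u)).
  by apply/funext => t; rewrite mul1r addrC.
have h : geodesic_at g 1 gamma (1 * s + u) by rewrite mul1r; apply: gg; lra.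
by have := geodesic_at_affine h; rewrite expr1n mulr1.
Qed.

Lemma unit_geodesic_rev gamma (L : R) : unit_geodesic gamma L -> unit_geodesic (fun t => gamma (L - t)) L.
Proof.
move=> gg s /andP[s0 sL]; have -> : (fun t => gamma (L - t)) = (fun t => gamma (-1 * t + L)).
  by apply/funext => t; congr gamma; ring.
have h : geodesic_at g 1 gamma (-1 * s + L) by apply: gg; lra.
by have := geodesic_at_affine h; rewrite sqrrN expr1n mulr1.
Qed.

(** Rescaling time by [r] turns unit speed into squared speed [sigma], so that [slow_continuation]
    applies to geodesics of any length. *)
Lemma unit_continuation gamma gamma' (a b : R) : 0 < a -> unit_geodesic gamma b -> unit_geodesic gamma' b ->
  (forall s, 0 <= s <= a -> gamma s = gamma' s) -> forall s, 0 <= s <= b -> gamma s = gamma' s.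
Proof.
move=> a0 gg gg' ga s /andP[s0 sb].
have [ab|ba] := leP a b; last by apply: ga; rewrite s0 (le_trans sb) // ltW.
have rs t : t = r * (t / r) by rewrite mulrC divfK // gt_eqF.
have H := @slow_continuation sigma (fun t => gamma (r * t)) (fun t => gamma' (r * t)) (a / r) (b / r).
rewrite (rs s); apply: H => //.
- by rewrite divr_gt0.
- by rewrite ler_pM2r ?invr_gt0.
- move=> t /andP[t0]; rewrite ler_pdivlMr // mulrC => tb; rewrite -r2.
  by apply: (unit_geodesic_scale gg); rewrite tb mulr_ge0 // ltW.
- move=> t /andP[t0]; rewrite ler_pdivlMr // mulrC => tb; rewrite -r2.
  by apply: (unit_geodesic_scale gg'); rewrite tb mulr_ge0 // ltW.
- by move=> t /andP[t0]; rewrite ler_pdivlMr // mulrC => tb; apply: ga; rewrite tb mulr_ge0 // ltW.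
- by rewrite divr_ge0 ?(ltW r0) //= ler_pM2r ?invr_gt0.
Qed.

Lemma short_geodesic_edge gamma (L : R) i : unit_geodesic gamma L -> 0 <= L <= r ->
  in_box (bx i) (rho (bx i)) (gamma 0) ->
  in_cbox (bx i) (2 * rho (bx i)) (gamma L) /\
  let u := coord (box_chart (bx i)) (gamma 0) in let w := coord (box_chart (bx i)) (gamma L) in
  (forall s, unit_itv s -> gamma (L * s) = param (box_chart (bx i)) ((edge (bx i) u w).1 s)) /\
  L ^+ 2 = edge_energy (bx i) u w.
Proof.
move=> gg /andP[L0 Lr] i0.
have gL s : unit_itv s -> geodesic_at g (L ^+ 2) (fun t => gamma (L * t)) s.
  move=> /andP[s0 s1]; apply: (unit_geodesic_scale gg).
  by rewrite mulr_ge0 //= ler_piMr.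
have Lb : L ^+ 2 <= edge_bound (bx i).
  by rewrite (le_trans _ (sigma_le i)) // -r2 lerXn2r // nnegrE // ltW.
have [|st] := geodesic_edge gL Lb; first by left; rewrite mulr0.
rewrite /= mulr0 mulr1 => H; split=> //; apply: in_box_cbox.
by have := st 1; rewrite mulr1; apply; rewrite /unit_itv /=; lra.
Qed.

(** Rescaled to unit time, both are the same edge, and the squared length is the energy of that
    edge. *)
Lemma short_geodesic_unique gamma gamma' (L L' : R) : unit_geodesic gamma L -> unit_geodesic gamma' L' ->
  0 < L <= r -> 0 < L' <= r -> gamma 0 = gamma' 0 -> gamma L = gamma' L' ->
  L = L' /\ forall s, 0 <= s <= L -> gamma s = gamma' s.
Proof.
move=> gg gg' /andP[L0 Lr] /andP[L0' Lr'] e0 eL.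
have [i i0] := bx_cover (gamma 0).
have [|_ /= [E1 E2]] := short_geodesic_edge gg _ i0; first by rewrite ltW.
rewrite e0 in i0; have [|_ /= [E1' E2']] := short_geodesic_edge gg' _ i0; first by rewrite ltW.
have LL : L = L'.
  apply/eqP; rewrite -(eqrXn2 (n := 2)) ?(ltW L0) ?(ltW L0') //; apply/eqP.
  by rewrite E2 E2' e0 eL.
split=> // s /andP[s0 sL]; have sE : s = L * (s / L) by rewrite mulrC divfK // gt_eqF.
have u01 : unit_itv (s / L) by rewrite /unit_itv /= divr_ge0 ?(ltW L0) //= ler_pdivrMr // mul1r.
by subst L'; rewrite sE E1 // E1' // e0 eL.
Qed.

(** A short loop would be the edge from a point to itself, of energy zero by [edge_energy_bound],
    while this energy is the squared length. *)
Lemma no_short_loop gamma (L s s' : R) : unit_geodesic gamma L -> 0 <= s < s' -> s' <= L ->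
  s' - s <= r -> gamma s = gamma s' -> False.
Proof.
move=> gg /andP[s0 ss'] sL sr E.
have gs : unit_geodesic (fun t => gamma (s + t)) (s' - s).
  by apply: unit_geodesic_shift gg _ _ => //; lra.
have [i i0] := bx_cover (gamma s).
have [||[_ zw] /= [_]] := short_geodesic_edge (i := i) gs; first by lra.
  by rewrite addr0.
have s'E : s + (s' - s) = s' by ring.
rewrite addr0 s'E -E => /esym LE.
have zu : cbox (center (bx i)) (2 * rho (bx i)) (coord (box_chart (bx i)) (gamma s)).
  by move: zw; rewrite /= s'E -E.
have := edge_energy_bound zu zu; rewrite LE subrr normr0 expr0n mulr0 leNgt.
by rewrite exprn_gt0 // subr_gt0.
Qed.

End FixedCover.
End UniqueContinuation.

(** * Counting geodesics *)

Section Coding.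
Context {R : realType} {n : nat}.
Variables (M : closed_connected_manifold R n) (g : riemannian_metric M).
Local Notation box := (good_box g).
Local Notation curve := (R * (R -> M))%type.
Implicit Types (gamma : R -> M) (x y z : M) (s t u L a b : R) (c : curve).

Lemma geodesicP x y L gamma : geodesic g x y L gamma <-> [/\ 0 < L, gamma 0 = x, gamma L = y &
  exists2 e : R, 0 < e & forall s, - e < s < L + e -> geodesic_at g 1 gamma s].
Proof.
split=> -[L0 g0 gL [e e0 H]]; split=> //; exists e => //.
  by move=> s se; move/unit_speed_geodesic_at: H; apply; [exact: interval_open|rewrite /= in_itv].
by apply/unit_speed_geodesic_at; [exact: interval_open|move=> s; rewrite /= in_itv; exact: H].
Qed.

Lemma sub_geodesic x y L gamma u u' : geodesic g x y L gamma -> 0 <= u -> u < u' -> u' <= L ->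
  geodesic g (gamma u) (gamma u') (u' - u) (fun s => gamma (u + s)).
Proof.
move=> /geodesicP[L0 g0 gL [e e0 H]] u0 uu' uL; apply/geodesicP; split=> //.
- by rewrite subr_gt0.
- by rewrite addr0.
- by congr gamma; ring.
exists e => // s se; have -> : (fun s => gamma (u + s)) = (fun s => gamma (1 * s + u)).
  by apply/funext => v; rewrite mul1r addrC.
have h : geodesic_at g 1 gamma (1 * s + u) by rewrite mul1r; apply: H; lra.
by have := geodesic_at_affine h; rewrite expr1n mulr1.
Qed.

(** Without a first hitting time, avoidance of [z] would propagate up to [b] by real induction. *)
Lemma first_hit gamma z a b : a <= b -> (forall s, a <= s <= b -> {for s, continuous gamma}) ->
  gamma a <> z -> gamma b = z ->
  exists u, [/\ a < u <= b, gamma u = z & forall s, a <= s < u -> gamma s <> z].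
Proof.
move=> ab gc ga gb; apply: contrapT => nH.
have oz : open (~` [set z]).
  by apply: closed_openC; apply: compact_closed; [exact: manifold_hausdorff|exact: compact_set1].
suff : gamma b <> z by [].
apply: (@real_induction R (fun s => gamma s <> z) a b) => //; last by rewrite ab lexx.
- move=> t /andP[at_ tb] H; have tab : a <= t <= b by rewrite at_ ltW.
  have : nbhs t (gamma @^-1` (~` [set z])).
    by apply: (gc t tab); apply: open_nbhs_nbhs; split=> //; apply: H; rewrite at_ lexx.
  move=> /nbhs_ballP[d /= d0 dP]; exists d => // s /andP[ts sd]; apply: dP.
  by rewrite -ball_normE /= ltr0_norm ?subr_lt0 //; lra.
- by move=> t /andP[at_ tb] H tz; apply: nH; exists t; split=> //; rewrite at_.
Qed.

Definition same c c' := c.1 = c'.1 /\ forall s, 0 <= s <= c.1 -> c.2 s = c'.2 s.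

Lemma same_sym c c' : same c c' -> same c' c.
Proof. by move=> [E H]; split=> // s; rewrite -E => /H. Qed.

(* [X] has at most [N] elements, up to the irrelevant values of curves outside [[0, L]]. *)
Definition codable (X : set curve) (N : nat) := exists code : curve -> nat,
  (forall c, X c -> (code c < N)%N) /\ forall c c', X c -> X c' -> code c = code c' -> same c c'.

Lemma codable_sub X Y N : X `<=` Y -> codable Y N -> codable X N.
Proof.
move=> XY [code [cN cI]]; exists code; split=> [c /XY/cN //|c c' /XY Yc /XY Yc'].
exact: cI.
Qed.

Lemma Gamma_mono t t' x y : t <= t' -> Gamma g t x y `<=` Gamma g t' x y.
Proof. by move=> tt' c [gc ct px py]; split=> //; exact: le_trans tt'. Qed.

Lemma mixed_radix (N q q' v v' : nat) : (v < N)%N -> (v' < N)%N -> (q * N + v = q' * N + v')%N ->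
  q = q' /\ v = v'.
Proof.
move=> vN vN' E; have N0 : (0 < N)%N by exact: leq_ltn_trans vN.
have := congr1 (divn^~ N) E; have := congr1 (modn^~ N) E.
by rewrite !modnMDl !modn_small // !divnMDl // !divn_small // !addn0.
Qed.

Lemma mixed_radix_lt (N Q q v : nat) : (q < Q)%N -> (v < N)%N -> (q * N + v < Q * N)%N.
Proof.
move=> qQ vN; apply: (@leq_trans (q.+1 * N)); last by rewrite leq_mul2r qQ orbT.
by rewrite mulSn addnC ltn_add2r.
Qed.

Section FixedCover.
Variables (m : nat) (bx : 'I_m.+1 -> box).
Hypothesis bx_cover : forall x, exists i, in_box (bx i) (rho (bx i)) x.
Variable sigma : R.
Hypothesis sigma_gt0 : 0 < sigma.
Hypothesis sigma_le : forall i, sigma <= edge_bound (bx i).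
Let r := Num.sqrt sigma.
Let r0 : 0 < r. Proof. by rewrite sqrtr_gt0. Qed.

(** By unique continuation the curves agree as long as both run. If one were longer, it would pass
    through [y] in its interior where the other ends, which [Gamma] forbids. *)
Lemma Gamma_prefix t x y c c' a : Gamma g t x y c -> Gamma g t x y c' -> 0 < a ->
  (forall s, 0 <= s <= a -> c.2 s = c'.2 s) -> same c c'.
Proof.
wlog cc' : c c' / c.1 <= c'.1.
  move=> W Gc Gc' a0 H; have [cc'|/ltW cc'] := leP c.1 c'.1; first exact: W.
  by apply: same_sym; apply: W => // s /H.
move=> [gc _ _ _] [gc' _ _ py'] a0 H.
have uc := geodesic_unit gc; have uc' := geodesic_unit gc'.
have uc'' : unit_geodesic g c'.2 c.1.
  by move=> s /andP[s0 sc]; apply: uc'; rewrite s0 (le_trans sc).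
have E := unit_continuation bx_cover sigma_gt0 sigma_le a0 uc uc'' H.
split=> //; apply/eqP; rewrite eq_le cc' leNgt; apply/negP => lt.
have [c0 _ cy _] := gc; apply: py'; exists c.1; first by rewrite c0.
by rewrite -E // lexx ltW.
Qed.

Lemma Gamma_suffix t x y c c' a : Gamma g t x y c -> Gamma g t x y c' -> 0 < a ->
  (forall s, 0 <= s <= a -> c.2 (c.1 - s) = c'.2 (c'.1 - s)) -> same c c'.
Proof.
wlog cc' : c c' / c.1 <= c'.1.
  move=> W Gc Gc' a0 H; have [cc'|/ltW cc'] := leP c.1 c'.1; first exact: W.
  by apply: same_sym; apply: W => // s /H.
move=> [gc _ _ _] [gc' _ px' _] a0 H.
have uc := unit_geodesic_rev (geodesic_unit gc); have uc' := unit_geodesic_rev (geodesic_unit gc').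
have uc'' : unit_geodesic g (fun t => c'.2 (c'.1 - t)) c.1.
  by move=> s /andP[s0 sc]; apply: uc'; rewrite s0 (le_trans sc).
have E := unit_continuation bx_cover sigma_gt0 sigma_le a0 uc uc'' H.
have [c0 cx _ _] := gc.
have LL : c.1 = c'.1.
  apply/eqP; rewrite eq_le cc' leNgt; apply/negP => lt.
  apply: px'; exists (c'.1 - c.1); first by lra.
  by rewrite -E ?subrr // lexx ltW.
split=> // s /andP[s0 sc]; have := E (c.1 - s); rewrite -LL subKr; apply.
by lra.
Qed.

Lemma codable_short x y : codable (Gamma g r x y) 1.
Proof.
exists (fun=> 0%N); split=> // c c' [gc cr _ _] [gc' cr' _ _] _.
have [c0 cx cy _] := gc; have [c0' cx' cy' _] := gc'.
have [||||E H] := short_geodesic_unique bx_cover sigma_gt0 sigma_le (geodesic_unit gc) (geodesic_unit gc').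
- by rewrite c0.
- by rewrite c0'.
- by rewrite cx.
- by rewrite cy.
by split.
Qed.

(* A blocking point splits a geodesic in two pieces, one of which has at most half the length; cut at the first or
   last passage through that point, it is again one of the counted geodesics, and it determines the whole. *)
Lemma codable_half N (b : nat) t x y (B : set M) : (forall x y, codable (Gamma g (t / 2) x y) N) ->
  blocking_set g t x y B -> (#|` fset_set B| <= b)%N -> codable (Gamma g t x y) (b * 2 * N).
Proof.
move=> cdN [finB nBx nBy Bblock] Bb.
have [cd cdP] := fun_choice (fun p : M * M => cdN p.1 p.2).
(* The flag in [d] is true for a final piece and false for an initial one; then come the blocking
   point at which the curve is cut and the length of the piece. *)
pose piece (d : bool * M * R) c : curve := if d.1.1 then (d.2, fun s => c.2 (c.1 - d.2 + s)) else (d.2, c.2).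
pose ends (d : bool * M * R) := if d.1.1 then (d.1.2, y) else (x, d.1.2).
have H c : exists d : bool * M * R, Gamma g t x y c -> [/\ B d.1.2, 0 < d.2 < c.1 &
    Gamma g (t / 2) (ends d).1 (ends d).2 (piece d c)].
  have [Gc|nG] := pselect (Gamma g t x y c); last by exists (true, x, 0).
  have [z Bz [u0 /andP[u00 u0c] cz]] := Bblock c Gc; have [gc ct px py] := Gc.
  have [c0 cx cy _] := gc; have uc := geodesic_unit gc.
  (* A passage in the first half yields an initial piece, cut at the first passage. Otherwise the
     first passage of the reversed curve, that is the last one, yields a final piece of less than
     half the length. *)
  have [u0h|u0h] := leP u0 (c.1 / 2).
    have [||||u [/andP[u1 u2] cu hu]] := @first_hit c.2 z 0 u0.
    - exact: ltW.
    - by move=> s /andP[s0 su]; apply: geodesic_at_continuous (uc s _); lra.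
    - by rewrite cx => xz; rewrite xz in nBx.
    - exact: cz.
    exists (false, z, u) => _; rewrite /ends /piece /=; split=> //; first by lra.
    split=> /=.
    - have uc1 : u <= c.1 by lra.
      have := sub_geodesic gc (lexx 0) u1 uc1; rewrite cx cu subr0.
      by have -> : (fun s => c.2 (0 + s)) = c.2 by apply/funext => s; rewrite add0r.
    - by lra.
    - by move=> [s /andP[s0 su] cs]; apply: px; exists s => //; lra.
    - by move=> [s /andP[s0 su] cs]; apply: (hu s) => //; lra.
  have [||||v [/andP[v1 v2] cv hv]] := @first_hit (fun s => c.2 (c.1 - s)) z 0 (c.1 - u0).
  - by lra.
  - move=> s /andP[s0 su]; apply: geodesic_at_continuous (unit_geodesic_rev uc _); lra.
  - by rewrite subr0 cy => yz; rewrite yz in nBy.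
  - by rewrite subKr.
  exists (true, z, v) => _; rewrite /ends /piece /=; split=> //; first by lra.
  split=> /=.
  - have h1 : 0 <= c.1 - v by lra.
    have h2 : c.1 - v < c.1 by lra.
    by have := sub_geodesic gc h1 h2 (lexx _); rewrite cv cy subKr.
  - by lra.
  - move=> [s /andP[s0 su] cs]; apply: (hv (v - s)); first by lra.
    by rewrite -cs; congr c.2; ring.
  - by move=> [s /andP[s0 su] cs]; apply: py; exists (c.1 - v + s) => //; lra.
have {H}[D DP] := fun_choice H.
(* The code lists blocking point, flag and code of the piece in mixed radix, so it takes at most
   [b * 2 * N] values. *)
pose q c := (index (D c).1.2 (fset_set B) * 2 + (D c).1.1)%N.
pose sub c := cd (ends (D c)) (piece (D c) c).
have mem c : Gamma g t x y c -> (D c).1.2 \in (fset_set B : seq M).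
  by move=> /DP[Bz _ _]; rewrite -[_ \in _]/((D c).1.2 \in fset_set B) in_fset_set // inE.
have subN c : Gamma g t x y c -> (sub c < N)%N.
  by move=> /DP[_ _ Gp]; have [+ _] := cdP (ends (D c)); exact.
exists (fun c => q c * N + sub c)%N; split=> [c Gc|c c' Gc Gc'].
  apply: mixed_radix_lt; last exact: subN.
  have : (index (D c).1.2 (fset_set B) < b)%N.
    by apply: leq_trans Bb; rewrite index_mem; exact: mem.
  move=> ib; apply: (@leq_trans ((index (D c).1.2 (fset_set B)).+1 * 2)); last by rewrite leq_mul2r.
  by rewrite /q mulSn addnC ltn_add2r; case: (D c).1.1.
move=> /(mixed_radix (subN c Gc) (subN c' Gc'))[qE sE].
have hl (b' : bool) : (b' < 2)%N by case: b'.
have [iE hE] := mixed_radix (hl _) (hl _) qE.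
have zE : (D c).1.2 = (D c').1.2.
  by rewrite -(nth_index x (mem c Gc)) -(nth_index x (mem c' Gc')) iE.
have {hE}hE : (D c).1.1 = (D c').1.1 by move: hE; do 2 case: (_.1.1).
have eE : ends (D c) = ends (D c') by rewrite /ends zE hE.
have [_ /andP[u0 uc] Gp] := DP c Gc; have [_ /andP[u0' uc'] Gp'] := DP c' Gc'.
have [_ inj] := cdP (ends (D c)); rewrite -eE in Gp'; move: sE; rewrite /sub -eE.
move=> /(inj _ _ Gp Gp'); rewrite /piece -hE; case: ifP => _ [/= uE pE].
  apply: (Gamma_suffix Gc Gc' u0) => s /andP[s0 su].
  have := pE ((D c).2 - s); rewrite -uE => pE'.
  have -> : c.1 - s = c.1 - (D c).2 + ((D c).2 - s) by ring.
  by rewrite pE'; [congr c'.2; ring|lra].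
by apply: (Gamma_prefix Gc Gc' u0) => s; exact: pE.
Qed.

(** Two loops with the same first return agree until the shorter one ends at [x]. If their lengths
    were different with the same integer part in units of [r], the rest of the longer one would be a
    loop shorter than [r]. *)
Lemma codable_loops N Q T x : codable (Gamma g T x x) N -> T < Q%:R * r ->
  codable [set c | geodesic g x x c.1 c.2 /\ c.1 <= T] (Q * N).
Proof.
move=> [cd [cdN cdI]] TQ.
have H c : exists u : R, geodesic g x x c.1 c.2 /\ c.1 <= T -> [/\ 0 < u, u <= c.1 & Gamma g T x x (u, c.2)].
  have [[gc cT]|nG] := pselect (geodesic g x x c.1 c.2 /\ c.1 <= T); last by exists 0.
  have [c0 cx cy _] := gc; have uc := geodesic_unit gc.
  (* There is no return to [x] within time [r], so the first return can be searched for from the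
     positive time [a], where the curve is away from [x]. *)
  pose a := Num.min r c.1 / 2; have mn0 : 0 < Num.min r c.1 by rewrite lt_min r0.
  have mr : Num.min r c.1 <= r by rewrite ge_min lexx.
  have mc : Num.min r c.1 <= c.1 by rewrite ge_min lexx orbT.
  have a0 : 0 < a by rewrite divr_gt0.
  have ar : a < r by rewrite /a; lra.
  have ac : a < c.1 by rewrite /a; lra.
  have nh s : 0 < s -> s <= a -> c.2 s <> x.
    move=> s0 sa cs; have s0' : 0 <= (0 : R) < s by rewrite lexx.
    apply: (no_short_loop bx_cover sigma_gt0 sigma_le uc s0'); [lra| |by rewrite cx].
    by rewrite subr0 -/r; lra.
  have [||||u [/andP[u1 u2] cu hu]] := @first_hit c.2 x a c.1.
  - exact: ltW.
  - by move=> s /andP[s0 su]; apply: geodesic_at_continuous (uc s _); lra.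
  - exact: nh.
  - exact: cy.
  have u0 : 0 < u by lra.
  have nohit s : 0 < s < u -> c.2 s <> x.
    by move=> /andP[s0 su]; have [sa|as_] := leP s a; [exact: nh|apply: hu; lra].
  exists u => _; split=> //; split=> /=; [|lra|by move=> [s /nohit]|by move=> [s /nohit]].
  have := sub_geodesic gc (lexx 0) u0 u2; rewrite cx cu subr0.
  by have -> : (fun s => c.2 (0 + s)) = c.2 by apply/funext => s; rewrite add0r.
have {H}[D DP] := fun_choice H.
pose q c := Num.truncn (c.1 / r).
have subN c : geodesic g x x c.1 c.2 /\ c.1 <= T -> (cd (D c, c.2) < N)%N.
  by move=> /DP[_ _ Gp]; exact: cdN.
have qP c : geodesic g x x c.1 c.2 /\ c.1 <= T -> (q c)%:R * r <= c.1 < (q c).+1%:R * r.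
  move=> [[c0 _ _ _] _]; have h : 0 <= c.1 / r by rewrite divr_ge0 // ltW.
  by have := truncn_itv h; rewrite ler_pdivlMr // ltr_pdivrMr.
exists (fun c => q c * N + cd (D c, c.2))%N; split=> [c Xc|].
  apply: mixed_radix_lt; last exact: subN.
  have /andP[h _] := qP c Xc; have [_ cT] := Xc.
  by rewrite -(ltr_nat R) -(ltr_pM2r r0) (le_lt_trans h) // (le_lt_trans cT).
move=> c c'; wlog cc' : c c' / c.1 <= c'.1.
  move=> W Xc Xc' E; have [cc'|/ltW cc'] := leP c.1 c'.1; first exact: W.
  by apply: same_sym; exact: W.
move=> Xc Xc' /(mixed_radix (subN c Xc) (subN c' Xc'))[qE sE].
have [u0 uc Gp] := DP c Xc; have [u0' uc' Gp'] := DP c' Xc'.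
have [/= uE pE] := cdI _ _ Gp Gp' sE.
have [gc cT] := Xc; have [gc' cT'] := Xc'.
have vc := geodesic_unit gc; have vc' := geodesic_unit gc'.
have vc'' : unit_geodesic g c'.2 c.1.
  by move=> s /andP[s0 sc]; apply: vc'; rewrite s0 (le_trans sc).
have E := unit_continuation bx_cover sigma_gt0 sigma_le u0 vc vc'' pE.
split=> //; apply/eqP; rewrite eq_le cc' leNgt; apply/negP => lt.
have [c0 cx cy _] := gc; have [_ _ cy' _] := gc'.
have cc : 0 <= c.1 < c'.1 by rewrite ltW.
apply: (no_short_loop bx_cover sigma_gt0 sigma_le vc' cc (lexx _)).
  have /andP[h _] := qP c Xc; have /andP[_ h'] := qP c' Xc'.
  rewrite -/r; rewrite -qE -natr1 mulrDl mul1r in h'; lra.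
by rewrite cy' -E ?cy // lexx ltW.
Qed.

End FixedCover.
End Coding.

(** * Growth of the number of geodesics and of word balls *)

Section Counting.
Context {R : realType} {n : nat}.
Variables (M : closed_connected_manifold R n) (g : riemannian_metric M).
Local Notation box := (good_box g).
Variables (m : nat) (bx : 'I_m.+1 -> box).
Hypothesis bx_cover : forall x, exists i, in_box (bx i) (rho (bx i)) x.
Variable sigma : R.
Hypothesis sigma_gt0 : 0 < sigma.
Hypothesis sigma_le : forall i, sigma <= edge_bound (bx i).
Local Notation r := (Num.sqrt sigma).
Implicit Types (x y : M) (t : R).

(** The slack [1] makes the bound on the threshold strict, so that the infimum yields an actual
    blocking set. *)
Lemma blocking_set_small t (S : R) x y : (blocking_cost g t <= S%:E)%E ->
  exists2 B, blocking_set g t x y B & #|` fset_set B|%:R <= S + 1.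
Proof.
move=> cS; have : (blocking_threshold g t x y < (S + 1)%:E)%E.
  apply: (@le_lt_trans _ _ S%:E); last by rewrite lte_fin ltrDl.
  by apply: le_trans cS; apply: ereal_sup_ubound; exists (x, y).
move=> /ereal_inf_lt[_ [B BB <-]]; rewrite lte_fin => /ltW BS; by exists B.
Qed.

Lemma codable_double N t (S : R) : (blocking_cost g (2 * t) <= S%:E)%E ->
  (forall x y, codable (Gamma g t x y) N) ->
  forall x y, codable (Gamma g (2 * t) x y) (Num.truncn (S + 1) * 2 * N).
Proof.
move=> cS cN x y; have [B BB BS] := blocking_set_small x y cS.
apply: (codable_half bx_cover sigma_gt0 sigma_le _ BB).
  by have -> : 2 * t / 2 = t by field.
by rewrite -(natrK #|` fset_set B| : Num.truncn (_%:R : R) = _); apply: le_truncn.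
Qed.

Section FiniteCost.
Hypothesis cost_finite : forall t, 0 < t -> blocking_cost g t <> +oo%E.

Lemma cost_bound t : 0 < t -> exists S : R, (blocking_cost g t <= S%:E)%E.
Proof.
move=> /cost_finite; case: (blocking_cost g t) => [s _|//|_]; first by exists s.
by exists 0; rewrite leNye.
Qed.

(** Doubles from the length [r], at which two points are joined by at most one geodesic; finiteness
    of the cost at each scale suffices. This supplies the starting value at [T0] of the exponential
    estimate. *)
Lemma codable_exists t : exists N, forall x y, codable (Gamma g t x y) N.
Proof.
have r0 : 0 < r by rewrite sqrtr_gt0.
have H i : exists N, forall x y, codable (Gamma g (r * 2 ^+ i) x y) N.
  elim: i => [|i [N IH]].
    by exists 1%N => x y; rewrite expr0 mulr1; exact: codable_short.
  have t0 : 0 < 2 * (r * 2 ^+ i) by rewrite !mulr_gt0 // exprn_gt0.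
  have [S cS] := cost_bound t0; have H := codable_double cS IH.
  by exists (Num.truncn (S + 1) * 2 * N)%N => x y; rewrite exprS mulrCA; exact: H.
have [N HN] := H (Num.truncn (t / r)).+1; exists N => x y; apply: codable_sub (HN x y).
apply: Gamma_mono; rewrite -ler_pdivrMl // mulrC.
have [t0|t0] := leP (t / r) 0; first by rewrite (le_trans t0) // exprn_ge0.
rewrite ltW // (lt_le_trans (truncnS_gt _)) // -natrX ler_nat.
by rewrite ltnW // ltn_expl.
Qed.

(** Doubling from [t] multiplies the bound by at most [2 * (S + 1) <= 4 * S] with
    [S = expR (eps * (2 * t))]. The exponents form a geometric series with sum at most [2 * eps]
    times the last length. *)
Lemma codable_exponential (eps T0 : R) N0 i : 0 <= eps -> 0 < T0 ->
  (forall t, T0 <= t -> (blocking_cost g t <= (expR (eps * t))%:E)%E) ->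
  (forall x y, codable (Gamma g T0 x y) N0) ->
  exists2 N, forall x y, codable (Gamma g (T0 * 2 ^+ i) x y) N &
    N%:R <= N0%:R * 4 ^+ i * expR (2 * eps * (T0 * 2 ^+ i)).
Proof.
move=> eps0 T00 cost cN0; elim: i => [|i [N IH NB]].
  exists N0 => [x y|]; first by rewrite expr0 mulr1.
  rewrite !expr0 !mulr1 ler_peMr // -expR0 ler_expR !mulr_ge0 // ltW //.
pose t := T0 * 2 ^+ i; have tT : T0 <= 2 * t.
  have : 1 <= 2 ^+ i :> R by rewrite exprn_ege1 // ler1n.
  rewrite -(ler_pM2l T00) mulr1 -/t; lra.
pose S := expR (eps * (2 * t)).
exists (Num.truncn (S + 1) * 2 * N)%N => [x y|].
  by rewrite exprS mulrCA; apply: codable_double IH x y; exact: cost.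
have S1 : 1 <= S.
  by rewrite -expR0 ler_expR mulr_ge0 //; lra.
have trS : (Num.truncn (S + 1))%:R <= S + 1 by rewrite truncn_le; lra.
rewrite !natrM.
have -> : N0%:R * 4 ^+ i.+1 * expR (2 * eps * (T0 * 2 ^+ i.+1)) =
    4 * S * (N0%:R * 4 ^+ i * expR (2 * eps * t)).
  have -> : 2 * eps * (T0 * 2 ^+ i.+1) = eps * (2 * t) + 2 * eps * t by rewrite exprS /t; ring.
  by rewrite expRD exprS /S; ring.
apply: ler_pM; [exact: mulr_ge0|exact: ler0n|lra|exact: NB].
Qed.

End FiniteCost.

Section Words.
Variable x0 : M.
Local Notation pi1 := (fundamental_group R x0).

Lemma coarse_generators (S : seq pi1) : exists K, forall b, b \in S -> coarse bx b K.+1.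
Proof.
suff [K HK] : exists K, forall K', (K <= K')%N -> forall b, b \in S -> coarse bx b K'.+1.
  by exists K; exact: HK.
elim: S => [|a S [K IH]]; first by exists 0%N.
have [Ka Ha] := coarse_exists bx_cover a; exists (maxn K Ka) => K'.
rewrite geq_max => /andP[KK' KaK'] b; rewrite inE => /orP[/eqP ->|bS]; first exact: Ha.
exact: IH bS.
Qed.

Lemma coarse_word (S : seq pi1) K w : (forall b, b \in S -> coarse bx b K.+1) -> {subset w <= S} ->
  (0 < size w)%N -> coarse bx (\prod_(b <- w) b)%g (size w * K.+1).
Proof.
move=> SK; elim: w => // b w IH wS _; have bS : coarse bx b K.+1 by apply/SK/wS; rewrite mem_head.
rewrite big_cons; have [w0|w0] := posnP (size w).
  by rewrite (size0nil w0) big_nil mulg1 mul1n.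
rewrite mulSn; apply: coarse_mul => //; first by rewrite muln_gt0 w0.
by apply: IH => // c cw; apply: wS; rewrite inE cw orbT.
Qed.

Lemma word_loops (S : seq pi1) : exists2 D : R, 0 < D & forall N a, word_ball S N a -> a <> 1%g ->
  exists c : R * (R -> M), [/\ geodesic g x0 x0 c.1 c.2, c.1 <= D * N%:R & represents c.2 c.1 a].
Proof.
have [K HK] := coarse_generators (S ++ [seq (b^-1)%g | b <- S]).
have [C C0 CP] := geodesic_loops bx_cover sigma_gt0 sigma_le x0.
exists (C * K.+1%:R) => [|N a [w [wN wS] aE] a1]; first by rewrite mulr_gt0 // ltr0n.
have w0 : (0 < size w)%N.
  by rewrite lt0n; apply/eqP => /size0nil w0; apply: a1; rewrite aE w0 big_nil.
have := coarse_word HK wS w0; rewrite -aE => ca.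
have KE : (size w * K.+1)%N = (size w * K.+1).-1.+1 by rewrite prednK // muln_gt0 w0.
rewrite KE in ca; have [L [gamma [gg LC rep]]] := CP a _ ca a1.
exists (L, gamma); split=> //=; rewrite (le_trans LC) // -KE -mulrA ler_pM2l // -natrM ler_nat.
by rewrite mulnC leq_mul2l wN orbT.
Qed.

(** Loops with the same code are the same curve and represent one class only, so choosing a loop for
    each nontrivial element gives an injective code; the identity receives the extra code [Q]. *)
Lemma growth_le (S : seq pi1) D N T Q : (forall a, word_ball S N a -> a <> 1%g ->
    exists c : R * (R -> M), [/\ geodesic g x0 x0 c.1 c.2, c.1 <= D * N%:R & represents c.2 c.1 a]) ->
  D * N%:R <= T -> codable [set c | geodesic g x0 x0 c.1 c.2 /\ c.1 <= T] Q -> (growth S N <= Q.+1)%N.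
Proof.
move=> HD DT [code [codeQ codeI]].
have H a : exists c : R * (R -> M), word_ball S N a -> a <> 1%g ->
    [/\ geodesic g x0 x0 c.1 c.2, c.1 <= T & represents c.2 c.1 a].
  have [[ba a1]|na] := pselect (word_ball S N a /\ a <> 1%g).
    by have [c [c1 c2 c3]] := HD a ba a1; exists c => _ _; split=> //; exact: le_trans DT.
  by exists (0, fun=> x0) => ba a1; case: na.
have {H}[c cP] := fun_choice H.
pose code' a := if a == 1%g then Q else code (c a).
(* For an infinite set [fset_set] is empty by convention, and [growth] would be [0]. *)
have [fin|nfin] := pselect (finite_set (word_ball S N)); last first.
  by rewrite /growth /fset_set; case: pselect.
have memX a : a \in fset_set (word_ball S N) -> word_ball S N a by rewrite in_fset_set // inE.
have code'Q a : word_ball S N a -> (code' a < Q.+1)%N.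
  move=> ba; rewrite /code'; case: eqP => // a1; have [c1 c2 _] := cP a ba a1.
  by apply: leqW; apply: codeQ.
have := @uniq_leq_size _ [seq code' a | a <- fset_set (word_ball S N)] (iota 0 Q.+1).
rewrite size_map size_iota; apply.
  rewrite map_inj_in_uniq ?fset_uniq // => a a' /memX ba /memX ba'; rewrite /code'.
  case: eqP => [->|a1]; case: eqP => [-> //|a1'].
  - by have [c1 c2 _] := cP _ ba' a1' => E; have := codeQ _ (conj c1 c2); rewrite -E ltnn.
  - by have [c1 c2 _] := cP _ ba a1 => E; have := codeQ _ (conj c1 c2); rewrite E ltnn.
  have [c1 c2 c3] := cP _ ba a1; have [c1' c2' c3'] := cP _ ba' a1'.
  move=> /(codeI _ _ (conj c1 c2) (conj c1' c2'))[LE cE].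
  have [c0 _ _ _] := c1; rewrite -LE in c3'.
  apply: (represents_unique (f := (c a').2) _ c3').
  by apply: represents_ext c3 => //; exact: ltW.
by move=> _ /mapP[a /memX ba ->]; rewrite mem_iota /= add0n; exact: code'Q.
Qed.

End Words.
End Counting.

(** * Growth *)

Section Growth.
Context {R : realType}.

(** Absorbs factors that are polynomial in the length into the exponential. *)
Lemma le_exp_div (c x : R) : 0 < c -> x <= expR (c * x) / c.
Proof. by move=> c0; rewrite ler_pdivlMr // mulrC (le_trans _ (expR_ge1Dx _)) // lerDr. Qed.

Lemma dyadic_scale (a x : R) : 0 < a -> a <= x -> exists i : nat, x <= a * 2 ^+ i <= 2 * x.
Proof.
move=> a0 ax; have H : exists i : nat, x <= a * 2 ^+ i.
  exists (Num.truncn (x / a)).+1; rewrite mulrC -ler_pdivrMr //.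
  rewrite ltW // (lt_le_trans (truncnS_gt _)) // -natrX ler_nat.
  by rewrite ltnW // ltn_expl.
have [i xi imin] := ex_minnP H; exists i; rewrite xi /=.
case: i xi imin => [|i] xi imin; first by rewrite expr0 mulr1; lra.
have : a * 2 ^+ i < x by rewrite ltNge; apply/negP => /imin; rewrite ltnn.
by rewrite exprS mulrCA ler_pM2l // => /ltW.
Qed.

End Growth.

Section CostGrowth.
Context {R : realType} {n : nat}.
Variables (M : closed_connected_manifold R n) (g : riemannian_metric M).

Lemma cost_subexponential (eps : R) : 0 < eps -> (forall t : R, 0 < t -> blocking_cost g t <> +oo%E) ->
  (limf_esup (fun t : R => lne (blocking_cost g t) * (t^-1)%:E) +oo%R <= 0)%E ->
  exists2 T : R, 0 < T & forall t, T <= t -> (blocking_cost g t <= (expR (eps * t))%:E)%E.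
Proof.
move=> e0 fin lim0.
have : (limf_esup (fun t : R => lne (blocking_cost g t) * (t^-1)%:E) +oo%R < eps%:E)%E.
  by apply: le_lt_trans lim0 _; rewrite lte_fin.
move=> /ereal_inf_lt[_ [B [T [_ TB]] <-] Be].
exists (Num.max 0 T + 1) => [|t Tt].
  by rewrite ltr_pwDr // le_max lexx.
have t0 : 0 < t by rewrite (lt_le_trans _ Tt) // ltr_pwDr // le_max lexx.
have Bt : B t.
  by apply: TB; rewrite (lt_le_trans _ Tt) // ltr_pwDr // le_max lexx orbT.
have : (lne (blocking_cost g t) * (t^-1)%:E < eps%:E)%E.
  by apply: le_lt_trans Be; apply: ereal_sup_ubound; exists t.
move: (fin t t0); case: (blocking_cost g t) => [c _|//|_ _]; last by rewrite leNye.
rewrite /lne lee_fin; case: ifPn => [c0 _|]; first by rewrite (le_trans c0) // expR_ge0.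
rewrite -ltNge => c0; rewrite -EFinM lte_fin ltr_pdivrMr // => /ltW h.
by rewrite -[c]lnK ?posrE // ler_expR.
Qed.

End CostGrowth.

Section WordGrowth.
Context {R : realType} {n : nat}.
Variables (M : closed_connected_manifold R n) (g : riemannian_metric M) (x0 : M).
Local Notation pi1 := (fundamental_group R x0).

Lemma growth_subexponential (S : seq pi1) (del : R) : 0 < del ->
  (forall t : R, 0 < t -> blocking_cost g t <> +oo%E) ->
  (limf_esup (fun t : R => lne (blocking_cost g t) * (t^-1)%:E) +oo%R <= 0)%E ->
  exists C, 1 <= C /\ exists N0, forall N, (N0 <= N)%N -> (growth S N)%:R <= C * expR (del * N%:R).
Proof.
move=> del0 fin lim0.
have [m [bx bx_cover]] := finite_box_cover g x0.
have [sigma sigma0 sigmaP] := finite_lower_bound (fun i => edge_bound_gt0 (bx i)).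
have [D D0 DP] := word_loops bx_cover sigma0 sigmaP S.
(* The final bound contains the fifth power of [expR (eps * X)]: one for the number of length
   classes in units of [r], two for [4 ^+ i] and two for the exponential estimate. As
   [X <= 2 * (D * N%:R)], the exponent is at most [10 * eps * D * N%:R = del * N%:R]. *)
pose eps := del / (10 * D); have eps0 : 0 < eps by rewrite divr_gt0 // mulr_gt0.
have [T0 T00 cost] := cost_subexponential eps0 fin lim0.
have [K0 cK0] := codable_exists bx_cover sigma0 sigmaP fin T0.
set r := Num.sqrt sigma; have r0 : 0 < r by rewrite sqrtr_gt0.
pose C1 := 1 / (eps * r) + 1; pose C2 := 1 / (eps * T0).
have C10 : 0 <= C1 by rewrite addr_ge0 // divr_ge0 // mulr_ge0 // ltW.
have C20 : 0 <= C2 by rewrite divr_ge0 // mulr_ge0 // ltW.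
pose C := C1 * (K0%:R * C2 ^+ 2) + 1; exists C.
have C0 : 0 <= C1 * (K0%:R * C2 ^+ 2) by apply: mulr_ge0 => //; apply: mulr_ge0 => //; exact: exprn_ge0.
split; first by rewrite /C lerDr.
exists (Num.truncn (T0 / D)).+1 => N NN.
have DN : T0 <= D * N%:R.
  rewrite mulrC -ler_pdivrMr // ltW // (lt_le_trans (truncnS_gt _)) // ler_nat //.
have [i /andP[i1 i2]] := dyadic_scale T00 DN.
set X := T0 * 2 ^+ i in i1 i2.
have X0 : 0 < X by rewrite mulr_gt0 // exprn_gt0.
have [K cK KB] := codable_exponential bx_cover sigma0 sigmaP i (ltW eps0) T00 cost cK0.
rewrite -/X in cK KB.
have XQ : X < (Num.truncn (X / r)).+1%:R * r by rewrite -ltr_pdivrMr // truncnS_gt.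
have := growth_le (DP N) i1 (codable_loops bx_cover sigma0 sigmaP (cK x0 x0) XQ).
rewrite -(ler_nat R) -natr1 natrM => /le_trans; apply.
pose E := expR (eps * X); have E1 : 1 <= E by rewrite -expR0 ler_expR mulr_ge0 // ltW.
have h1 : (Num.truncn (X / r)).+1%:R <= C1 * E.
  rewrite -natr1 /C1 mulrDl [1 * E]mul1r; apply: lerD => //.
  have -> : 1 / (eps * r) * E = E / eps / r by rewrite invfM; ring.
  have : (Num.truncn (X / r))%:R <= X / r by rewrite truncn_le divr_ge0 // ltW.
  move=> /le_trans; apply.
  by rewrite ler_pM2r ?invr_gt0 //; exact: le_exp_div.
have h2 : 4 ^+ i <= (C2 * E) ^+ 2.
  have -> : 4 ^+ i = (2 ^+ i) ^+ 2 :> R by rewrite -exprM mulnC exprM; congr (_ ^+ _); ring.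
  have : 2 ^+ i <= C2 * E.
    have -> : 2 ^+ i = X / T0 :> R by rewrite /X [T0 * _]mulrC mulfK // gt_eqF.
    have -> : C2 * E = E / eps / T0 by rewrite /C2 invfM; ring.
    by rewrite ler_pM2r ?invr_gt0 //; exact: le_exp_div.
  by apply: lerXn2r; rewrite nnegrE ?exprn_ge0 // mulr_ge0 // (le_trans ler01).
have h3 : K%:R <= K0%:R * (C2 * E) ^+ 2 * E ^+ 2.
  apply: le_trans KB _.
  have -> : expR (2 * eps * X) = E ^+ 2 by rewrite -expRM_natl; congr expR; ring.
  by rewrite ler_wpM2r ?exprn_ge0 ?expR_ge0 // ler_wpM2l.
have h4 : (Num.truncn (X / r)).+1%:R * K%:R <= C1 * (K0%:R * C2 ^+ 2) * E ^+ 5.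
  have -> : C1 * (K0%:R * C2 ^+ 2) * E ^+ 5 = (C1 * E) * (K0%:R * (C2 * E) ^+ 2 * E ^+ 2) by ring.
  exact: ler_pM.
have h5 : E ^+ 5 <= expR (del * N%:R).
  rewrite -expRM_natl ler_expR.
  have -> : del * N%:R = 5 * (eps * (2 * (D * N%:R))) by rewrite /eps; field; lra.
  by rewrite ler_pM2l // ler_pM2l.
have h6 : 1 <= expR (del * N%:R) by apply: le_trans h5; rewrite exprn_ege1.
rewrite /C mulrDl mul1r lerD //; apply: (le_trans h4); by rewrite ler_wpM2l.
Qed.

End WordGrowth.

Theorem theorem1 (R : realType) (n : nat) (M : closed_connected_manifold R n)
    (x0 : M) (hpi1 : exponential_growth R (fundamental_group R x0))
    (g : riemannian_metric M) :
  (exists2 t : R, 0 < t & blocking_cost g t = +oo%E) \/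
  (0 < limf_esup (fun t : R => lne (blocking_cost g t) * (t^-1)%:E) +oo%R)%E.
Proof.
apply: contrapT => /not_orP[nfin /negP]; rewrite -leNgt => lim0.
have fin (t : R) : 0 < t -> blocking_cost g t <> +oo%E.
  by move=> t0 E; apply: nfin; exists t.
have [S _ Spos] := hpi1.
have [del del0 delP] : exists2 del : R, 0 < del &
    (del%:E < limn_esup (fun n => (ln (growth S n)%:R / n%:R : R)%:E))%E.
  move: Spos; case: (limn_esup _) => [l|_|//]; last by exists 1; rewrite ?ltr01 ?ltry.
  rewrite lte_fin => l0; exists (l / 2); first by rewrite divr_gt0.
  by rewrite lte_fin; lra.
(* One half of [del] bounds the growth, the other half absorbs [ln C] once [N] exceeds
   [ln C / (del / 2)]. *)
have [C [C1 [N0 CN]]] := growth_subexponential S (divr_gt0 del0 (ltr0n R 2)) fin lim0.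
have lC0 : 0 <= ln C by rewrite ln_ge0.
move: delP; rewrite ltNge => /negP; apply.
pose N1 := maxn N0 (Num.truncn (ln C / (del / 2))).+1.
have : (\oo : set_system nat) [set k | (N1 <= k)%N] by exists N1.
move=> N1P; apply: le_trans (ereal_inf_lbound _) _.
  by exists [set k | (N1 <= k)%N].
apply: ge_ereal_sup => _ [N /= NN <-]; rewrite lee_fin.
move: NN; rewrite geq_max => /andP[NN0 NN1].
have Npos : 0 < N%:R :> R by rewrite ltr0n (leq_trans _ NN1).
rewrite ler_pdivrMr //.
have lCN : ln C <= del / 2 * N%:R.
  rewrite mulrC -ler_pdivrMr ?divr_gt0 // ltW // (lt_le_trans (truncnS_gt _)) // ler_nat //.
have [G0|G0] := posnP (growth S N).
  by rewrite G0 ln0 // mulr_ge0 // ltW.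
have := CN N NN0; rewrite -ler_ln ?posrE ?ltr0n ?mulr_gt0 ?expR_gt0 //; last first.
  exact: lt_le_trans C1.
rewrite lnM ?posrE ?expR_gt0 //; last exact: lt_le_trans C1.
rewrite expRK; lra.
Qed.
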